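(* Suppose that conditions (A1), (A2), (A3) of the context hold and let $0<t<t_{\mathrm{sing}}$. Then the following hold. (a) The probability measure $\nu_t$ is the push-forward of $\nu_0$ under $T_t$: $(T_t)_\#\nu_0=\nu_t$. In particular, $\nu_t$ is concentrated on the domain $\mathcal{R}_t$. As another consequence, $\nu_t(\mathcal{E}_{s,t})=\alpha_0(s)$ for all $s>0$. (b) The distribution $\nu_t$ has a globally bounded Lebesgue density $p_t$ on $\mathbb{C}$. (c) The Stieltjes transform $m_t(z)=\int_{\mathbb{C}}\frac{1}{z-y}\,\nu_t(dy)$ of $\nu_t$ is continuous on $\mathbb{C}$ and satisfies $$m_t(T_t(w))=m_0(w)=\frac{\alpha_0(w)}{w}=\frac{\partial}{\partial t}T_t(w)\qquad\text{for all }w\in\mathbb{C}\setminus\{0\}.$$ (d) For every $z=T_t(w)\in\mathcal{R}_t$, the function $\alpha\mapsto f_t(\alpha,z)$, $\alpha\in[0,1]$, has a unique maximizer $\alpha_t(z)\in(0,1)$. Moreover, writing $\alpha_t(z)$ for the maximizer of $f_t(\cdot,z)$ on $[0,1]$, we have $\alpha_t(T_t(w))=\alpha_0(w)$ for all $w\in\mathbb{C}$. (e) The logarithmic potential $U_t$ of $\nu_t$ belongs to the class $C^1$ (that is, it is real continuously differentiable on $\mathbb{C}$) and satisfies $$U_t(T_t(w))=U_0(w)+\frac{\alpha_0(w)^2}{2}\operatorname{Re}\left(\frac{t}{w^2}\right)\qquad\text{for all }w\in\mathbb{C}\setminus\{0\}.$$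
   Context: Let $P_n(z)=\sum_{k=0}^n\xi_k a_{k;n}z^k$ with: (A1) $\xi_0,\xi_1,\ldots$ are i.i.d. complex-valued, non-degenerate (not almost surely constant) random variables with $\mathbb{E}\log(1+|\xi_0|)<\infty$. (A2) $a_{k;n}$ are deterministic complex coefficients such that for some continuous $g:[0,1]\to\mathbb{R}$, $\lim_{n\to\infty}\sup_{0\le k\le n}\left|\frac1n\log|a_{k;n}|-g\left(\frac kn\right)\right|=0$; moreover $g$ is concave and $g'_-(1)>-\infty$. (A3) $g$ is infinitely differentiable on $(0,1)$ and $g''(\alpha)<0$ for all $\alpha\in(0,1)$. With $g'(0):=\lim_{\alpha\downarrow0}g'(\alpha)\in(-\infty,+\infty]$ and $g'(1):=\lim_{\alpha\uparrow1}g'(\alpha)$ (finite): if $g'(0)=+\infty$, then additionally $\lim_{\alpha\downarrow0}\alpha e^{g'(\alpha)}=0$. For $z\in\mathbb{C}$, $\alpha_0(z)=\alpha_0(|z|)$ is the unique maximizer over $\alpha\in[0,1]$ of $g(\alpha)+\alpha\log|z|$: $\alpha_0(z)=0$ if $|z|\le e^{-g'(0)}$, $\alpha_0(z)=(g')^{-1}(-\log|z|)$ if $e^{-g'(0)}<|z|<e^{-g'(1)}$, $\alpha_0(z)=1$ if $|z|\ge e^{-g'(1)}$ (with $e^{-\infty}=0$). The transport map is $T_t(w)=w+t\frac{\alpha_0(w)}{w}$, $w\ne0$, and $T_t(0)=0$ (by continuity). Further, $$t_{\mathrm{sing}}=\left(\sup_{s\in(e^{-g'(0)},e^{-g'(1)})}\left|\left(\frac{\alpha_0(s)}{s}\right)'\right|\right)^{-1}=\inf_{\alpha\in(0,1)}\left|\frac{g''(\alpha)e^{-2g'(\alpha)}}{1+\alpha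 g''(\alpha)}\right|\quad(1/\infty=0),$$ $$\mathcal{E}_{s,t}=\left\{x+iy:\frac{x^2}{(s+t\alpha_0(s)/s)^2}+\frac{y^2}{(s-t\alpha_0(s)/s)^2}\le1\right\},$$ $$\mathcal{R}_t=\left\{z=x+iy:|z|>e^{-g'(0)},\ \frac{x^2}{(e^{-g'(1)}+te^{g'(1)})^2}+\frac{y^2}{(e^{-g'(1)}-te^{g'(1)})^2}<1\right\}.$$ For $t\in\mathbb{C}$, $\nu_t$ is the limit in probability (weak topology) of the empirical zero distributions (each zero, with multiplicity, gets weight $1/\deg$) of $\exp\{-\frac{t}{2n}\partial_z^2\}P_n$. The measure $\nu_0$ is rotationally invariant with $\nu_0(\{|z|<r\})=\alpha_0(r)$, $r>0$, and Stieltjes transform $m_0(z)=\int\frac{\nu_0(dy)}{z-y}=\frac{\alpha_0(z)}{z}$. For $t\ne0$, $\nu_t$ is the unique compactly supported probability measure with $\int\log|z-y|\,\nu_t(dy)=U_t(z)$, $z\in\mathbb{C}$, where $U_t(z)=\sup_{\alpha\in[0,1]}f_t(\alpha,z)-g(1)$, $f_t(\alpha,z)=g(\alpha)+\alpha\log\sqrt{|t|\alpha}+\alpha\Psi\left(\frac{z}{\sqrt{t\alpha}}\right)$ for $\alpha\in(0,1]$, $f_t(0,z)=g(0)$, and $$\Psi(z)=\frac14\operatorname{Re}\left(z^2-z\sqrt{z^2-4}\right)+\log\left|\frac{z+\sqrt{z^2-4}}{2}\right|-\frac12,$$ with $\sqrt{z^2-4}$ holomorphic on $\mathbb{C}\setminus[-2,2]$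 and $\sim z$ at infinity (on $[-2,2]$ either sign gives the same value). Also $U_0(z)=\int\log|z-w|\,\nu_0(dw)=\sup_{\alpha\in[0,1]}(g(\alpha)+\alpha\log|z|)-g(1)$ for $z\ne0$. *)

(* Defs.v *)
From HB Require Import structures.
From mathcomp Require Export all_boot all_order all_algebra.
From mathcomp Require Export complex.
From mathcomp Require Export all_classical all_reals all_analysis.

Set Implicit Arguments.
Unset Strict Implicit.
Unset Printing Implicit Defensive.

Import Order.TTheory GRing.Theory Num.Theory.
Import numFieldNormedType.Exports.

Local Open Scope classical_set_scope.
Local Open Scope ring_scope.
Local Open Scope complex_scope.

Local Notation normc := ComplexField.Normc.normc.

(* The complex plane is R * R wherever topology, real differentiability or
   measures are involved (product topology, product sigma-algebra), and R[i]
   wherever complex arithmetic is; [cplx] and [plane] are the mutually inverse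
   identifications.  The norm of R * R is the max norm, so the modulus of a
   point is always written [modulus]. *)
Section plane.
Context {R : realType}.

Definition cplx (z : R * R) : R[i] := z.1 +i* z.2.
Definition plane (w : R[i]) : R * R := (complex.Re w, complex.Im w).
Definition modulus (z : R * R) : R := normc (cplx z).

(* The library's Lebesgue measure lives on the alias [measurableTypeR R], which
   has the same sigma-algebra as R but another display. *)
Definition leb1 : set R -> \bar R := @lebesgue_measure R.

HB.instance Definition _ := isMeasure.Build _ R R leb1
  (measure0 (@lebesgue_measure R)) (measure_ge0 (@lebesgue_measure R))
  (@measure_semi_sigma_additive _ _ _ (@lebesgue_measure R)).

HB.instance Definition _ := Measure_isSigmaFinite.Build _ R R leb1
  (@sigma_finiteT _ _ _ (@lebesgue_measure R)).

Definition leb2 : {measure set (R * R) -> \bar R} := (leb1 \x leb1)%E.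

(* Real continuous differentiability on the whole plane. *)
Definition C1 (U : R * R -> R) : Prop :=
  (forall z, differentiable U z) /\
  (forall v : R * R, continuous (fun z => 'd U z v)).

End plane.

Section random_polynomial.
Context {R : realType} {d : measure_display} {Omega : measurableType d}.
Variable P : probability Omega R.

Definition independent_seq (xi : nat -> Omega -> R * R) : Prop :=
  forall (s : seq nat) (A : nat -> set (R * R)), uniq s ->
    (forall k, measurable (A k)) ->
    P (\bigcap_(k in [set` s]) (xi k @^-1` A k)) =
    (\prod_(k <- s) P (xi k @^-1` A k))%E.

Definition identically_distributed (xi : nat -> Omega -> R * R) : Prop :=
  forall (k : nat) (A : set (R * R)), measurable A ->
    P (xi k @^-1` A) = P (xi 0%N @^-1` A).

Definition condA1 (xi : nat -> {RV P >-> (R * R)%type}) : Prop :=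
  [/\ independent_seq xi,
      identically_distributed xi,
      ~ (exists c : R * R, {ae P, forall w, xi 0%N w = c}) &
      ('E_P[fun w => ln (1 + modulus (xi 0%N w))] < +oo)%E].

Definition rand_poly (xi : nat -> Omega -> R * R) (a : nat -> nat -> R[i])
    (n : nat) (w : Omega) : {poly R[i]} :=
  \sum_(k < n.+1) (cplx (xi k w) * a k n) *: 'X^k.

(* exp(c d^2/dz^2); the exponential series is a finite sum on polynomials. *)
Definition exp_D2 (c : R[i]) (p : {poly R[i]}) : {poly R[i]} :=
  \sum_(k < size p) (c ^+ k / (k`!)%:R) *: p^`(2 * k).

Definition zeros (p : {poly R[i]}) : seq R[i] :=
  sval (closed_field_poly_normal p).

Definition inv_deg (p : {poly R[i]}) : {nonneg R} := ((size p).-1%:R^-1)%:nng.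

(* If p is constant this is the null measure, since 0^-1 = 0; for the random
   polynomials below this happens with probability tending to 0. *)
Definition zero_distr (p : {poly R[i]}) : {measure set (R * R) -> \bar R} :=
  mscale (inv_deg p)
    (msum (fun k => \d_(plane (nth 0 (zeros p) k))) (size p).-1).

(* Convergence in probability for the weak topology, tested on bounded
   continuous functions. *)
Definition weak_limit_in_proba
    (mu : nat -> Omega -> {measure set (R * R) -> \bar R})
    (nu : {measure set (R * R) -> \bar R}) : Prop :=
  forall f : R * R -> R, continuous f -> (exists M : R, forall z, `|f z| <= M) ->
  forall eps : R, 0 < eps ->
    P [set w | eps <= `| \int[mu n w]_z f z - \int[nu]_z f z |]
      @[n --> \oo] --> 0%E.

Definition zero_limit (xi : nat -> Omega -> R * R) (a : nat -> nat -> R[i])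
    (t : R) (nu : {measure set (R * R) -> \bar R}) : Prop :=
  weak_limit_in_proba
    (fun n w => zero_distr
       (exp_D2 (- (t / (2 * n%:R))%:C) (rand_poly xi a n w))) nu.

End random_polynomial.

Section profile.
Context {R : realType}.
Implicit Types (g : R -> R) (t s a : R) (z : R * R).

(* [lne 0 = -oo], so the supremum is +oo as soon as some coefficient vanishes. *)
Definition condA2 g (coef : nat -> nat -> R[i]) : Prop :=
  [/\ {within `[0, 1], continuous g},
      (ereal_sup [set `| (n%:R^-1)%:E * lne (normc (coef k n))%:E
                         - (g (k%:R / n%:R))%:E | | k in [set k | (k <= n)%N]]
         @[n --> \oo] --> 0)%E,
      @convex_function R R^o `[0, 1] (fun x => - g x) &
      cvg ((g 1 - g (1 - h)) / h @[h --> 0^'+])].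

Definition dg0 g : \bar R := lim ((derive1 g x)%:E @[x --> 0^'+]).
Definition dg1 g : R := lim (derive1 g x @[x --> 1^'-]).

Definition condA3 g : Prop :=
  [/\ forall (n : nat) (x : R), 0 < x < 1 -> derivable (derive1n n g) x 1,
      forall x : R, 0 < x < 1 -> derive1n 2 g x < 0 &
      dg0 g = +oo%E -> x * expR (derive1 g x) @[x --> 0^'+] --> 0].

(* e^{-g'(0)} and e^{-g'(1)} *)
Definition rad0 g : R := fine (expeR (- dg0 g)).
Definition rad1 g : R := expR (- dg1 g).

Definition maximizer01 (F : R -> \bar R) a : Prop :=
  0 <= a <= 1 /\ forall b, 0 <= b <= 1 -> (F b <= F a)%E.

Definition unique_maximizer01 (F : R -> \bar R) a : Prop :=
  maximizer01 F a /\ forall b, maximizer01 F b -> b = a.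

Definition argmax01 (F : R -> \bar R) : R := xget 0 [set a | maximizer01 F a].

(* For r = 0 the objective is g 0 at x = 0 and -oo elsewhere, since
   [0 * -oo = 0] in \bar R. *)
Definition alpha0 g (r : R) : R :=
  argmax01 (fun x => (g x)%:E + x%:E * lne r%:E)%E.

Definition transport g t z : R * R :=
  if z == 0 then 0
  else plane (cplx z + t%:C * (alpha0 g (modulus z))%:C / cplx z).

Definition t_sing g : \bar R :=
  ((ereal_sup [set `| derive1 (fun r => alpha0 g r / r) s |%:E
              | s in [set s | (rad0 g < s < rad1 g)%R]])^-1)%E.

Definition Eset g s t : set (R * R) :=
  [set z | z.1 ^+ 2 / (s + t * alpha0 g s / s) ^+ 2
         + z.2 ^+ 2 / (s - t * alpha0 g s / s) ^+ 2 <= 1].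

Definition Rset g t : set (R * R) :=
  [set z | rad0 g < modulus z /\
           z.1 ^+ 2 / (rad1 g + t * expR (dg1 g)) ^+ 2
         + z.2 ^+ 2 / (rad1 g - t * expR (dg1 g)) ^+ 2 < 1].

(* The branch of sqrt(z^2 - 4) holomorphic off [-2, 2] and ~ z at infinity:
   [sqrtc] is the principal square root, with its cut on the negative axis,
   and the sign changes of the two factors cancel on ]-oo, -2[. *)
Definition sqrt_z24 (z : R[i]) : R[i] := sqrtc (z - 2) * sqrtc (z + 2).

Definition Psi (z : R[i]) : R :=
  complex.Re (z ^+ 2 - z * sqrt_z24 z) / 4
  + ln (normc ((z + sqrt_z24 z) / 2)) - 2^-1.

(* Only used for real t > 0, where sqrt (t a) is the real square root. *)
Definition f_ g t z a : R :=
  if a == 0 then g 0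
  else g a + a * ln (Num.sqrt (`|t| * a))
       + a * Psi (cplx z / (Num.sqrt (t * a))%:C).

Definition U_ g t z : R := sup [set f_ g t z a | a in `[0, 1]] - g 1.

Definition alpha_ g t z : R := argmax01 (fun a => (f_ g t z a)%:E).

End profile.

Section measures.
Context {R : realType}.
Implicit Types (nu : {measure set (R * R) -> \bar R}).

(* [lne 0 = -oo]: an atom of nu at z makes the potential -oo at z. *)
Definition log_potential nu (z : R * R) : \bar R :=
  (\int[nu]_y lne (modulus (z - y))%:E)%E.

Definition cauchy_kernel (z y : R * R) : R * R := plane (cplx (z - y))^-1.

Definition stieltjes_integrable nu (z : R * R) : Prop :=
  nu.-integrable setT (fun y => (cauchy_kernel z y).1%:E) /\
  nu.-integrable setT (fun y => (cauchy_kernel z y).2%:E).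

Definition stieltjes nu (z : R * R) : R * R :=
  (\int[nu]_y (cauchy_kernel z y).1, \int[nu]_y (cauchy_kernel z y).2).

Definition rotation_invariant nu : Prop :=
  forall (u : R[i]) (A : set (R * R)), normc u = 1 -> measurable A ->
    nu ((fun z => plane (u * cplx z)) @^-1` A) = nu A.

Definition compactly_supported nu : Prop :=
  exists2 K : set (R * R), compact K & nu (~` K) = 0%E.

(* These determine nu_0 and nu_t (t > 0) in terms of g. *)
Definition nu0_spec (g : R -> R) nu : Prop :=
  rotation_invariant nu /\
  forall r : R, 0 < r -> nu [set z | modulus z < r] = (alpha0 g r)%:E.

Definition nut_spec (g : R -> R) (t : R) nu : Prop :=
  compactly_supported nu /\
  forall z, log_potential nu z = (U_ g t z)%:E.

End measures.

(* Main.v *)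
(* The field h(w) = alpha0(|w|) / w, extended by h(0) = 0, is Lipschitz with a
   constant c such that t c < 1, so T = id + t h is a bi-Lipschitz bijection of
   the plane, which maps circles about 0 to ellipses.

   Let z = T(w), let W_a be the root of largest modulus of W + t a / W = z, and
   let s(a) = exp(-g'(a)) be the inverse function of alpha0.  Then d/da f_t(a, z)
   = g'(a) + ln|W_a| = ln (|W_a| / s(a)) has the sign of alpha0(w) - a, and
   W_a = w for a = alpha0(w).  Hence alpha0(w) is the maximizer and
   U_t(T(w)) = U_0(w) + alpha0(w)^2 Re(t / w^2) / 2.

   The logarithmic potential of the image of nu_0 under T at z is integrated over
   the layers alpha0(|v|) < a.  On the circle of radius s(a), the mean of
   ln|z - T(u v)| over the N-th roots of unity u is ln max(|W_a|, s(a)) up to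
   O(1 / N), because the N-th roots of unity turn the product of the factors
   into the explicit polynomials X^N - Y^N.  Integrating in a gives U_t(z).

   Two measures with the same potential are compared by smoothing with nu_0:
   the difference of the potentials of nu_0 at the scales 2e and e is a
   nonnegative kernel of compact support, whose convolutions with both measures
   agree; integrating these over boxes identifies the measures.

   By comparison with the Poisson kernel, nu_0 gives a disc of radius r a mass
   O(r^2); so does nu_t, whence the bounded density.  Finally
   |U_t(z + v) - U_t(z) - Re(h(w) v)| = O(|v|^2) yields both the C^1 property
   and, by the same mass bound, the Stieltjes transform m_t(T(w)) = h(w). *)
From HB Require Import structures.
Require Import Defs.
From mathcomp Require Import all_boot all_order all_algebra complex.
From mathcomp Require Import all_classical all_reals all_analysis.
From mathcomp Require Import measurable_realfun.
From mathcomp Require Import ring lra.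
Import Order.TTheory GRing.Theory Num.Theory.
Import numFieldNormedType.Exports.
Local Open Scope classical_set_scope.
Local Open Scope ring_scope.
Local Open Scope complex_scope.
Set Implicit Arguments.
Unset Strict Implicit.
Unset Printing Implicit Defensive.

Local Notation normc := ComplexField.Normc.normc.

(** The measure [nu_0] is known only through its rotation invariance and its masses of discs.
    Circular means are therefore taken over the N-th roots of unity: the bounded error of the sum is
    divided by [N], which is free to grow. No inverse of [T] is computed. A point is written [T w],
    and [w] is recovered as the larger root of [W + t alpha0(w) / W = T w], because [t c < 1] gives
    [t alpha0(r) < r^2]. The obstacle in the maximization is a focus: where [T w] is [2 sqrt (t a)]
    up to sign, the two roots merge and the root is no longer differentiable in [a]. This concerns
    at most one [a], so the mean value theorem is used with an exceptional point, and continuity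
    there is proved separately. Geometry and averaging are developed for [0 <= t]. With [t = 0] they
    yield the potential of [nu_0], which is why this same measure can serve as the mollifier when
    two measures with equal potentials are compared. *)

Lemma within_sub (R : realType) (f : R -> R) (a b c d : R) :
  {within `[a, b], continuous f} -> a <= c -> d <= b ->
  {within `[c, d], continuous f}.
Proof.
move=> cf ac db; apply: continuous_subspaceW cf => x /=.
by rewrite !in_itv/= => /andP[cx xd]; rewrite (le_trans ac cx) (le_trans xd db).
Qed.

Lemma is_derive_within (R : realType) (f f' : R -> R) (a b : R) :
  (forall x, a <= x <= b -> is_derive x 1 f (f' x)) ->
  {within `[a, b], continuous f}.
Proof.
move=> fd; apply: continuous_in_subspaceT => x; rewrite inE/= in_itv/= => xab.
by have [/derivable1_diffP/differentiable_continuous] := fd _ xab.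
Qed.

(** Serves [h_lip_high], where [b / u] is a value of [h] near the outer radius [r]. The numerator
    [u - b r] is at most [d (1 + r) = e r x] in absolute value, and [x <= u] makes its quotient by
    [r u] at most [e]. *)
Lemma inv_sub_frac_le (R : realType) (r u x b e : R) : 0 < e -> 0 < x -> x <= u ->
  u < r -> r - e * r * x / (1 + r) < u -> b < 1 ->
  1 - e * r * x / (1 + r) <= b -> `|r^-1 - b / u| <= e.
Proof.
set d := e * r * x / (1 + r) => e0 x0 xu ur ru b1 db.
have u0 : 0 < u by lra.
have r0 : 0 < r by lra.
have d0 : 0 < d by rewrite divr_gt0 ?addr_gt0// !mulr_gt0.
rewrite (_ : r^-1 - b / u = (u - b * r) / (r * u)); last by field; rewrite !gt_eqF.
rewrite normrM normfV (gtr0_norm (mulr_gt0 r0 u0)) ler_pdivrMr ?mulr_gt0//.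
apply: (@le_trans _ _ (d * (1 + r))).
  by clear -b1 r0 db d0 ur ru; rewrite ler_norml; apply/andP; split; nra.
by rewrite /d divfK ?gt_eqF ?addr_gt0// -mulrA ler_pM2l// ler_pM2l.
Qed.

(** * The maximizer alpha0 and its Lipschitz quotient *)

Section profile.
Context {R : realType}.
Implicit Types a b r x : R.
Variable g : R -> R.
Hypothesis g_cont : {within `[0, 1], continuous g}.
Hypothesis dg1_cvg : cvg ((g 1 - g (1 - h)) / h @[h --> 0^'+]).
Hypothesis A3 : condA3 g.

Let G : R -> R := derive1 g.
Let s (a : R) : R := expR (- G a).

Lemma dgP a : 0 < a < 1 -> is_derive a 1 g (G a).
Proof.
case: A3 => + _ _ => /(_ 0%N) h a01; rewrite /G derive1E; apply/derivableP.
exact: h.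
Qed.

Lemma ddgP a : 0 < a < 1 -> is_derive a 1 G (derive1n 2 g a).
Proof.
case: A3 => + _ _ => /(_ 1%N) h a01.
by rewrite [derive1n 2 g a]/= derive1E; apply/derivableP; exact: h.
Qed.

Lemma ddg_lt0 a : 0 < a < 1 -> derive1n 2 g a < 0.
Proof. by case: A3 => _ + _; exact. Qed.

Lemma dg_decr a b : 0 < a -> a < b -> b < 1 -> G b < G a.
Proof.
move=> a0 ab b1.
have [||c] := @MVT _ G (derive1n 2 g) a b ab.
- by move=> x; rewrite in_itv/= => /andP[ax xb]; apply: ddgP; lra.
- by apply: (is_derive_within (f' := derive1n 2 g)) => x /andP[ax xb]; apply: ddgP; lra.
rewrite in_itv/= => /andP[ac cb] e.
have d0 : derive1n 2 g c < 0 by apply: ddg_lt0; lra.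
by rewrite -subr_lt0 e nmulr_rlt0// subr_gt0.
Qed.

Lemma g_mvt a b : 0 <= a -> a < b -> b <= 1 ->
  exists2 c : R, a < c < b & g b - g a = G c * (b - a).
Proof.
move=> a0 ab b1.
have [||c + e] := @MVT _ g G a b ab; last by exists c.
- by move=> x; rewrite in_itv/= => /andP[ax xb]; apply: dgP; lra.
- exact: within_sub g_cont _ _.
Qed.

(** [G] is decreasing, so its limit at 0 exists as a supremum, the value +oo included. *)
Lemma dg0E : dg0 g = ereal_sup ((fun x => (G x)%:E) @` `]0%R, 1%R[).
Proof.
rewrite /dg0; apply/cvg_lim => //.
apply: (@nonincreasing_at_right_cvge _ (fun x => (G x)%:E) 0 (BLeft 1)).
  by rewrite bnd_simp.
move=> x y; rewrite !in_itv/= => /andP[x0 x1] /andP[y0 y1].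
rewrite le_eqVlt => /predU1P[->//|xy]; rewrite lee_fin.
by apply/ltW/dg_decr.
Qed.

Lemma dg_lt_dg0 a : 0 < a < 1 -> ((G a)%:E < dg0 g)%E.
Proof.
move=> /andP[a0 a1]; apply: (@lt_le_trans _ _ (G (a / 2))%:E).
  by rewrite lte_fin; apply: dg_decr; lra.
rewrite dg0E; apply: ereal_sup_ubound; exists (a / 2) => //=.
rewrite in_itv/=; lra.
Qed.

Lemma lt_dg0 (r : R) : (r%:E < dg0 g)%E -> exists2 a : R, 0 < a < 1 & r < G a.
Proof.
rewrite dg0E => /ereal_sup_gt[y [a + <-]]; rewrite /= in_itv/= => a01.
by rewrite lte_fin => ?; exists a.
Qed.

(** By the mean value theorem the left difference quotients at 1 are eventually values of [G] beyond
    [a], hence below [G a]; their limit is finite by (A2). This is what makes [dg1] a true limit. *)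
Lemma dg_lb : exists L, forall a, 0 < a < 1 -> L <= G a.
Proof.
exists (lim ((g 1 - g (1 - h)) / h @[h --> 0^'+])) => a /andP[a0 a1].
apply: limr_le => //; near=> h.
have h0 : 0 < h by near: h; exact: nbhs_right_gt.
have h1 : h < 1 - a by near: h; apply: nbhs_right_lt; lra.
have [|||c /andP[hc c1] e] := @g_mvt (1 - h) 1; try lra.
rewrite ler_pdivrMr// e (_ : 1 - (1 - h) = h); last lra.
rewrite ler_pM2r//; apply/ltW/dg_decr; lra.
Unshelve. all: end_near. Qed.

Lemma dg1_cvgG : G x @[x --> 1^'-] --> dg1 g.
Proof.
have [L GL] := dg_lb.
suff : cvg (G x @[x --> 1^'-]) by [].
rewrite -(_ : (- (fun x => - G x)) = G); last by apply/funext => x; rewrite opprfctE opprK.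
apply: is_cvgN; apply: nondecreasing_at_left_is_cvgr.
  near=> x => u v; rewrite !in_itv/= => /andP[xu u1] /andP[xv v1].
  have x0 : 0 < x by near: x; apply: nbhs_left_gt; lra.
  rewrite le_eqVlt => /predU1P[->//|uv]; rewrite lerN2; apply/ltW/dg_decr; lra.
near=> x; exists (- L) => _ [y /= + <-]; rewrite in_itv/= => /andP[xy y1].
have x0 : 0 < x by near: x; apply: nbhs_left_gt; lra.
rewrite lerN2; apply: GL; lra.
Unshelve. all: end_near. Qed.

Lemma dg1_lt_dg a : 0 < a < 1 -> dg1 g < G a.
Proof.
move=> /andP[a0 a1]; apply: (@le_lt_trans _ _ (G ((a + 1) / 2))); last by apply: dg_decr; lra.
rewrite /dg1; apply: limr_le; first by apply: (cvgP _ dg1_cvgG).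
near=> x; apply/ltW/dg_decr; first lra.
  by near: x; apply: nbhs_left_gt; lra.
by near: x; exact: nbhs_left_lt.
Unshelve. all: end_near. Qed.

Lemma dg1_lt r : dg1 g < r -> exists2 a : R, 0 < a < 1 & G a < r.
Proof.
move=> dr; near (1 : R)^'- => x.
exists x; last first.
  by near: x; apply: (cvgr_lt (F := 1^'-) (f := G) _ dg1_cvgG).
apply/andP; split; first by near: x; apply: nbhs_left_gt; lra.
by near: x; exact: nbhs_left_lt.
Unshelve. all: end_near. Qed.

Lemma s_gt0 a : 0 < s a. Proof. exact: expR_gt0. Qed.

Lemma s_incr a b : 0 < a -> a < b -> b < 1 -> s a < s b.
Proof. by move=> *; rewrite ltr_expR ltrN2; exact: dg_decr. Qed.

Lemma rad0_ge0 : 0 <= rad0 g.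
Proof. by rewrite /rad0 fine_ge0// expeR_ge0. Qed.

Lemma rad0_lt_s a : 0 < a < 1 -> rad0 g < s a.
Proof.
move=> /dg_lt_dg0; rewrite /rad0 /s; case: (dg0 g) => [D||]//=.
- by rewrite lte_fin ltr_expR ltrN2.
- by rewrite expR_gt0.
Qed.

Lemma rad0_lt r : rad0 g < r -> exists2 a : R, 0 < a < 1 & s a < r.
Proof.
move=> r0r.
have r0 : 0 < r by apply: le_lt_trans rad0_ge0 r0r.
have [a a01 h] : exists2 a : R, 0 < a < 1 & - ln r < G a.
  apply: lt_dg0; move: r0r (@dg_lt_dg0 2^-1); rewrite /rad0; case: (dg0 g) => [D||]//=.
  - by rewrite lte_fin => h _; rewrite lte_fin ltrNl -ltr_expR lnK.
  - by move=> *; rewrite ltry.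
  - by move=> _ h; have /h : 0 < (2^-1 : R) < 1 by lra.
by exists a; [exact: a01|rewrite /s -[ltRHS](@lnK _ r)// ?posrE// ltr_expR ltrNl].
Qed.

Lemma s_lt_rad1 a : 0 < a < 1 -> s a < rad1 g.
Proof. by move=> /dg1_lt_dg h; rewrite ltr_expR ltrN2. Qed.

Lemma lt_rad1 r : r < rad1 g -> exists2 a : R, 0 < a < 1 & r < s a.
Proof.
move=> rr1; have [r0|r0] := leP r 0.
  by exists (2^-1 : R); [lra|exact: le_lt_trans r0 (s_gt0 _)].
have [a a01 h] : exists2 a : R, 0 < a < 1 & G a < - ln r.
  by apply: dg1_lt; rewrite ltrNr -ltr_expR lnK.
have lnr : expR (ln r) = r by apply: lnK; rewrite posrE.
clear rr1; exists a; first exact: a01.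
by rewrite /s -[X in X < _]lnr ltr_expR ltrNr.
Qed.

Lemma dg_cont a : 0 < a < 1 -> {for a, continuous G}.
Proof. by move=> /ddgP[/derivable1_diffP/differentiable_continuous]. Qed.

Lemma s_deriv a : 0 < a < 1 -> is_derive a 1 s (- derive1n 2 g a * s a).
Proof.
move=> a01; have := ddgP a01 => dG.
have -> : - derive1n 2 g a * s a = expR (- G a) * (- derive1n 2 g a) by rewrite /s mulrC.
exact: (@is_derive1_comp _ expR (- G)).
Qed.

Lemma s_ndecr a b : 0 < a -> a <= b -> b < 1 -> s a <= s b.
Proof.
move=> a0; rewrite le_eqVlt => /predU1P[->//|ab b1]; exact/ltW/s_incr.
Qed.

Lemma s_surj r : rad0 g < r < rad1 g -> exists2 a : R, 0 < a < 1 & s a = r.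
Proof.
move=> /andP[/rad0_lt[a /andP[a0 a1] ar] /lt_rad1[b /andP[b0 b1] rb]].
have ab : a < b.
  rewrite ltNge; apply/negP; rewrite le_eqVlt => /predU1P[e|ba].
    by move: (lt_trans ar rb); rewrite e ltxx.
  by have := lt_trans (lt_trans ar rb) (s_incr b0 ba a1); rewrite ltxx.
have [|||c] := @IVT _ s a b r; first exact: ltW.
- apply: (is_derive_within (f' := fun a => - derive1n 2 g a * s a)) => x /andP[ax xb].
  by apply: s_deriv; rewrite (lt_le_trans a0 ax) (le_lt_trans xb b1).
- have sab : s a <= s b by apply/ltW/s_incr.
  by rewrite min_l// max_r// !ltW.
by rewrite in_itv/= => /andP[ac cb] <-; exists c;
   first by rewrite (lt_le_trans a0 ac) (le_lt_trans cb b1).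
Qed.

Lemma argmax01E (F : R -> \bar R) a : unique_maximizer01 F a -> argmax01 F = a.
Proof.
move=> [Fa Fu]; rewrite /argmax01; case: xgetP => [b -> /Fu//|/(_ a)].
by move=> /(_ Fa).
Qed.

Lemma unique_maximizer01_mono (F : R -> R) a : 0 <= a <= 1 ->
  (forall x y : R, 0 <= x -> x < y -> y <= a -> F x < F y) ->
  (forall x y : R, a <= x -> x < y -> y <= 1 -> F y < F x) ->
  unique_maximizer01 (fun x => (F x)%:E) a.
Proof.
move=> /andP[a0 a1] Fi Fd.
have Fmax b : 0 <= b <= 1 -> b != a -> F b < F a.
  by move=> /andP[b0 b1]; rewrite neq_lt => /orP[ba|ab]; [exact: Fi|exact: Fd].
split; first split; first by rewrite a0 a1.
  move=> b b01; rewrite lee_fin; have [->//|ba] := eqVneq b a.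
  exact/ltW/Fmax.
move=> b [b01 bmax]; apply/eqP/negPn/negP => ba.
by have := bmax a; rewrite a0 a1 lee_fin leNgt Fmax// => /(_ isT).
Qed.

Let F r a : R := g a + a * ln r.

Lemma F_mvt r a b : 0 <= a -> a < b -> b <= 1 ->
  exists2 c : R, a < c < b & F r b - F r a = (G c + ln r) * (b - a).
Proof.
move=> a0 ab b1; have [c acb e] := g_mvt a0 ab b1; exists c => //.
rewrite /F mulrDl -e; ring.
Qed.

(** The derivative [G c + ln r] is [ln (r / s c)], so its sign is read off from comparing [s c] with
    [r]. *)
Lemma F_mono r a : 0 < r -> 0 <= a <= 1 ->
  (forall x : R, 0 < x < 1 -> x < a -> s x < r) ->
  (forall x : R, 0 < x < 1 -> a < x -> r < s x) ->
  unique_maximizer01 (fun x => (F r x)%:E) a.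
Proof.
move=> r0 /andP[a0 a1] lea gea.
have lnr : expR (ln r) = r by apply: lnK; rewrite posrE.
apply: unique_maximizer01_mono; first by rewrite a0 a1.
- move=> x y x0 xy ya; have y1 := le_trans ya a1.
  have [c /andP[xc cy] e] := F_mvt r x0 xy y1.
  rewrite -subr_gt0 e mulr_gt0 ?subr_gt0// addrC -ltrBlDr sub0r -ltr_expR lnr.
  apply: lea; last exact: lt_le_trans cy ya.
  by rewrite (le_lt_trans x0 xc) (lt_le_trans cy y1).
- move=> x y ax xy y1; have x0 := le_trans a0 ax.
  have [c /andP[xc cy] e] := F_mvt r x0 xy y1.
  rewrite -subr_lt0 e nmulr_rlt0 ?subr_gt0// addrC -ltrBrDr sub0r -ltr_expR lnr.
  apply: gea; last exact: le_lt_trans ax xc.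
  by rewrite (le_lt_trans x0 xc) (lt_le_trans cy y1).
Qed.

Lemma obj_pos r : 0 < r ->
  (fun x : R => ((g x)%:E + x%:E * lne r%:E)%E) = (fun x => (F r x)%:E).
Proof. by move=> r0; apply/funext => x; rewrite lne_EFin. Qed.

Lemma alpha0E r a : 0 < r -> 0 <= a <= 1 ->
  (forall x : R, 0 < x < 1 -> x < a -> s x < r) ->
  (forall x : R, 0 < x < 1 -> a < x -> r < s x) -> alpha0 g r = a.
Proof.
by move=> r0 a01 h1 h2; rewrite /alpha0 obj_pos//; apply/argmax01E/F_mono.
Qed.

Lemma alpha0_s a : 0 < a < 1 -> alpha0 g (s a) = a.
Proof.
move=> /andP[a0 a1]; apply: alpha0E; first exact: s_gt0.
- by rewrite !ltW.
- by move=> x /andP[x0 _] xa; exact: s_incr.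
- by move=> x /andP[_ x1] ax; exact: s_incr.
Qed.

Lemma alpha0_0 : alpha0 g 0 = 0.
Proof.
rewrite /alpha0 le0_lneNy//; apply: argmax01E; split; first split; first by rewrite lexx ler01.
  move=> b /andP[b0 _]; rewrite mul0e adde0.
  move: b0; rewrite le_eqVlt => /predU1P[<-|b0]; first by rewrite mul0e adde0.
  by rewrite gt0_muleNy ?lte_fin// addeNy leNye.
move=> b [/andP[+ _]]; rewrite le_eqVlt => /predU1P[//|b0] /(_ 0).
by rewrite lexx ler01 => /(_ isT); rewrite mul0e adde0 gt0_muleNy ?lte_fin// addeNy.
Qed.

Lemma alpha0_le_rad0 r : 0 <= r -> r <= rad0 g -> alpha0 g r = 0.
Proof.
rewrite le_eqVlt => /predU1P[<-|r0] rr; first exact: alpha0_0.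
apply: (alpha0E r0); first by rewrite lexx ler01.
  by move=> x /andP[x0 _] /(lt_trans x0); rewrite ltxx.
by move=> x x01 _; exact: le_lt_trans rr (rad0_lt_s x01).
Qed.

Lemma alpha0_ge_rad1 r : rad1 g <= r -> alpha0 g r = 1.
Proof.
move=> rr; have r0 : 0 < r by apply: lt_le_trans rr; exact: expR_gt0.
apply: (alpha0E r0); first by rewrite lexx ler01.
  by move=> x x01 _; exact: lt_le_trans (s_lt_rad1 x01) rr.
by move=> x /andP[_ x1] /(lt_trans x1); rewrite ltxx.
Qed.

Lemma alpha0_cases r : 0 <= r ->
  [\/ r <= rad0 g /\ alpha0 g r = 0,
      exists2 a : R, 0 < a < 1 & s a = r /\ alpha0 g r = a |
      rad1 g <= r /\ alpha0 g r = 1].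
Proof.
move=> r0; have [rr|rr] := leP r (rad0 g).
  by constructor 1; split=> //; exact: alpha0_le_rad0.
have [rr1|rr1] := leP (rad1 g) r.
  by constructor 3; split => //; exact: alpha0_ge_rad1.
have [|a a01 <-] := @s_surj r; first by rewrite rr rr1.
by constructor 2; exists a => //; rewrite alpha0_s.
Qed.

Lemma alpha0_01 r : 0 <= r -> 0 <= alpha0 g r <= 1.
Proof.
move=> /alpha0_cases[[_ ->]|[a /andP[a0 a1] [_ ->]]|[_ ->]]; rewrite ?lexx ?ler01//.
by rewrite !ltW.
Qed.

(** With [alpha0_lt], this expresses that [s] inverts [alpha0] in a form valid at every radius, also
    where [alpha0] is constantly 0 or 1. *)
Lemma lt_alpha0 r a : 0 < a < 1 -> 0 <= r -> (a < alpha0 g r) = (s a < r).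
Proof.
move=> /andP[a0 a1] /alpha0_cases[[rr ->]|[b /andP[b0 b1] [<- ->]]|[rr ->]].
- rewrite !ltNge ltW//=; apply/esym/negbF/(le_trans rr)/ltW/rad0_lt_s.
  by rewrite a0 a1.
- have [ab|ba|->] := ltgtP a b; last by rewrite ltxx.
    by rewrite s_incr.
  by rewrite ltNge ltW// s_incr.
- by rewrite a1 (lt_le_trans (s_lt_rad1 _) rr)// a0 a1.
Qed.

Lemma alpha0_lt r a : 0 < a < 1 -> 0 <= r -> (alpha0 g r < a) = (r < s a).
Proof.
move=> /andP[a0 a1] /alpha0_cases[[rr ->]|[b /andP[b0 b1] [<- ->]]|[rr ->]].
- by rewrite a0 (le_lt_trans rr (rad0_lt_s _))// a0 a1.
- have [ab|ba|->] := ltgtP a b; last by rewrite ltxx.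
    by rewrite ltNge ltW// s_incr.
  by rewrite s_incr.
- rewrite !ltNge ltW//=; apply/esym/negbF/(le_trans _ rr)/ltW/s_lt_rad1.
  by rewrite a0 a1.
Qed.

Lemma alpha0_max r : 0 < r -> unique_maximizer01 (fun x => (F r x)%:E) (alpha0 g r).
Proof.
move=> r0; apply: F_mono => //; first exact/alpha0_01/ltW.
  by move=> x x01; rewrite lt_alpha0// ltW.
by move=> x x01; rewrite alpha0_lt// ltW.
Qed.

Lemma alpha0_deriv a : 0 < a < 1 -> derivable (alpha0 g) (s a) 1.
Proof.
move=> /andP[a0 a1].
have l0 : - derive1n 2 g a * s a != 0.
  apply: mulf_neq0; last exact: lt0r_neq0 (s_gt0 _).
  by rewrite oppr_eq0 lt_eqF// ddg_lt0// a0 a1.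
have a01 : \forall x \near a, 0 < x < 1.
  near=> x; apply/andP; split; near: x; [exact: lt_nbhsr|exact: lt_nbhsl].
suff : is_derive (s a) 1 (alpha0 g) (- derive1n 2 g a * s a)^-1 by case.
apply: is_derive_inverse; last exact: l0.
- by near=> x; apply: alpha0_s; near: x.
- near=> x.
  have [|/derivable1_diffP/differentiable_continuous //] := @s_deriv x _.
  by near: x.
- by apply: s_deriv; rewrite a0 a1.
Unshelve. all: by end_near. Qed.

Let h r : R := alpha0 g r / r.

Lemma h_deriv r : rad0 g < r < rad1 g -> is_derive r 1 h (derive1 h r).
Proof.
move=> /s_surj[a a01 <-]; rewrite derive1E; apply/derivableP.
apply: derivableM; first exact: alpha0_deriv.
by apply: derivableV; [exact: lt0r_neq0 (s_gt0 _)|exact: derivable_id].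
Qed.

(** [x / s x = x expR (G x)] is the value of [h] at the radius [s x], so this is the continuity of
    [h] at [rad0]. If [g'(0)] is finite, [s] stays above [rad0 > 0]; if it is infinite, this is the
    last clause of (A3). *)
Lemma h_small (e : R) : 0 < e -> exists2 a : R, 0 < a < 1 &
  forall x : R, 0 < x -> x <= a -> x / s x < e.
Proof.
move=> e0; case: A3 => _ _.
have sV x : (s x)^-1 = expR (G x) by rewrite /s expRN invrK.
case E : (dg0 g) => [D||] h3.
- have r0 : 0 < rad0 g by rewrite /rad0 E /= expR_gt0.
  have m0 : 0 < Num.min (2^-1 : R) (e * rad0 g) by rewrite lt_min mulr_gt0// andbT invr_gt0.
  exists (Num.min (2^-1) (e * rad0 g)).
    by rewrite m0 gt_min; apply/orP; left; lra.
  move=> x x0; rewrite le_min => /andP[x1 xe].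
  have xs : rad0 g < s x by apply: rad0_lt_s; rewrite x0/= (le_lt_trans x1)//; lra.
  rewrite ltr_pdivrMr ?s_gt0// (le_lt_trans xe)// ltr_pM2l//.
- have {h3} := h3 erefl.
  move=> /cvgr_lt/(_ _ e0)[d /= d0 dP].
  exists (Num.min (2^-1) (d / 2)).
    by rewrite lt_min gt_min divr_gt0//; apply/andP; split; [|apply/orP; left; lra]; lra.
  move=> x x0; rewrite le_min => /andP[x1 xd]; rewrite sV.
  apply: dP => //; rewrite /ball_/= sub0r normrN gtr0_norm// (le_lt_trans xd)//; lra.
- have := @dg_lt_dg0 2^-1; rewrite E => /(_ ltac:(lra)); by rewrite ltNge leNye.
Qed.

Variable c : R.
Hypothesis c0 : 0 <= c.
Hypothesis cP : forall r, rad0 g < r < rad1 g -> `|derive1 h r| <= c.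

Lemma h_lip_mid x y : rad0 g < x -> x <= y -> y < rad1 g -> `|h y - h x| <= c * (y - x).
Proof.
move=> rx xy yr.
have hin z : x <= z <= y -> rad0 g < z < rad1 g.
  by move=> /andP[xz zy]; rewrite (lt_le_trans rx xz) (le_lt_trans zy yr).
have [||z] := @MVT_segment _ h (derive1 h) x y xy.
- by move=> z; rewrite in_itv/= => /andP[xz zy]; apply/h_deriv/hin; rewrite !ltW.
- by apply: (is_derive_within (f' := derive1 h)) => z /hin/h_deriv.
rewrite in_itv/= => /hin/cP hc ->; rewrite normrM ler_pM//.
by rewrite ger0_norm// subr_ge0.
Qed.

Lemma h_ge0 x : 0 <= x -> 0 <= h x.
Proof. by move=> x0; rewrite divr_ge0//; case/andP: (alpha0_01 x0). Qed.

Lemma h_s a : 0 < a < 1 -> h (s a) = a / s a.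
Proof. by move=> a01; rewrite /h alpha0_s. Qed.

(** The interior bound is applied from a radius [s x] just above [rad0], where [h (s x) < e]; then
    [e] tends to 0. *)
Lemma h_lip_low y : rad0 g < y < rad1 g -> h y <= c * (y - rad0 g).
Proof.
move=> /andP[ry yr]; apply/ler_addgt0Pr => e e0.
have [a /andP[a0 a1] ae] := h_small e0.
have [b /andP[b0 b1] bs] := rad0_lt ry.
pose x := Num.min a b.
have x0 : 0 < x by rewrite lt_min a0 b0.
have xa : x <= a by rewrite ge_min lexx.
have x1 : x < 1 by exact: le_lt_trans a1.
have x01 : 0 < x < 1 by rewrite x0 x1.
have xs : s x < y.
  by apply: le_lt_trans bs; apply: (s_ndecr x0 _ b1); rewrite ge_min lexx orbT.
have hx : h (s x) < e by rewrite h_s//; exact: ae.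
have := h_lip_mid (rad0_lt_s x01) (ltW xs) yr.
have : c * (y - s x) <= c * (y - rad0 g).
  by rewrite ler_wpM2l// lerD2l lerN2; exact/ltW/rad0_lt_s.
rewrite ler_norml => h1 /andP[_ h2].
rewrite -(subrK (h (s x)) (h y)) lerD//; last exact: ltW.
exact: le_trans h2 h1.
Qed.

Lemma rad1_gt0 : 0 < rad1 g. Proof. exact: expR_gt0. Qed.

Lemma h_lip_high x : rad0 g < x < rad1 g -> `|(rad1 g)^-1 - h x| <= c * (rad1 g - x).
Proof.
move=> /andP[rx xr]; apply/ler_addgt0Pr => e e0.
have x0 : 0 < x by apply: le_lt_trans rad0_ge0 rx.
have r1 := rad1_gt0; set r := rad1 g in r1 xr *.
pose d : R := e * r * x / (1 + r).
have r10 : 0 < 1 + r by rewrite addr_gt0.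
have d0 : 0 < d by rewrite divr_gt0// !mulr_gt0.
(* [d] is the tolerance of [inv_sub_frac_le]. The level [a] brings [s] within [d] of [rad1]; raising
   it to [b >= 1 - d] preserves this, since [s] is increasing. *)
have [a /andP[a0 a1]] : exists2 a : R, 0 < a < 1 & Num.max x (r - d) < s a.
  by apply: lt_rad1; rewrite gt_max xr/= ltrBlDr ltrDl.
rewrite gt_max => /andP[xa ra].
pose b := Num.max a (1 - d).
have ab : a <= b by rewrite le_max lexx.
have b0 : 0 < b := lt_le_trans a0 ab.
have b1 : b < 1 by rewrite gt_max a1/= ltrBlDr ltrDl.
have b01 : 0 < b < 1 by rewrite b0 b1.
have db : 1 - d <= b by rewrite le_max lexx orbT.
have sab : s a <= s b := s_ndecr a0 ab b1.
have xb := lt_le_trans xa sab.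
have br : s b < r by exact: s_lt_rad1.
have rb := lt_le_trans ra sab.
have sb0 := s_gt0 b.
have H1 := h_lip_mid rx (ltW xb) br.
have H2 : `|r^-1 - h (s b)| <= e.
  by rewrite (h_s b01); exact: (inv_sub_frac_le e0 x0 (ltW xb) br rb b1 db).
have H4 : c * (s b - x) <= c * (r - x) := ler_wpM2l c0 (lerB (ltW br) (lexx x)).
rewrite -(subrK (h (s b)) r^-1) -addrA addrC (le_trans (ler_normD _ _))//.
exact: (lerD (le_trans H1 H4) H2).
Qed.

Lemma rad0_lt_rad1 : rad0 g < rad1 g.
Proof.
have a01 : 0 < (2^-1 : R) < 1 by lra.
exact: lt_trans (rad0_lt_s a01) (s_lt_rad1 a01).
Qed.

(** The end values of [h] are 0 at [rad0] and [1 / rad1] at [rad1]; the bounds from either end are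
    added at the radius [s 2^-1]. *)
Lemma inv_rad1_le : (rad1 g)^-1 <= c * (rad1 g - rad0 g).
Proof.
have a01 : 0 < (2^-1 : R) < 1 by lra.
have h12 : rad0 g < s 2^-1 < rad1 g by rewrite rad0_lt_s// s_lt_rad1.
have := h_lip_high h12; have := h_lip_low h12.
move: (h (s 2^-1)) (s 2^-1) (rad1 g)^-1 (rad1 g) (rad0 g) => u v w x y h1.
rewrite ler_norml => /andP[_ h2].
have -> : c * (x - y) = c * (x - v) + c * (v - y) by ring.
lra.
Qed.

Lemma h_low x : 0 <= x -> x <= rad0 g -> h x = 0.
Proof. by move=> x0 xr; rewrite /h alpha0_le_rad0// mul0r. Qed.

Lemma h_high x : rad1 g <= x -> h x = x^-1.
Proof. by move=> xr; rewrite /h alpha0_ge_rad1// div1r. Qed.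

(** The supremum in [t_sing] does not look beyond [rad1]. There [h] is the inverse function, of
    slope at most [1 / rad1^2], and [inv_rad1_le] bounds this by [c]. *)
Lemma h_high_lip x y : rad1 g <= x -> x <= y -> `|x^-1 - y^-1| <= c * (y - x).
Proof.
have := inv_rad1_le; have := rad1_gt0; have := rad0_ge0.
move: (rad0 g) (rad1 g) => u r u0 r0 cr rx xy.
have x0 : 0 < x := lt_le_trans r0 rx.
have y0 : 0 < y := lt_le_trans x0 xy.
have -> : x^-1 - y^-1 = (y - x) / (x * y) by field; rewrite !gt_eqF.
have xy0 : 0 <= (x * y)^-1 by rewrite invr_ge0 ltW// mulr_gt0.
rewrite ger0_norm; last by rewrite mulr_ge0// subr_ge0.
rewrite mulrC ler_wpM2r ?subr_ge0//.
have H : 1 <= c * r * r.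
  have : 1 <= c * (r - u) * r by rewrite -ler_pdivrMr// div1r.
  by move/le_trans; apply; rewrite ler_pM2r// ler_wpM2l// gerBl.
rewrite invf_ple ?posrE ?mulr_gt0//; last first.
  by rewrite lt_neqAle c0 andbT; apply/eqP => c00; move: H; rewrite -c00; lra.
have c_gt0 : 0 < c by rewrite lt_neqAle c0 andbT; apply/eqP => c00; move: H; rewrite -c00; lra.
rewrite -[leLHS]mulr1 ler_pdivrMl// mulrA.
by apply: (le_trans H); rewrite -!mulrA ler_pM2l// ler_pM ?(ltW r0)// (le_trans rx xy).
Qed.

Lemma h_lip_le x y : 0 <= x -> x <= y -> `|h y - h x| <= c * (y - x).
Proof.
move=> x0 xy; have y0 := le_trans x0 xy.
have [xr|xr] := leP x (rad0 g).
  rewrite (h_low x0 xr) subr0 ger0_norm ?h_ge0//.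
  have [yr|yr] := leP y (rad0 g); first by rewrite h_low// mulr_ge0// subr_ge0.
  have [yr1|yr1] := leP (rad1 g) y.
    rewrite h_high//; apply: (@le_trans _ _ (rad1 g)^-1).
      by rewrite lef_pV2// posrE ?rad1_gt0// (lt_le_trans rad1_gt0 yr1).
    by apply: (le_trans inv_rad1_le); rewrite ler_wpM2l// lerB.
  apply: (@le_trans _ _ (c * (y - rad0 g))); first by apply: h_lip_low; rewrite yr yr1.
  by rewrite ler_wpM2l// lerB.
have [xr1|xr1] := leP (rad1 g) x.
  rewrite !h_high//; last exact: le_trans xy.
  by rewrite distrC h_high_lip.
have [yr1|yr1] := leP (rad1 g) y; last exact: h_lip_mid.
rewrite (h_high yr1).
have H1 := h_high_lip (lexx _) yr1.
have H2 : `|(rad1 g)^-1 - h x| <= c * (rad1 g - x) by apply: h_lip_high; rewrite xr xr1.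
rewrite (_ : c * (y - x) = c * (y - rad1 g) + c * (rad1 g - x)); last by ring.
rewrite -(subrK (rad1 g)^-1 y^-1) -addrA (le_trans (ler_normD _ _))// lerD//.
by rewrite distrC.
Qed.

End profile.

(** [c] is the supremum itself: the value 0 makes [t_sing] infinite, and +oo would make it 0. *)
Lemma t_sing_lip (R : realType) (g : R -> R) (t : R) : 0 < t ->
  (t%:E < t_sing g)%E -> exists c : R, [/\ 0 <= c, t * c < 1 &
  forall r, rad0 g < r < rad1 g -> `|derive1 (fun r => alpha0 g r / r) r| <= c].
Proof.
move=> t0; rewrite /t_sing; set S := ereal_sup _ => tS.
have SP r : rad0 g < r < rad1 g ->
    (`|derive1 (fun r => alpha0 g r / r) r|%:E <= S)%E.
  by move=> rr; apply: ereal_sup_ubound; exists r.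
move: tS; case: (S) SP => [q||] SP.
- rewrite inver; case: ifPn => [/eqP q0 _|q0].
    by exists 0; rewrite mulr0; split=> // r /SP; rewrite q0 lee_fin.
  rewrite lte_fin => tq.
  have q1 : 0 < q by rewrite -invr_gt0 (lt_trans t0).
  exists q; split; [exact: ltW| |by move=> r /SP; rewrite lee_fin].
  by rewrite -ltr_pdivlMr// div1r.
- by rewrite invey lte_fin ltNge ltW.
- by rewrite inveNy ltNge leNye.
Qed.

(** * Geometry of the transport map *)

Section plane_basics.
Context {R : realType}.
Implicit Types z w : R * R.

Lemma modulusE z : modulus z = Num.sqrt (z.1 ^+ 2 + z.2 ^+ 2).
Proof. by []. Qed.

Lemma modulus_ge0 z : 0 <= modulus z. Proof. exact: sqrtr_ge0. Qed.

Lemma sqr_modulus z : modulus z ^+ 2 = z.1 ^+ 2 + z.2 ^+ 2.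
Proof. by rewrite modulusE sqr_sqrtr// addr_ge0 ?sqr_ge0. Qed.

Lemma cplxK z : plane (cplx z) = z. Proof. by case: z. Qed.
Lemma planeK (w : R[i]) : cplx (plane w) = w. Proof. by case: w. Qed.
Lemma cplxD z w : cplx (z + w) = cplx z + cplx w. Proof. by []. Qed.
Lemma cplxB z w : cplx (z - w) = cplx z - cplx w. Proof. by []. Qed.
Lemma cplx0 : cplx (0 : R * R) = 0. Proof. by []. Qed.

Lemma cplx_inj : injective (@cplx R).
Proof. exact: can_inj cplxK. Qed.

Lemma cplx_eq0 z : (cplx z == 0) = (z == 0).
Proof. by rewrite -cplx0 (inj_eq cplx_inj). Qed.

Lemma normc_ge0 (w : R[i]) : 0 <= normc w.
Proof. by case: w => a b; exact: sqrtr_ge0. Qed.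

Lemma normc_eq0 (w : R[i]) : (normc w == 0) = (w == 0).
Proof.
apply/eqP/eqP => [|->]; first exact: ComplexField.Normc.eq0_normc.
exact: ComplexField.Normc.normc0.
Qed.

Lemma normc_gt0 (w : R[i]) : (0 < normc w) = (w != 0).
Proof. by rewrite lt_neqAle normc_ge0 andbT eq_sym normc_eq0. Qed.

Lemma modulus_eq0 z : (modulus z == 0) = (z == 0).
Proof. by rewrite /modulus normc_eq0 cplx_eq0. Qed.

Lemma modulus_gt0 z : (0 < modulus z) = (z != 0).
Proof. by rewrite lt_neqAle modulus_ge0 andbT eq_sym modulus_eq0. Qed.

Lemma modulus0 : modulus (0 : R * R) = 0.
Proof. by apply/eqP; rewrite modulus_eq0. Qed.

Lemma le_modulusD z w : modulus (z + w) <= modulus z + modulus w.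
Proof. by rewrite /modulus cplxD; exact: le_normcD. Qed.

Lemma modulusN z : modulus (- z) = modulus z.
Proof. by rewrite !modulusE /= !sqrrN. Qed.

Lemma modulusBC z w : modulus (z - w) = modulus (w - z).
Proof. by rewrite -modulusN opprB. Qed.

Lemma le_modulusB z w : modulus z - modulus w <= modulus (z - w).
Proof. by rewrite lerBlDr -{1}(subrK w z) le_modulusD. Qed.

Lemma modulusZ (a : R) z : modulus (a *: z) = `|a| * modulus z.
Proof.
rewrite !modulusE /= /GRing.scale /= !exprMn -mulrDr sqrtrM ?sqr_ge0//.
by rewrite sqrtr_sqr.
Qed.

Lemma normr_fst_le z : `|z.1| <= modulus z.
Proof. by rewrite modulusE -sqrtr_sqr ler_wsqrtr// lerDl sqr_ge0. Qed.

Lemma normr_snd_le z : `|z.2| <= modulus z.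
Proof. by rewrite modulusE -sqrtr_sqr ler_wsqrtr// lerDr sqr_ge0. Qed.

Lemma modulus_le_add z : modulus z <= `|z.1| + `|z.2|.
Proof.
rewrite -ler_sqr ?nnegrE ?modulus_ge0 ?addr_ge0// sqr_modulus.
rewrite -(real_normK (num_real z.1)) -(real_normK (num_real z.2)).
have := normr_ge0 z.1; have := normr_ge0 z.2; nra.
Qed.

Lemma normc_plane (w : R[i]) : modulus (plane w) = normc w.
Proof. by rewrite /modulus planeK. Qed.

Lemma normcX (w : R[i]) n : normc (w ^+ n) = normc w ^+ n.
Proof.
elim: n => [|n IH]; first by rewrite !expr0 ComplexField.Normc.normc1.
by rewrite !exprS ComplexField.Normc.normcM IH.
Qed.

Lemma cplxV z : (cplx z)^-1 =
  (z.1 / modulus z ^+ 2) +i* (- z.2 / modulus z ^+ 2).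
Proof. by rewrite sqr_modulus; case: z => a b /=; rewrite mulNr. Qed.

End plane_basics.

Section transport.
Context {R : realType}.
Implicit Types (z w : R * R) (r : R).
Variables (g : R -> R) (c t : R).
Hypothesis c0 : 0 <= c.
Hypothesis t0 : 0 <= t.
Hypothesis tc : t * c < 1.
Let h r := alpha0 g r / r.
Hypothesis h0 : forall r, 0 <= r -> 0 <= h r.
Hypothesis hL : forall x y : R, 0 <= x -> 0 <= y -> `|h x - h y| <= c * `|x - y|.

Lemma h_le r : 0 <= r -> h r <= c * r.
Proof.
move=> r0; have := hL r0 (lexx 0).
by rewrite [h 0]/h invr0 mulr0 !subr0 !ger0_norm// h0.
Qed.

(** The field [alpha0(|z|) / z] in real coordinates; the sign of the second one is the conjugation
    in [1 / z = conj z / |z|^2]. Thanks to [0^-1 = 0] it vanishes at the origin. *)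
Definition hvec z : R * R :=
  (z.1 * (h (modulus z) / modulus z), - (z.2 * (h (modulus z) / modulus z))).

Lemma hvec0 : hvec 0 = 0.
Proof. by rewrite /hvec /= !mul0r oppr0. Qed.

Lemma transportE z : transport g t z = z + t *: hvec z.
Proof.
rewrite /transport; case: eqVneq => [->|z0].
  by rewrite hvec0 scaler0 addr0.
have m0 : modulus z != 0 by rewrite modulus_eq0.
rewrite cplxV; case: z z0 m0 => x y z0 m0.
rewrite /plane /cplx /hvec /h /=; simpc => /=.
by congr pair => /=; rewrite /GRing.scale/=; field.
Qed.

Lemma hvec_cplx z : cplx (hvec z) = (alpha0 g (modulus z))%:C / cplx z.
Proof.
have [->|z0] := eqVneq z 0.
  by rewrite /hvec /= !mul0r oppr0 cplx0 invr0 mulr0.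
have m0 : modulus z != 0 by rewrite modulus_eq0.
rewrite cplxV; case: z z0 m0 => x y z0 m0.
rewrite /cplx /hvec /h /=; simpc.
by congr (_ +i* _); field.
Qed.

Lemma modulus_hvec z : modulus (hvec z) = h (modulus z).
Proof.
have [->|z0] := eqVneq z 0.
  by rewrite /hvec /= !mul0r oppr0 modulus0 /h invr0 mulr0.
have m0 : modulus z != 0 by rewrite modulus_eq0.
apply/eqP; rewrite -(eqrXn2 (n := 2)) ?modulus_ge0 ?h0 ?modulus_ge0//; apply/eqP.
rewrite sqr_modulus /hvec /= sqrrN !exprMn -mulrDl -sqr_modulus.
by field.
Qed.

(** A radial Lipschitz constant passes to the plane. With [C] the cosine of the angle between [z]
    and [w], the squared distances are [(k - l)^2 + 2 k l (1 - C)] and [(r - s)^2 + 2 r s (1 - C)],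
    and they are compared term by term. *)
Lemma hvec_lip z w : modulus (hvec z - hvec w) <= c * modulus (z - w).
Proof.
have [->|z0] := eqVneq z 0.
  by rewrite hvec0 !sub0r !modulusN modulus_hvec h_le ?modulus_ge0.
have [->|w0] := eqVneq w 0.
  by rewrite hvec0 !subr0 modulus_hvec h_le ?modulus_ge0.
rewrite -ler_sqr ?nnegrE ?mulr_ge0 ?modulus_ge0//.
rewrite exprMn !sqr_modulus /hvec /=.
have := sqr_modulus z; have := sqr_modulus w.
move: z0 w0; rewrite -!modulus_gt0 => z0 w0.
have := h_le (ltW z0); have := h_le (ltW w0); have := h0 (ltW z0); have := h0 (ltW w0).
have := hL (ltW z0) (ltW w0).
move: (modulus z) (modulus w) z0 w0 => r s r0 s0.
move: (h r) (h s) => k l.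
case: z => x y; case: w => u v /= kl l0 k0 lc kc Ew Ez.
set C := (x * u + y * v) / (r * s).
have C1 : C <= 1.
  rewrite ler_pdivrMr ?mulr_gt0// mul1r.
  rewrite (le_trans (ler_norm _))// -ler_sqr ?nnegrE ?normr_ge0 ?mulr_ge0 ?(ltW r0) ?(ltW s0)//.
  rewrite real_normK ?num_real// exprMn Ew Ez.
  have := sqr_ge0 (x * v - y * u); nra.
have HE : (x * (k / r) - u * (l / s)) ^+ 2 + (- (y * (k / r)) - - (v * (l / s))) ^+ 2 =
    k ^+ 2 + l ^+ 2 - 2 * k * l * C.
  transitivity ((x ^+ 2 + y ^+ 2) * (k / r) ^+ 2 + (u ^+ 2 + v ^+ 2) * (l / s) ^+ 2
    - 2 * k * l * C); last by rewrite -Ez -Ew; field; rewrite !gt_eqF.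
  by rewrite /C; field; rewrite !gt_eqF.
have HD : (x - u) ^+ 2 + (y - v) ^+ 2 = r ^+ 2 + s ^+ 2 - 2 * r * s * C.
  by rewrite Ew Ez /C; field; rewrite !gt_eqF.
rewrite HE HD.
have H1 : (k - l) ^+ 2 <= c ^+ 2 * (r - s) ^+ 2.
  rewrite -exprMn -[X in X <= _](real_normK (num_real _)).
  rewrite -[X in _ <= X](real_normK (num_real _)) normrM (ger0_norm c0).
  by rewrite ler_sqr ?nnegrE ?mulr_ge0.
have H2 : k * l <= c ^+ 2 * (r * s).
  by rewrite (_ : _ * (r * s) = (c * r) * (c * s)); [rewrite ler_pM|ring].
have : 0 <= (c ^+ 2 * (r * s) - k * l) * (1 - C).
  by rewrite mulr_ge0// subr_ge0.
clear -H1; nra.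
Qed.

Local Notation T := (transport g t).

Lemma transport_lip z w : modulus (T z - T w) <= (1 + t * c) * modulus (z - w).
Proof.
rewrite !transportE opprD addrACA -scalerBr mulrDl mul1r.
rewrite (le_trans (le_modulusD _ _))// lerD2l modulusZ (ger0_norm t0) -mulrA.
by rewrite ler_wpM2l// hvec_lip.
Qed.

Lemma transport_expand z w : (1 - t * c) * modulus (z - w) <= modulus (T z - T w).
Proof.
rewrite !transportE opprD addrACA -scalerBr mulrBl mul1r.
have := le_modulusB (z - w) (- (t *: (hvec z - hvec w))).
rewrite opprK; apply: le_trans; rewrite modulusN lerB// modulusZ (ger0_norm t0) -mulrA.
by rewrite ler_wpM2l// hvec_lip.
Qed.

Lemma transport_inj : injective T.
Proof.
move=> z w e; apply/eqP; rewrite -subr_eq0 -modulus_eq0 eq_le modulus_ge0 andbT.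
have := transport_expand z w; rewrite e subrr modulus0.
by rewrite pmulr_rle0// subr_gt0.
Qed.

Lemma transport0 : T 0 = 0.
Proof. by rewrite /transport eqxx. Qed.

(* Semi-axes of the image of the circle of radius [r]. *)
Definition axis1 r := r + t * h r.
Definition axis2 r := r - t * h r.

Lemma axis1_ge0 r : 0 <= r -> r <= axis1 r.
Proof. by move=> r0; rewrite lerDl mulr_ge0// h0. Qed.

Lemma axis2_ge r : 0 <= r -> (1 - t * c) * r <= axis2 r.
Proof.
by move=> r0; rewrite mulrBl mul1r lerB// -mulrA ler_wpM2l// h_le.
Qed.

Lemma axis2_gt0 r : 0 < r -> 0 < axis2 r.
Proof.
move=> r0; apply: lt_le_trans (axis2_ge (ltW r0)).
by rewrite mulr_gt0// subr_gt0.
Qed.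

Lemma axis1_gt0 r : 0 < r -> 0 < axis1 r.
Proof. by move=> r0; apply: lt_le_trans (axis1_ge0 (ltW r0)). Qed.

Lemma axis_incr r s : 0 <= r -> r < s -> axis1 r < axis1 s /\ axis2 r < axis2 s.
Proof.
move=> r0 rs; have := hL (ltW (le_lt_trans r0 rs)) r0.
rewrite (gtr0_norm (_ : 0 < s - r)) ?subr_gt0// => hrs.
have : t * `|h s - h r| <= t * (c * (s - r)) by rewrite ler_wpM2l.
rewrite -{1}(ger0_norm t0) -normrM ler_norml mulrA => /andP[H1 H2].
have H3 : t * c * (s - r) < s - r by rewrite gtr_pMl// subr_gt0.
by rewrite /axis1 /axis2; split; lra.
Qed.

Lemma transport_axis z :
  T z = (z.1 / modulus z * axis1 (modulus z), z.2 / modulus z * axis2 (modulus z)).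
Proof.
have [->|z0] := eqVneq z 0; first by rewrite transport0 /= !mul0r.
have m0 : modulus z != 0 by rewrite modulus_eq0.
rewrite transportE; case: z z0 m0 => x y /= z0 m0; rewrite /hvec /axis1 /axis2.
by congr pair => /=; rewrite /GRing.scale/=; field.
Qed.

Definition ell r z := z.1 ^+ 2 / axis1 r ^+ 2 + z.2 ^+ 2 / axis2 r ^+ 2.

Lemma ell_transport r z : ell r (T z) =
  (z.1 / modulus z) ^+ 2 * (axis1 (modulus z) / axis1 r) ^+ 2 +
  (z.2 / modulus z) ^+ 2 * (axis2 (modulus z) / axis2 r) ^+ 2.
Proof. by rewrite /ell transport_axis /= !exprMn !exprVn !mulrA. Qed.

Lemma unit_modulus z : z != 0 -> (z.1 / modulus z) ^+ 2 + (z.2 / modulus z) ^+ 2 = 1.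
Proof.
move=> z0; have m0 : modulus z != 0 by rewrite modulus_eq0.
by rewrite !exprMn -mulrDl -sqr_modulus -exprMn divff// expr1n.
Qed.

Lemma ell_transport_lt r z : 0 < r -> modulus z < r -> ell r (T z) < 1.
Proof.
move=> r0 zr; rewrite ell_transport; have [->|z0] := eqVneq z 0.
  by rewrite !mul0r expr0n/= !mul0r addr0.
have m0 : 0 < modulus z by rewrite modulus_gt0.
have [H1 H2] := axis_incr (ltW m0) zr.
have P (x y : R) : 0 < x -> x < y -> (x / y) ^+ 2 < 1.
  move=> x0 xy; have y0 := lt_trans x0 xy.
  by rewrite expr_lt1 ?ltr_pdivrMr ?mul1r// divr_ge0// ltW.
have Q1 := P _ _ (axis1_gt0 m0) H1; have Q2 := P _ _ (axis2_gt0 m0) H2.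
have := unit_modulus z0.
have := sqr_ge0 (z.1 / modulus z); have := sqr_ge0 (z.2 / modulus z).
move: (_ ^+ 2) (_ ^+ 2) ((_ / axis1 _) ^+ 2) ((_ / axis2 _) ^+ 2) Q1 Q2 => a b u v.
by move=> u1 v1 b0 a0 ab; case: (leP u v) => uv; nra.
Qed.

Lemma ell_transport_gt r z : 0 < r -> r < modulus z -> 1 < ell r (T z).
Proof.
move=> r0 zr; rewrite ell_transport.
have m0 : 0 < modulus z := lt_trans r0 zr.
have [H1 H2] := axis_incr (ltW r0) zr.
have P (x y : R) : 0 < x -> x < y -> 1 < (y / x) ^+ 2.
  by move=> x0 xy; rewrite exprn_egt1// ltr_pdivlMr// mul1r.
have Q1 := P _ _ (axis1_gt0 r0) H1; have Q2 := P _ _ (axis2_gt0 r0) H2.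
have := @unit_modulus z; rewrite -modulus_gt0 => /(_ m0).
have := sqr_ge0 (z.1 / modulus z); have := sqr_ge0 (z.2 / modulus z).
move: (_ ^+ 2) (_ ^+ 2) ((_ / axis1 _) ^+ 2) ((_ / axis2 _) ^+ 2) Q1 Q2 => a b u v.
by move=> u1 v1 b0 a0 ab; case: (leP u v) => uv; nra.
Qed.

Lemma ell_transport_eq z : z != 0 -> ell (modulus z) (T z) = 1.
Proof.
move=> z0; have m0 : 0 < modulus z by rewrite modulus_gt0.
rewrite ell_transport !divff ?gt_eqF ?axis1_gt0 ?axis2_gt0// expr1n !mulr1.
exact: unit_modulus.
Qed.

(** [hL] speaks of nonnegative radii only; composing with the absolute value gives a function
    continuous on the whole line. *)
Lemma h_continuous r : {for r, continuous (fun x => h `|x|)}.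
Proof.
apply/cvgrPdist_lt => e e0; near=> y.
apply: (@le_lt_trans _ _ ((c + 1) * `|r - y|)).
  apply: (le_trans (hL _ _)) => //.
  rewrite ler_pM//; first by rewrite lerDl.
  exact: ler_dist_dist.
rewrite -ltr_pdivlMl ?ltr_wpDl//; near: y.
by exists ((c + 1)^-1 * e) => //=; rewrite mulr_gt0// invr_gt0 ltr_wpDl.
Unshelve. all: by end_near. Qed.

Lemma ell_continuous z r : 0 < r ->
  {for r, continuous (fun x => z.1 ^+ 2 / (x + t * h `|x|) ^+ 2 +
                               z.2 ^+ 2 / (x - t * h `|x|) ^+ 2)}.
Proof.
move=> r0; have hr := @h_continuous r.
have th : {for r, continuous (fun x => t * h `|x|)}.
  by apply: continuousM => //; exact: cst_continuous.
have h1 := axis1_gt0 r0; have h2 := axis2_gt0 r0.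
apply: continuousD; (apply: continuousM; first exact: cst_continuous);
  (apply: continuousV; first by rewrite /= (gtr0_norm r0) expf_neq0// gt_eqF).
- by apply: (@continuous_comp _ _ _ (fun x => x + t * h `|x|) (fun u => u ^+ 2));
     [exact: continuousD|exact: exprn_continuous].
- by apply: (@continuous_comp _ _ _ (fun x => x - t * h `|x|) (fun u => u ^+ 2));
     [exact: continuousB|exact: exprn_continuous].
Qed.

(** Each [z != 0] lies on the image of some circle, by the intermediate value theorem in the radius:
    at [a] both semi-axes are at most [|z|], so the quadratic form is at least 1, and at [b] both
    are at least [|z|]. The preimage is then read off the coordinates. *)
Lemma transport_surj z : exists w, T w = z.
Proof.
have [->|z0] := eqVneq z 0; first by exists 0; rewrite transport0.
have m0 : 0 < modulus z by rewrite modulus_gt0.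
have k0 : 0 <= t * c by rewrite mulr_ge0.
have d1 : 0 < 1 + t * c by rewrite ltr_pwDl.
have d2 : 0 < 1 - t * c by rewrite subr_gt0.
pose a := modulus z / (1 + t * c); pose b := modulus z / (1 - t * c).
have a0 : 0 < a by rewrite divr_gt0.
have b0 : 0 < b by rewrite divr_gt0.
have ab : a <= b.
  by rewrite ler_pM2l// lef_pV2// lerD2l; lra.
have Aa : axis1 a <= modulus z.
  rewrite (_ : modulus z = a + t * c * a); last by rewrite /a; field; rewrite gt_eqF.
  by rewrite lerD2l -mulrA ler_wpM2l// h_le// ltW.
have Ba : axis2 a <= axis1 a.
  by rewrite lerD2l -subr_ge0 opprK addr_ge0// mulr_ge0// h0// ltW.
have Bb : modulus z <= axis2 b.
  by rewrite (le_trans _ (axis2_ge (ltW b0)))// /b mulrC divfK// gt_eqF.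
have Ab : axis2 b <= axis1 b.
  by rewrite lerD2l -subr_ge0 opprK addr_ge0// mulr_ge0// h0// ltW.
have E (x y : R) : 0 < x -> x <= y -> forall u : R, 0 <= u -> u / y ^+ 2 <= u / x ^+ 2.
  move=> x0 xy u u0; rewrite ler_wpM2l// lef_pV2 ?posrE ?exprn_gt0// ?(lt_le_trans x0)//.
  by rewrite ler_sqr ?nnegrE ?(ltW x0)// (le_trans (ltW x0)).
have m1 : z.1 ^+ 2 / modulus z ^+ 2 + z.2 ^+ 2 / modulus z ^+ 2 = 1.
  by rewrite -mulrDl -sqr_modulus divff// expf_neq0// gt_eqF.
have [||s] := @IVT _ (fun x => z.1 ^+ 2 / (x + t * h `|x|) ^+ 2 +
    z.2 ^+ 2 / (x - t * h `|x|) ^+ 2) a b 1 ab.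
- apply: continuous_in_subspaceT => x; rewrite inE/= in_itv/= => /andP[ax _].
  exact/ell_continuous/(lt_le_trans a0 ax).
- rewrite (gtr0_norm a0) (gtr0_norm b0) ge_min le_max; apply/andP; split; apply/orP.
    right; rewrite -m1; apply: lerD; apply: E; rewrite ?sqr_ge0//.
    exact: le_trans Bb Ab.
  left; rewrite -m1; apply: lerD; apply: E; rewrite ?sqr_ge0 ?axis1_gt0 ?axis2_gt0//.
  exact: le_trans Ba Aa.
rewrite in_itv/= => /andP[as_ sb]; have s0 := lt_le_trans a0 as_.
rewrite (gtr0_norm s0) => e1.
have A0 := axis1_gt0 s0; have B0 := axis2_gt0 s0.
pose w : R * R := (z.1 * (s / axis1 s), z.2 * (s / axis2 s)).
have mw : modulus w = s.
  rewrite modulusE /w /= !exprMn.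
  rewrite (_ : _ + _ = s ^+ 2 * (z.1 ^+ 2 / axis1 s ^+ 2 + z.2 ^+ 2 / axis2 s ^+ 2)).
    by rewrite e1 mulr1 sqrtr_sqr gtr0_norm.
  by field; rewrite !gt_eqF.
exists w; rewrite transport_axis mw /w /=; case: (z) => x y /=.
by congr pair; field; rewrite !gt_eqF.
Qed.

Lemma axis2_le_modulus z : axis2 (modulus z) <= modulus (T z).
Proof.
have [->|z0] := eqVneq z 0.
  by rewrite transport0 !modulus0 /axis2 /h invr0 !mulr0 subr0.
have m0 : 0 < modulus z by rewrite modulus_gt0.
have B0 := axis2_gt0 m0.
have AB : axis2 (modulus z) <= axis1 (modulus z).
  by rewrite lerD2l -subr_ge0 opprK addr_ge0// mulr_ge0// h0// ltW.
rewrite -ler_sqr ?nnegrE ?modulus_ge0 ?(ltW B0)// sqr_modulus transport_axis /= !exprMn.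
rewrite -!exprMn.
have := unit_modulus z0; rewrite !exprMn.
have : axis2 (modulus z) ^+ 2 <= axis1 (modulus z) ^+ 2.
  by rewrite ler_sqr ?nnegrE ?(ltW B0)// (le_trans (ltW B0)).
have := sqr_ge0 (z.1 / modulus z); rewrite exprMn.
move: (z.1 ^+ 2 * _) (z.2 ^+ 2 * _) (axis1 _ ^+ 2) (axis2 _ ^+ 2) => p q u v; nra.
Qed.

End transport.

(** * Averages over roots of unity *)

Section unity_roots.
Context {R : realType}.
Implicit Types (a w u : R[i]) (N : nat).

Definition unity_roots N : seq R[i] := zeros ('X^N - 1).

Lemma unity_rootsE N : (0 < N)%N ->
  'X^N - 1 = \prod_(u <- unity_roots N) ('X - u%:P) :> {poly R[i]}.
Proof.
move=> N0; rewrite /unity_roots /zeros; case: closed_field_poly_normal => r /= {1}->.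
by rewrite lead_coefDl ?lead_coefXn ?scale1r// size_polyXn size_polyN size_poly1.
Qed.

Lemma size_unity_roots N : (0 < N)%N -> size (unity_roots N) = N.
Proof.
move=> N0; have := congr1 (fun p : {poly _} => size p) (unity_rootsE N0).
rewrite size_prod_XsubC size_polyDl; first by rewrite size_polyXn => -[].
by rewrite size_polyXn size_polyN size_poly1.
Qed.

Lemma unity_roots_expr N u : (0 < N)%N -> u \in unity_roots N -> u ^+ N = 1.
Proof.
move=> N0 uN; have : root ('X^N - 1) u by rewrite unity_rootsE// root_prod_XsubC.
by rewrite rootE !hornerE subr_eq0 => /eqP.
Qed.

Lemma normc_unity_root N u : (0 < N)%N -> u \in unity_roots N -> normc u = 1.
Proof.
move=> N0 /(unity_roots_expr N0) /(congr1 (fun v : R[i] => normc v)).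
rewrite normcX ComplexField.Normc.normc1 => /eqP.
by rewrite pexpr_eq1 ?normc_ge0// => /eqP.
Qed.

Lemma prod_cst_unity_roots N w : (0 < N)%N -> \prod_(u <- unity_roots N) w = w ^+ N.
Proof. by move=> N0; rewrite big_const_seq count_predT size_unity_roots// iter_mulr_1. Qed.

Lemma prod_unity_roots N a w : (0 < N)%N ->
  \prod_(u <- unity_roots N) (a - u * w) = a ^+ N - w ^+ N.
Proof.
move=> N0; have [->|w0] := eqVneq w 0.
  under eq_bigr do rewrite mulr0 subr0.
  by rewrite prod_cst_unity_roots// expr0n gtn_eqF// subr0.
have -> : a ^+ N - w ^+ N = w ^+ N * ('X^N - 1 : {poly R[i]}).[a / w].
  by rewrite !hornerE mulrBr mulr1 -exprMn mulrC divfK.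
rewrite unity_rootsE// horner_prod -prod_cst_unity_roots// -big_split /=.
by apply: eq_bigr => u _; rewrite hornerXsubC mulrBr mulrCA divff// mulr1 [w * u]mulrC.
Qed.

Lemma normc_prod (I : Type) (s : seq I) (F : I -> R[i]) :
  normc (\prod_(i <- s) F i) = \prod_(i <- s) normc (F i).
Proof.
elim: s => [|x s IH]; first by rewrite !big_nil ComplexField.Normc.normc1.
by rewrite !big_cons ComplexField.Normc.normcM IH.
Qed.

Lemma sum_ln_seq (I : eqType) (s : seq I) (F : I -> R) : (forall i, i \in s -> 0 < F i) ->
  \sum_(i <- s) ln (F i) = ln (\prod_(i <- s) F i).
Proof.
elim: s => [|x s IH] F0; first by rewrite !big_nil ln1.
have Fs i : i \in s -> 0 < F i by move=> si; apply: F0; rewrite in_cons si orbT.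
rewrite !big_cons IH// lnM// posrE ?F0 ?mem_head//.
by rewrite big_seq; apply: prodr_gt0.
Qed.

Lemma sum_ln_unity_roots N a w : (0 < N)%N -> a ^+ N - w ^+ N != 0 ->
  \sum_(u <- unity_roots N) ln (normc (a - u * w)) = ln (normc (a ^+ N - w ^+ N)).
Proof.
move=> N0 aw; rewrite sum_ln_seq.
  by rewrite -normc_prod prod_unity_roots.
move=> u uN; rewrite normc_gt0; apply: contraNneq aw => e.
by rewrite -prod_unity_roots// (big_rem u)//= e mul0r.
Qed.

(** The logarithmic derivative of a polynomial given by its roots. *)
Lemma sum_inv_roots (s : seq R[i]) x (p := \prod_(u <- s) ('X - u%:P)) :
  p.[x] != 0 -> \sum_(u <- s) (x - u)^-1 = (p^`()).[x] / p.[x].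
Proof.
rewrite {}/p; elim: s => [|v s IH]; first by rewrite !big_nil derivC horner0 mul0r.
rewrite !big_cons derivM derivXsubC mul1r !hornerE mulf_eq0 negb_or => /andP[xv ps].
by rewrite IH//; move: ps; set p := _.[x]; set q := _.[x] => p0; field; rewrite p0.
Qed.

Lemma sum_inv_unity_roots N x : (0 < N)%N -> x ^+ N != 1 ->
  \sum_(u <- unity_roots N) (x - u)^-1 = N%:R * x ^+ N.-1 / (x ^+ N - 1).
Proof.
move=> N0 xN; rewrite sum_inv_roots -unity_rootsE//.
  by rewrite derivB derivXn derivC subr0 !hornerE hornerMn hornerXn mulr_natl.
by rewrite !hornerE subr_eq0.
Qed.

Lemma sum_const_unity_roots N (x : R) : (0 < N)%N ->
  \sum_(u <- unity_roots N) x = N%:R * x.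
Proof.
by move=> N0; rewrite big_const_seq count_predT size_unity_roots// iter_addr_0 mulr_natl.
Qed.

Lemma complex_ReD (x y : R[i]) : complex.Re (x + y) = complex.Re x + complex.Re y.
Proof. by case: x; case: y. Qed.

Lemma Re_sum (I : Type) (s : seq I) (F : I -> R[i]) :
  complex.Re (\sum_(i <- s) F i) = \sum_(i <- s) complex.Re (F i).
Proof.
by elim: s => [|x s IH]; rewrite ?big_nil// !big_cons complex_ReD IH.
Qed.

Lemma Re_le_normc (x : R[i]) : `|complex.Re x| <= normc x.
Proof. by rewrite -[leRHS]normc_plane; exact: (normr_fst_le (plane x)). Qed.

(** With [x = a / w] the mean of the Poisson kernel over the roots of unity is
    [Re ((x ^+ N + 1) / (x ^+ N - 1))]. As soon as [|x ^+ N| >= 2] this is at most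
    [(2 + 1) / (2 - 1) = 3]. *)
Lemma sum_poisson_le N a w : (0 < N)%N -> 2 * normc w ^+ N <= normc a ^+ N ->
  a != 0 -> \sum_(u <- unity_roots N) complex.Re ((a + u * w) / (a - u * w)) <= N%:R * 3.
Proof.
move=> N0 aw a0.
have [->|w0] := eqVneq w 0.
  under eq_bigr do rewrite mulr0 addr0 subr0 divff//=.
  by rewrite sum_const_unity_roots// ler_pM2l ?ltr0n//; lra.
have an : 0 < normc a by rewrite normc_gt0.
have wn : 0 < normc w by rewrite normc_gt0.
pose x := a / w.
have xN : 2 <= normc (x ^+ N).
  rewrite normcX /x ComplexField.Normc.normcM ComplexField.Normc.normcV exprMn exprVn.
  by rewrite ler_pdivlMr// exprn_gt0.
have x1 : x ^+ N != 1.
  by apply: contraTneq xN => ->; rewrite ComplexField.Normc.normc1 -ltNge; lra.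
have xu u : u \in unity_roots N -> x - u != 0.
  move=> uN; rewrite subr_eq0; apply: contraNneq x1 => ->.
  by apply/eqP/unity_roots_expr.
rewrite -Re_sum.
have -> : \sum_(u <- unity_roots N) (a + u * w) / (a - u * w) =
    \sum_(u <- unity_roots N) (2 * x * (x - u)^-1 - 1).
  rewrite !big_seq; apply: eq_bigr => u uN; have xu0 := xu _ uN.
  have au : a - u * w = w * (x - u) by rewrite /x; field.
  rewrite au; have -> : a = w * x by rewrite /x; field.
  by move: xu0; move: (x) => y yu0; field; rewrite w0 yu0.
rewrite big_split /= -mulr_sumr sum_inv_unity_roots//.
rewrite big_const_seq count_predT size_unity_roots// iter_addr_0.
have x1' : x ^+ N - 1 != 0 by rewrite subr_eq0.
have -> : 2 * x * (N%:R * x ^+ N.-1 / (x ^+ N - 1)) + (-1) *+ N =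
   N%:R * ((x ^+ N + 1) / (x ^+ N - 1)).
  rewrite mulNrn -(prednK N0) exprS [N.-1.+1.-1]/=.
  move: x1'; rewrite -{1}(prednK N0) exprS => x1'.
  by move: (N.-1.+1%:R) (x ^+ N.-1) x1' => n y xy; field.
apply: (le_trans (ler_norm _)); apply: (le_trans (Re_le_normc _)).
have nN : normc (N%:R : R[i]) = N%:R.
  by rewrite -[N%:R]/((N%:R : R[i])) -(rmorph_nat (real_complex R)) /=
    expr0n/= addr0 sqrtr_sqr ger0_norm.
rewrite ComplexField.Normc.normcM nN ler_pM2l ?ltr0n//.
rewrite ComplexField.Normc.normcM ComplexField.Normc.normcV ler_pdivrMr ?normc_gt0//.
have h1 := le_normcD (x ^+ N) 1.
have h2 := le_normcD (x ^+ N - 1) 1.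
rewrite subrK ComplexField.Normc.normc1 in h1 h2.
lra.
Qed.

End unity_roots.

(** * Rotation invariant measures *)

Section rotation.
Context {R : realType}.
Implicit Types (u : R[i]) (z : R * R) (S : set (R * R)).

Definition rot u z : R * R := plane (u * cplx z).

Lemma modulus_rot u z : normc u = 1 -> modulus (rot u z) = modulus z.
Proof. by move=> u1; rewrite normc_plane ComplexField.Normc.normcM u1 mul1r. Qed.

Lemma cplx_rot u z : cplx (rot u z) = u * cplx z.
Proof. by rewrite planeK. Qed.

Lemma measurable_rot u : measurable_fun setT (rot u).
Proof.
case: u => a b; apply/measurable_fun_pairP; split.
- rewrite (_ : fst \o _ = fun z : R * R => a * z.1 - b * z.2)//.
  by apply: measurable_funB; apply: measurable_funM.
- rewrite (_ : snd \o _ = fun z : R * R => a * z.2 + b * z.1)//.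
  by apply: measurable_funD; apply: measurable_funM.
Qed.

HB.instance Definition _ u := isMeasurableFun.Build _ _ _ _ (rot u) (measurable_rot u).

Variable nu : probability (R * R)%type R.
Hypothesis nu_rot : rotation_invariant nu.

Lemma ge0_integral_rot u S (f : R * R -> \bar R) : normc u = 1 -> measurable S ->
  measurable_fun S f -> (forall z, S z -> 0 <= f z)%E -> rot u @^-1` S = S ->
  (\int[nu]_(z in S) f (rot u z) = \int[nu]_(z in S) f z)%E.
Proof.
move=> u1 mS mf f0 Su.
have := ge0_integral_pushforward (measurable_rot u) nu mS mf.
rewrite Su => <-; last by move=> z; rewrite inE; exact: f0.
by apply: eq_measure_integral => A mA _; rewrite -(nu_rot u1 mA).
Qed.

Lemma measurable_comp_rot u S (f : R * R -> \bar R) : measurable S ->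
  measurable_fun S f -> rot u @^-1` S = S -> measurable_fun S (f \o rot u).
Proof.
move=> mS mf Su; apply: (measurable_comp mS _ mf).
  by move=> _ [z Sz <-]; rewrite -Su in Sz.
exact: measurable_funTS (measurable_rot u).
Qed.

Lemma integrable_rot u S (f : R * R -> \bar R) : normc u = 1 -> measurable S ->
  rot u @^-1` S = S -> nu.-integrable S f -> nu.-integrable S (f \o rot u).
Proof.
move=> u1 mS Su /integrableP[mf fi]; apply/integrableP; split.
  exact: measurable_comp_rot.
rewrite (ge0_integral_rot (f := fun z => `|f z|%E))//.
exact: measurableT_comp.
Qed.

Lemma integral_rot u S (f : R * R -> \bar R) : normc u = 1 -> measurable S ->
  rot u @^-1` S = S -> measurable_fun S f ->
  (\int[nu]_(z in S) f (rot u z) = \int[nu]_(z in S) f z)%E.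
Proof.
move=> u1 mS Su mf; rewrite integralE [RHS]integralE.
congr (_ - _)%E.
- rewrite -(ge0_integral_rot u1 mS (measurable_funepos mf) _ Su)//.
  by apply: eq_integral => z _; rewrite funepos_comp.
- rewrite -(ge0_integral_rot u1 mS (measurable_funeneg mf) _ Su)//.
  by apply: eq_integral => z _; rewrite funeneg_comp.
Qed.

Definition rot_stable S := forall u, normc u = 1 -> rot u @^-1` S = S.

Lemma modulus_stable (p : set R) : rot_stable [set z | p (modulus z)].
Proof. by move=> u u1; apply/funext => z /=; rewrite modulus_rot. Qed.

(** By invariance the integral of [f] is that of its mean over the N-th roots of unity, so a
    pointwise bound on the mean suffices. This stands in for integration along circles. *)
Lemma le_integral_average N S (f : R * R -> R) (K : R) : (0 < N)%N ->
  measurable S -> rot_stable S -> nu.-integrable S (EFin \o f) ->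
  (forall z, S z -> \sum_(u <- unity_roots N) f (rot u z) <= N%:R * K) ->
  (\int[nu]_(z in S) (f z)%:E <= K%:E * nu S)%E.
Proof.
move=> N0 mS Sr fi fK.
have NR : (0 < N%:R :> R) by rewrite ltr0n.
(* Set to 0 off the roots of unity, so that [F u] is integrable for every [u], as the interchange of
   sum and integral demands. *)
pose F u z : \bar R := if u \in unity_roots N then (f (rot u z))%:E else 0%E.
have hi u : nu.-integrable S (F u).
  have [uN|/negbTE uN] := boolP (u \in unity_roots N); rewrite /F uN; last exact: integrable0.
  have u1 := normc_unity_root N0 uN.
  exact: (integrable_rot u1 mS (Sr _ u1) fi).
have fin := integrable_fin_num mS fi.
have FE z : (\sum_(u <- unity_roots N) F u z)%E = (\sum_(u <- unity_roots N) f (rot u z))%:E.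
  by rewrite -sumEFin !big_seq; apply: eq_bigr => u uN; rewrite /F uN.
have e : (\int[nu]_(z in S) (\sum_(u <- unity_roots N) F u z) =
    N%:R%:E * \int[nu]_(z in S) (f z)%:E)%E.
  rewrite integral_sum// big_seq (eq_bigr (fun=> \int[nu]_(z in S) (f z)%:E))%E.
    by rewrite -big_seq -(fineK fin) sumEFin sum_const_unity_roots.
  move=> u uN; have u1 := normc_unity_root N0 uN; rewrite /F uN.
  by apply: (integral_rot u1 mS (Sr _ u1)); apply: measurable_int fi.
have : (\int[nu]_(z in S) (\sum_(u <- unity_roots N) F u z) <=
    \int[nu]_(z in S) (N%:R * K)%:E)%E.
  apply: le_integral => //.
  - exact: integrable_sum.
  - by apply: finite_measure_integrable_cst => //.
  - by move=> z; rewrite inE => Sz; rewrite FE lee_fin; exact: fK.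
by rewrite e integral_cst// EFinM -muleA lee_pmul2l// lte_fin.
Qed.

End rotation.

(** * Measures of quadratic growth on discs *)

Section measurability.
Context {R : realType}.

Lemma measurable_modulus : measurable_fun setT (@modulus R).
Proof.
rewrite (_ : @modulus R = Num.sqrt \o (fun z : R * R => z.1 ^+ 2 + z.2 ^+ 2))//.
apply: measurableT_comp; first by apply: continuous_measurable_fun; exact: sqrt_continuous.
by apply: measurable_funD; apply: measurable_funX.
Qed.

Lemma measurable_subr2 (z : R * R) : measurable_fun setT (fun y : R * R => z - y).
Proof.
apply/measurable_fun_pairP; split.
- by rewrite (_ : fst \o _ = fun y : R * R => z.1 - y.1)//; apply: measurable_funB.
- by rewrite (_ : snd \o _ = fun y : R * R => z.2 - y.2)//; apply: measurable_funB.
Qed.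

Lemma measurable_dist (z : R * R) : measurable_fun setT (fun y : R * R => modulus (z - y)).
Proof. exact: (measurableT_comp measurable_modulus (measurable_subr2 z)). Qed.

Lemma measurable_fun_inv (d : measure_display) (T : measurableType d) (D : set T) (f : T -> R) :
  measurable_fun D f -> measurable_fun D (fun x => (f x)^-1).
Proof.
(* The identity [1 / y = y / |y|^2] reduces the inverse to a real power of a nonnegative number; it
   respects [0^-1 = 0]. *)
move=> mf; rewrite (_ : (fun x => (f x)^-1) = (fun x => f x * (`|f x| ^+ 2) `^ (-1))).
  apply: measurable_funM => //; apply: (measurableT_comp (@measurable_powR R (-1))).
  by apply: measurable_funX; apply: measurableT_comp.
apply/funext => x; rewrite powR_inv1 ?sqr_ge0// real_normK ?num_real//.
have [->|fx] := eqVneq (f x) 0; first by rewrite mul0r invr0.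
by field.
Qed.

Definition disc (z : R * R) (r : R) : set (R * R) := [set y | modulus (z - y) < r].

Lemma measurable_disc z r : measurable (disc z r).
Proof.
have := measurable_dist z; move=> /(_ measurableT `]-oo, r[%classic (measurable_itv _)).
by rewrite setTI; congr measurable; apply/seteqP; split => y /=; rewrite in_itv.
Qed.

Lemma measurable_modulus_lt (r : R) : measurable [set y : R * R | modulus y < r].
Proof.
have := measurable_modulus; move=> /(_ measurableT `]-oo, r[%classic (measurable_itv _)).
by rewrite setTI; congr measurable; apply/seteqP; split => y /=; rewrite in_itv.
Qed.

End measurability.

Section disc_bound.
Context {R : realType}.
Variables (g : R -> R) (c : R).
Hypothesis c0 : 0 <= c.
Let h (r : R) := alpha0 g r / r.
Hypothesis h0 : forall r, 0 <= r -> 0 <= h r.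
Hypothesis hL : forall x y : R, 0 <= x -> 0 <= y -> `|h x - h y| <= c * `|x - y|.
Hypothesis al0 : alpha0 g 0 = 0.
Variable nu : probability (R * R)%type R.
Hypothesis nuP : nu0_spec g nu.

Lemma alpha0_h (r : R) : 0 <= r -> alpha0 g r = r * h r.
Proof.
rewrite le_eqVlt => /predU1P[<-|r0]; first by rewrite al0 mul0r.
by rewrite /h; field; rewrite gt_eqF.
Qed.

(** The bound is [c (s^2 - r^2)]: the mass of a shell is at most a multiple of its area. *)
Lemma alpha0_diff (r s : R) : 0 <= r -> r <= s ->
  `|alpha0 g s - alpha0 g r| <= c * (s + r) * (s - r).
Proof.
move=> r0 rs; have s0 := le_trans r0 rs.
rewrite !alpha0_h// (_ : _ - _ = s * (h s - h r) + h r * (s - r)); last by ring.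
have hr0 : `|h r| = h r by apply/ger0_norm/h0.
apply: (le_trans (ler_normD _ _)); rewrite (normrM s) (normrM (h r)) (ger0_norm s0) hr0.
have := hL s0 r0; have := h_le h0 hL r0.
rewrite -/(h r) (ger0_norm (_ : 0 <= s - r)) ?subr_ge0// => H1 H2.
rewrite (_ : c * (s + r) * (s - r) = s * (c * (s - r)) + c * r * (s - r)); last by ring.
by rewrite lerD// ?ler_wpM2l// ler_wpM2r// subr_ge0.
Qed.

Lemma nu_modulus_lt (r : R) : 0 <= r -> nu [set z | modulus z < r] = (alpha0 g r)%:E.
Proof.
rewrite le_eqVlt => /predU1P[<-|r0]; last by case: nuP => _; exact.
rewrite al0 (_ : [set z | _] = set0) ?measure0//.
by apply/seteqP; split => z //=; rewrite ltNge modulus_ge0.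
Qed.

Definition shell (r s : R) : set (R * R) := [set z | r <= modulus z < s].

Lemma shellE (r s : R) : shell r s = [set z | modulus z < s] `\` [set z | modulus z < r].
Proof.
apply/seteqP; split => z /=; first by move=> /andP[rz zs]; split=> //; apply/negP; rewrite -leNgt.
by move=> [zs /negP]; rewrite -leNgt /shell /= zs => ->.
Qed.

Lemma measurable_shell (r s : R) : measurable (shell r s).
Proof. by rewrite shellE; apply: measurableD; exact: measurable_modulus_lt. Qed.

Lemma nu_shell (r s : R) : 0 <= r -> r <= s ->
  nu (shell r s) = (alpha0 g s - alpha0 g r)%:E.
Proof.
move=> r0 rs; rewrite EFinB -(nu_modulus_lt (le_trans r0 rs)) -(nu_modulus_lt r0) shellE.
have sub : [set z : R * R | modulus z < r] `<=` [set z | modulus z < s].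
  by move=> z /= /lt_le_trans; exact.
rewrite measureD; last 3 first.
- exact: measurable_modulus_lt.
- exact: measurable_modulus_lt.
- by rewrite ltey_eq fin_num_measure//; exact: measurable_modulus_lt.
by rewrite setIidr.
Qed.

Lemma nu_shell_le (r s : R) : 0 <= r -> r <= s ->
  (nu (shell r s) <= (c * (s + r) * (s - r))%:E)%E.
Proof.
move=> r0 rs; rewrite nu_shell// lee_fin (le_trans (ler_norm _))//.
exact: alpha0_diff.
Qed.

Lemma exprn_ge2 (q : R) : 1 < q -> exists2 N, (0 < N)%N & 2 <= q ^+ N.
Proof.
move=> q1; have q0 : 0 < q - 1 by rewrite subr_gt0.
pose N := (Num.truncn (q - 1)^-1).+1.
exists N => //.
have Bern n : 1 + n%:R * (q - 1) <= q ^+ n.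
  elim: n => [|n IH]; first by rewrite mul0r addr0 expr0.
  rewrite exprS; have : 0 <= n%:R * (q - 1) :> R by rewrite mulr_ge0// ltW.
  rewrite -natr1; nra.
apply: le_trans (Bern N); have : (q - 1)^-1 <= N%:R.
  by rewrite ltW// truncnS_gt // ?invr_ge0 // ltW.
by rewrite -div1r ler_pdivrMr// => ?; lra.
Qed.

(* The Poisson kernel of a point [a] just outside the shell of [z] dominates the
   indicator of the disc, and its circular means are about 1. *)
Lemma nu_disc_le z (r : R) : 0 < r -> (nu (disc z r) <= (108 * c * r ^+ 2)%:E)%E.
Proof.
move=> r0; set s := modulus z; have s0 : 0 <= s := modulus_ge0 z.
have tri y : disc z r y -> s - r < modulus y < s + r.
  move=> zy; have {}zy : modulus (z - y) < r := zy.
  have H1 := le_modulusB z y; have := le_modulusB y z; rewrite (modulusBC y z) => H2.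
  by rewrite -/s in H1 H2; apply/andP; split; lra.
have [sr|rs] := ltP s r.
  apply: (@le_trans _ _ (nu [set y | modulus y < 2 * r])).
    rewrite le_measure ?inE; [|exact: measurable_disc|exact: measurable_modulus_lt|].
      by [].
    by move=> y /tri/andP[_]/= ?; lra.
  have r2 : 0 <= 2 * r by lra.
  apply: (@le_trans _ _ (alpha0 g (2 * r))%:E); first by rewrite -(nu_modulus_lt r2).
  rewrite lee_fin alpha0_h//.
  have := h_le h0 hL r2; rewrite -/(h _) => H.
  have c2 : 0 <= c * r ^+ 2 by rewrite mulr_ge0// sqr_ge0.
  have := ler_wpM2l r2 H; rewrite (_ : 2 * r * (c * (2 * r)) = 4 * (c * r ^+ 2)); last by ring.
  by move/le_trans; apply; lra.
have s_gt0 : 0 < s by lra.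
(* The pole lies on the ray of [z] at modulus [s + 2 r]: at distance more than [r] from the shell,
   and less than [3 r] from every point of the disc. *)
pose a : R[i] := (1 + 2 * r / s)%:C * cplx z.
have q0 : 0 < 1 + 2 * r / s by rewrite addr_gt0// divr_gt0// mulr_gt0.
have na : normc a = s + 2 * r.
  rewrite ComplexField.Normc.normcM -/(modulus z) -/s /= expr0n/= addr0 sqrtr_sqr gtr0_norm//.
  by field; rewrite gt_eqF.
have a0 : a != 0 by rewrite -normc_gt0 na; lra.
have az : normc (a - cplx z) = 2 * r.
  have -> : a - cplx z = (2 * r / s)%:C * cplx z by rewrite /a rmorphD rmorph1 /=; ring.
  rewrite ComplexField.Normc.normcM -/(modulus z) -/s /= expr0n/= addr0 sqrtr_sqr gtr0_norm//.
    by field; rewrite gt_eqF.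
  by rewrite divr_gt0// mulr_gt0.
pose P (y : R * R) := complex.Re ((a + cplx y) / (a - cplx y)).
have PE y : modulus y < s + 2 * r ->
    P y = (normc a ^+ 2 - modulus y ^+ 2) / normc (a - cplx y) ^+ 2.
  move=> ys; have : a - cplx y != 0.
    by rewrite subr_eq0; apply: contraTneq ys => e; rewrite /modulus -e na ltxx.
  have E : a - cplx y = cplx (plane a - y) by rewrite cplxB planeK.
  rewrite /P E cplx_eq0 -modulus_eq0 cplxV -/(modulus (plane a - y)) => m0.
  rewrite -(normc_plane a) !sqr_modulus -sqr_modulus; move: m0.
  move: (modulus (plane a - y)) => m m0; clear -m0; case: a => a b; case: y => u v /=.
  by simpc => /=; field.
set S := shell (s - r) (s + r).
have mS : measurable S by exact: measurable_shell.
have Sy y : S y -> [/\ s - r <= modulus y, modulus y < s + r, r < normc (a - cplx y) &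
    modulus y < s + 2 * r].
  move=> /andP[sy ys]; split=> //; last by lra.
  have := le_modulusB (plane a) y; rewrite normc_plane na /modulus cplxB planeK.
  by rewrite -/(modulus y); lra.
have Pb y : S y -> 0 <= P y <= normc a ^+ 2 / r ^+ 2.
  move=> /Sy[sy ys ay ys2]; rewrite PE//.
  have y0 := modulus_ge0 y.
  have y2 : modulus y ^+ 2 <= normc a ^+ 2.
    by rewrite ler_sqr ?nnegrE ?modulus_ge0 ?normc_ge0// na ltW.
  rewrite divr_ge0 ?sqr_ge0 ?subr_ge0// andTb.
  rewrite ler_pM ?subr_ge0 ?invr_ge0 ?sqr_ge0//.
    by rewrite gerBl sqr_ge0.
  move: (normc (a - cplx y)) ay => n ay; have n0 := lt_trans r0 ay.
  by rewrite lef_pV2 ?posrE ?exprn_gt0// ler_sqr ?nnegrE ltW.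
have mP : measurable_fun S P.
  apply: (@eq_measurable_fun _ _ _ _ S (fun y : R * R =>
    (normc a ^+ 2 - modulus y ^+ 2) * (modulus (plane a - y) ^+ 2)^-1)).
    move=> y; rewrite inE => /Sy[_ _ _ ys]; rewrite PE//.
  apply: measurable_funTS; apply: measurable_funM.
    by apply: measurable_funB => //; apply: measurable_funX; exact: measurable_modulus.
  by apply: measurable_fun_inv; apply: measurable_funX; exact: measurable_dist.
have Pi : nu.-integrable S (EFin \o P).
  apply: measurable_bounded_integrable => //.
    by rewrite (le_lt_trans (probability_le1 _ mS))// ltry.
  exists (normc a ^+ 2 / r ^+ 2); split; first exact: num_real.
  move=> x Mx y /Pb/andP[P0 PM]; rewrite /mkset ger0_norm//; exact: le_trans PM (ltW Mx).
(* This [N] doubles the ratio of the moduli, as [sum_poisson_le] asks, uniformly on the shell. *)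
have [|N N0 qN] := @exprn_ge2 ((s + 2 * r) / (s + r)).
  by rewrite ltr_pdivlMr ?mul1r; lra.
have PS : (\int[nu]_(y in S) (P y)%:E <= 3%:E * nu S)%E.
  apply: (@le_integral_average _ nu _ N) => //.
  - by case: nuP.
  - exact: modulus_stable (fun u => s - r <= u < s + r).
  - move=> y /Sy[_ ys _ _].
    rewrite (eq_bigr (fun u => complex.Re ((a + u * cplx y) / (a - u * cplx y)))).
      apply: sum_poisson_le => //; rewrite na -/(modulus y).
      have -> : (s + 2 * r) ^+ N = ((s + 2 * r) / (s + r)) ^+ N * (s + r) ^+ N.
        by rewrite -exprMn divfK// gt_eqF//; lra.
      rewrite ler_pM ?exprn_ge0 ?modulus_ge0//.
      by rewrite lerXn2r ?nnegrE ?modulus_ge0 ?ltW//; lra.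
    by move=> u _; rewrite /P cplx_rot.
have dS : disc z r `<=` S.
  by move=> y /tri/andP[H1 H2]; rewrite /S /shell /= H2 ltW.
have rs0 : 0 <= 9 * r / s by rewrite divr_ge0// mulr_ge0// ltW.
(* On the disc the kernel is at least [s / (9 r)]: its numerator is at least
   [(s + 2 r)^2 - (s + r)^2 >= s r], its denominator at most [(3 r)^2]. *)
have : (nu (disc z r) <= \int[nu]_(y in S) ((9 * r / s)%:E * (P y)%:E))%E.
  rewrite -[leLHS]mul1e -integral_cst; last exact: measurable_disc.
  apply: (@le_trans _ _ (\int[nu]_(y in disc z r) ((9 * r / s)%:E * (P y)%:E)))%E.
    apply: ge0_le_integral => //.
    - exact: measurable_disc.
    - by apply: measurable_funeM; apply/measurable_EFinP; exact: measurable_funS mP.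
    move=> y yd; have := Sy _ (dS _ yd) => -[sy ys ay ys2].
    rewrite -EFinM lee_fin PE//.
    have y0 := modulus_ge0 y.
    have d0 := lt_trans r0 ay.
    have d3 : normc (a - cplx y) <= 3 * r.
      have := le_modulusD (plane (a - cplx z)) (z - y).
      rewrite normc_plane az /modulus cplxD planeK cplxB addrA subrK -/(modulus (z - y)).
      by move/le_trans; apply; have : modulus (z - y) < r := yd; lra.
    rewrite mulrA ler_pdivlMr ?exprn_gt0// mul1r.
    apply: (@le_trans _ _ (9 * r * r)).
      have : normc (a - cplx y) ^+ 2 <= (3 * r) ^+ 2.
        by rewrite ler_sqr ?nnegrE ?mulr_ge0 ?normc_ge0// ltW.
      by rewrite exprMn; lra.
    rewrite -[leRHS]mulrA ler_pM2l ?mulr_gt0// ler_pdivlMl// na.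
    by move: (modulus y) sy ys y0 => m sy ys y0; clear -sy ys y0 s_gt0 r0; nra.
  apply: ge0_subset_integral => //.
  - exact: measurable_disc.
  - by apply: measurable_funeM; exact/measurable_EFinP.
  - by move=> y /Pb/andP[P0 _]; rewrite mule_ge0// lee_fin.
move/le_trans; apply; rewrite integralZl//.
apply: (@le_trans _ _ ((9 * r / s)%:E * (3%:E * (c * (s + r + (s - r)) * (s + r - (s - r)))%:E)))%E.
  rewrite lee_pmul//.
  - by apply: integral_ge0 => y /Pb/andP[P0 _]; rewrite lee_fin.
  - by apply: (le_trans PS); rewrite lee_pmul2l// nu_shell_le//; lra.
rewrite -!EFinM lee_fin.
(* 108 is [9 * 3 * 4]: the lower bound of the kernel, the bound on its means, and the factor in
   [4 s r] from the area of the shell. *)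
have -> : 9 * r / s * (3 * (c * (s + r + (s - r)) * (s + r - (s - r)))) = 108 * c * r ^+ 2.
  by field; rewrite gt_eqF.
by [].
Qed.

End disc_bound.

Section singular_integral.
Context {R : realType}.
Variables (mu : probability (R * R)%type R) (M : R).
Hypothesis M0 : 0 <= M.
Hypothesis muD : forall z (r : R), 0 < r -> (mu (disc z r) <= (M * r ^+ 2)%:E)%E.
Implicit Types (z y : R * R) (A : set (R * R)).

Definition inv_dist z y : R := (modulus (z - y))^-1.

Lemma inv_dist_ge0 z y : 0 <= inv_dist z y.
Proof. by rewrite invr_ge0 modulus_ge0. Qed.

Lemma measurable_inv_dist z : measurable_fun setT (inv_dist z).
Proof. by apply: measurable_fun_inv; exact: measurable_dist. Qed.

Lemma measurable_inv_distE z A : measurable_fun A (EFin \o inv_dist z).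
Proof.
apply/measurable_EFinP; apply: measurable_funTS; exact: measurable_inv_dist.
Qed.

Lemma disc_sub z (r s : R) : r <= s -> disc z r `<=` disc z s.
Proof. by move=> rs y; move/lt_le_trans; exact. Qed.

(** The outermost dyadic annulus contributes at most [(2 / r) (M r^2) = 2 M r]; halving [r] produces
    a geometric series. *)
Lemma integral_inv_dist_annulus z n (r : R) : 0 < r ->
  (\int[mu]_(y in disc z r `\` disc z (r / 2 ^+ n)) (inv_dist z y)%:E <=
   (4 * M * r * (1 - (2 ^+ n)^-1))%:E)%E.
Proof.
elim: n r => [|n IH] r r0.
  by rewrite expr0 divr1 setDv integral_set0 invr1 subrr mulr0.
have r2 : 0 < r / 2 by rewrite divr_gt0.
have -> : disc z r `\` disc z (r / 2 ^+ n.+1) =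
    (disc z r `\` disc z (r / 2)) `|` (disc z (r / 2) `\` disc z (r / 2 / 2 ^+ n)).
  have -> : r / 2 ^+ n.+1 = r / 2 / 2 ^+ n.
    by rewrite exprS invfM mulrA.
  have s1 : disc z (r / 2) `<=` disc z r by apply: disc_sub; lra.
  have s2 : disc z (r / 2 / 2 ^+ n) `<=` disc z (r / 2).
    apply: disc_sub; rewrite ler_pdivrMr ?exprn_gt0// ler_peMr ?(ltW r2)//.
    by rewrite exprn_ege1//; lra.
  apply/seteqP; split => y /=.
    move=> [y1 y2]; have [y3|y3] := pselect (disc z (r / 2) y); first by right.
    by left.
  move=> [[y1 y2]|[y1 y2]]; split=> //; last exact: s1.
  by move=> /s2.
rewrite ge0_integral_setU; last 5 first.
- by apply: measurableD; exact: measurable_disc.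
- by apply: measurableD; exact: measurable_disc.
- exact: measurable_inv_distE.
- by move=> y _; rewrite lee_fin inv_dist_ge0.
- by rewrite disj_set2E; apply/eqP/seteqP; split => y //= [[_ h1] [h2 _]].
apply: (@le_trans _ _ ((2 * M * r)%:E + (4 * M * (r / 2) * (1 - (2 ^+ n)^-1))%:E)%E).
  apply: leeD; last exact: IH.
  apply: (@le_trans _ _ (\int[mu]_(y in disc z r `\` disc z (r / 2)) (2 / r)%:E)%E).
    apply: ge0_le_integral => //.
    - by apply: measurableD; exact: measurable_disc.
    - by move=> y _; rewrite lee_fin inv_dist_ge0.
    - exact: measurable_inv_distE.
    - move=> y [_ /negP]; rewrite -leNgt => ry; rewrite lee_fin.
      by rewrite -[2 / r]invrK invf_div lef_pV2 ?posrE// (lt_le_trans r2).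
  rewrite integral_cst; last by apply: measurableD; exact: measurable_disc.
  apply: (@le_trans _ _ ((2 / r)%:E * (M * r ^+ 2)%:E)%E).
    rewrite lee_pmul2l ?lte_fin ?divr_gt0//; apply: le_trans (muD z r0).
    apply: le_measure; rewrite ?inE; [|exact: measurable_disc|exact: subDsetl].
    by apply: measurableD; exact: measurable_disc.
  by rewrite -EFinM lee_fin le_eqVlt; apply/orP; left; apply/eqP; field; rewrite gt_eqF.
rewrite -EFinD lee_fin exprS invfM le_eqVlt; apply/orP; left; apply/eqP.
by move: (2 ^+ n)^-1 => q; field.
Qed.

Lemma mu_set1 z : mu [set z] = 0%E.
Proof.
have m1 : measurable [set z].
  have -> : [set z] = [set z.1] `*` [set z.2].
    by apply/seteqP; split => -[x y] /=; [move=> <-|case: z => u v /= [-> ->]].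
  exact: measurableX.
apply/eqP; rewrite eq_le measure_ge0 andbT; apply/lee_addgt0Pr => e e0.
rewrite add0e; pose r := Num.min 1 (e / (M + 1)).
have M1 : 0 < M + 1 by rewrite ltr_wpDl.
have r0 : 0 < r by rewrite lt_min ltr01 divr_gt0.
apply: (@le_trans _ _ (mu (disc z r))).
  rewrite le_measure ?inE//; first exact: measurable_disc.
  by move=> y /= ->; rewrite /disc /= subrr modulus0.
apply: (le_trans (muD z r0)); rewrite lee_fin.
have r1 : r <= 1 by rewrite ge_min lexx.
have re : r * (M + 1) <= e by rewrite -ler_pdivlMr// ge_min lexx orbT.
nra.
Qed.

Lemma integral_inv_dist_disc z (r : R) : 0 < r ->
  (\int[mu]_(y in disc z r) (inv_dist z y)%:E <= (4 * M * r)%:E)%E.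
Proof.
move=> r0; pose F n := disc z r `\` disc z (r / 2 ^+ n).
have mF n : measurable (F n) by apply: measurableD; exact: measurable_disc.
have mono m n : (m <= n)%N -> F m `<=` F n.
  move=> mn y [y1 y2]; split=> // y3; apply: y2; apply: disc_sub y3.
  by rewrite ler_pM2l// lef_pV2 ?posrE ?exprn_gt0// ler_weXn2l//; lra.
have FU : \bigcup_n F n = disc z r `\` [set z].
  apply/seteqP; split => y.
    move=> [n _ [y1 y2]]; split=> // yz; apply: y2; rewrite yz /disc /= subrr modulus0.
    by rewrite divr_gt0// exprn_gt0.
  move=> [y1 yz]; have zy : 0 < modulus (z - y).
    by rewrite modulus_gt0 subr_eq0; apply/eqP => e; apply: yz.
  have [N N0 qN] : exists2 N, (0 < N)%N & r / modulus (z - y) <= 2 ^+ N.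
    exists (Num.truncn (r / modulus (z - y))).+1 => //.
    have : r / modulus (z - y) < (Num.truncn (r / modulus (z - y))).+1%:R.
      by apply: truncnS_gt.
    move/ltW/le_trans; apply; rewrite -natrX ler_nat; exact/ltnW/ltn_expl.
  exists N => //; split=> // y2; move: qN; rewrite ler_pdivrMr// leNgt => /negP; apply.
  by rewrite mulrC -ltr_pdivlMr ?exprn_gt0.
have mD := measurable_disc z r.
(* The annuli exhaust the disc without its centre. There [inv_dist] is 0, by [0^-1 = 0], so the
   missing point contributes nothing. *)
have -> : (\int[mu]_(y in disc z r) (inv_dist z y)%:E =
    \int[mu]_(y in \bigcup_n F n) (inv_dist z y)%:E)%E.
  rewrite FU.
  have mz : measurable [set z].
    have -> : [set z] = [set z.1] `*` [set z.2].
      by apply/seteqP; split => -[x y] /=; [move=> <-|case: (z) => u v /= [-> ->]].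
    exact: measurableX.
  have {1}-> : disc z r = (disc z r `\` [set z]) `|` [set z].
    rewrite setUC setDUK// => y /= ->; by rewrite /disc /= subrr modulus0.
  rewrite ge0_integral_setU//; last 4 first.
  - exact: measurableD.
  - exact: measurable_inv_distE.
  - by move=> y _; rewrite lee_fin inv_dist_ge0.
  - by rewrite disj_set2E setDKI.
  rewrite [X in (_ + X)%E](_ : _ = 0%E) ?adde0//.
  rewrite (eq_integral (cst 0%E)) ?integral0// => y; rewrite inE /= => ->.
  by rewrite /inv_dist subrr modulus0 invr0.
have nd : {homo F : n m / (n <= m)%N >-> (n <= m)%O}.
  by move=> m n mn; apply/subsetPset; exact: mono.
have mf n : measurable_fun (F n) (fun y => (inv_dist z y)%:E) by exact: measurable_inv_distE.
have f0 n y : F n y -> (0 <= (inv_dist z y)%:E)%E by rewrite lee_fin inv_dist_ge0.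
have cv := ge0_nondecreasing_set_cvg_integral (mu := mu) nd mF mf f0.
rewrite -(cvg_lim _ cv)//; apply: lime_le; first by apply/cvg_ex; eexists; exact: cv.
near=> n; apply: (le_trans (integral_inv_dist_annulus z n r0)).
rewrite lee_fin -[leRHS]mulr1 ler_wpM2l//; first by rewrite !mulr_ge0// ltW.
Unshelve. all: by end_near. Qed.

(* Optimising in [r] makes the right-hand side small with [mu A]. *)
Lemma integral_inv_dist_le z A (r : R) : 0 < r -> measurable A ->
  (\int[mu]_(y in A) (inv_dist z y)%:E <= (4 * M * r)%:E + (r^-1)%:E * mu A)%E.
Proof.
move=> r0 mA; have mD := measurable_disc z r.
rewrite -{1}(setUIDK A (disc z r)) ge0_integral_setU; last 5 first.
- exact: measurableI.
- exact: measurableD.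
- exact: measurable_inv_distE.
- by move=> y _; rewrite lee_fin inv_dist_ge0.
- by rewrite disj_set2E; apply/eqP/seteqP; split => y //= [[_ ?] [_]].
apply: leeD.
  apply: le_trans (integral_inv_dist_disc z r0).
  apply: ge0_subset_integral => //; [exact: measurableI|exact: measurable_inv_distE|].
  by move=> y _; rewrite lee_fin inv_dist_ge0.
apply: (@le_trans _ _ (\int[mu]_(y in A `\` disc z r) (r^-1)%:E)%E).
  apply: ge0_le_integral => //.
  - exact: measurableD.
  - by move=> y _; rewrite lee_fin inv_dist_ge0.
  - exact: measurable_inv_distE.
  - move=> y [_ /negP]; rewrite -leNgt => ry; rewrite lee_fin lef_pV2 ?posrE//.
    exact: lt_le_trans ry.
rewrite integral_cst; last exact: measurableD.
rewrite lee_pmul2l ?lte_fin ?invr_gt0//.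
by apply: le_measure; rewrite ?inE; [exact: measurableD|exact: mA|exact: subDsetl].
Qed.

Lemma integrable_inv_dist z : mu.-integrable setT (EFin \o inv_dist z).
Proof.
apply/integrableP; split; first exact: measurable_inv_distE.
under eq_integral do rewrite /= ger0_norm ?inv_dist_ge0//.
apply: (le_lt_trans (integral_inv_dist_le z ltr01 measurableT)).
by rewrite invr1 mul1e probability_setT -EFinD ltry.
Qed.

End singular_integral.

(** * Logarithmic potentials and Stieltjes transforms *)

Section log_inequalities.
Context {R : realType}.
Implicit Types (x y : R) (u : R[i]).

Lemma ln_le_subr1 x : 0 < x -> ln x <= x - 1.
Proof.
move=> x0; have e : 1 + (x - 1) = x by ring.
by rewrite -{1}e le_ln1Dx//; lra.
Qed.

Lemma ln_ge_1Binv x : 0 < x -> 1 - x^-1 <= ln x.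
Proof.
move=> x0; have := @ln_le_subr1 x^-1; rewrite invr_gt0 => /(_ x0).
rewrite lnV ?posrE//; lra.
Qed.

Lemma normr_ln_le x : 0 <= x -> `|ln x| <= x^-1 + x.
Proof.
rewrite le_eqVlt => /predU1P[<-|x0]; first by rewrite ln0// normr0 invr0 addr0.
have := ln_le_subr1 x0; have := ln_ge_1Binv x0.
have : 0 < x^-1 by rewrite invr_gt0.
by rewrite ler_norml => ? ? ?; apply/andP; split; lra.
Qed.

Lemma normr_lnB_le x y : 0 < x -> 0 < y -> `|ln x - ln y| <= `|x - y| * (x^-1 + y^-1).
Proof.
move=> x0 y0; rewrite -ln_div ?posrE//.
have xy0 : 0 < x / y by rewrite divr_gt0.
have := ln_le_subr1 xy0; have := ln_ge_1Binv xy0.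
rewrite invf_div (_ : x / y - 1 = (x - y) * y^-1); last by field; rewrite gt_eqF.
rewrite (_ : 1 - y / x = (x - y) * x^-1); last by field; rewrite gt_eqF.
have xi : 0 < x^-1 by rewrite invr_gt0.
have yi : 0 < y^-1 by rewrite invr_gt0.
rewrite ler_norml; move: x^-1 y^-1 xi yi => a b a0 b0.
have := ler_norm (x - y); have := ler_norm (- (x - y)); rewrite normrN.
have := normr_ge0 (x - y); move: `|x - y| (x - y) => m d m0 d1 d2 h1 h2.
by apply/andP; split; nra.
Qed.

(** With [p = |1 + u|^2 = 1 + 2 Re u + |u|^2], [ln |1 + u|] lies between the halves of [1 - 1 / p]
    and of [p - 1]. As [p >= 1/4] and [|p - 1| <= 5/2 |u|], these halves differ by at most
    [25/2 |u|^2]; 13 leaves a margin. *)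
Lemma ln_normc_1D u : normc u <= 2^-1 ->
  `|ln (normc (1 + u)) - complex.Re u| <= 13 * normc u ^+ 2.
Proof.
move=> u2; have u0 := normc_ge0 u.
have nu : 2^-1 <= normc (1 + u).
  have := le_normcD (1 + u) (- u); rewrite addrK normcN ComplexField.Normc.normc1; lra.
have n0 : 0 < normc (1 + u) by lra.
have -> : ln (normc (1 + u)) = 2^-1 * ln (normc (1 + u) ^+ 2).
  by rewrite lnXn// -[X in _ = _ * X]mulr_natl mulrA mulVf ?mul1r// pnatr_eq0.
have e1 : normc (1 + u) ^+ 2 = 1 + 2 * complex.Re u + normc u ^+ 2.
  have := sqr_modulus (plane (1 + u)); have := sqr_modulus (plane u).
  rewrite !normc_plane => -> ->; case: (u) => a b /=; ring.
have p0 : 0 < normc (1 + u) ^+ 2 by rewrite exprn_gt0.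
have := ln_le_subr1 p0; have := ln_ge_1Binv p0.
have p4 : 4^-1 <= normc (1 + u) ^+ 2.
  rewrite (_ : 4^-1 = 2^-1 * 2^-1); last by field.
  by rewrite expr2 ler_pM.
have Re1 : `|complex.Re u| <= normc u := Re_le_normc u.
move: p4; rewrite {}e1; set p := 1 + _ + _ => p4 h1 h2.
have p_gt0 : 0 < p by lra.
have h3 : 1 - p^-1 = (p - 1) - (p - 1) ^+ 2 / p by field; rewrite gt_eqF.
have h4 : (p - 1) ^+ 2 / p <= 25 * normc u ^+ 2.
  rewrite ler_pdivrMr//.
  have H : `|p - 1| <= 5 / 2 * normc u.
    rewrite /p ler_norml; move: Re1; rewrite ler_norml => /andP[r1 r2].
    by apply/andP; split; nra.
  have : (p - 1) ^+ 2 <= (5 / 2 * normc u) ^+ 2.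
    rewrite -(real_normK (num_real (p - 1))) ler_sqr ?nnegrE//.
    exact: le_trans (normr_ge0 _) H.
  rewrite exprMn; have := sqr_ge0 (normc u); nra.
rewrite h3 in h1; move: h1 h2; set q := ln p => h1 h2.
have pe : p - 1 = 2 * complex.Re u + normc u ^+ 2 by rewrite /p; ring.
rewrite ler_norml; have := sqr_ge0 (normc u); move: h1 h2 h4; rewrite pe.
by move: (_ / p) => w *; apply/andP; split; lra.
Qed.

End log_inequalities.

Section potential.
Context {R : realType}.
Implicit Types (z y v : R * R).

Definition ln_dist z y : R := ln (modulus (z - y)).

Lemma measurable_ln_dist z : measurable_fun setT (ln_dist z).
Proof. exact: (measurableT_comp (@measurable_ln R) (measurable_dist z)). Qed.

Lemma measurable_set1_plane z : measurable [set z].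
Proof.
have -> : [set z] = [set z.1] `*` [set z.2].
  by apply/seteqP; split => -[x y] /=; [move=> <-|case: z => u v /= [-> ->]].
exact: measurableX.
Qed.

Lemma ae_neq (mu : probability (R * R)%type R) z : mu [set z] = 0%E ->
  {ae mu, forall y, y != z}.
Proof.
move=> z0; exists [set z]; split=> //; first exact: measurable_set1_plane.
by move=> y /= /negP; rewrite negbK => /eqP.
Qed.

Lemma measurable_lne_dist z : measurable_fun setT (fun y => lne (modulus (z - y))%:E).
Proof.
rewrite (_ : (fun y => _) = fun y => if modulus (z - y) <= 0 then -oo%E else (ln_dist z y)%:E).
  apply: measurable_fun_ifT => //; last (apply/measurable_EFinP; exact: measurable_ln_dist).
  by apply: measurable_fun_ler => //; exact: measurable_dist.
apply/funext => y; case: ifPn => yz; first by rewrite le0_lneNy// lee_fin.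
by rewrite lne_EFin// ltNge.
Qed.

(** [lne] and [ln] differ at 0 only ([-oo] against 0), that is, at the point [z], which is null. *)
Lemma log_potentialE (mu : probability (R * R)%type R) z : mu [set z] = 0%E ->
  log_potential mu z = (\int[mu]_y (ln_dist z y)%:E)%E.
Proof.
move=> z0; apply: ae_eq_integral => //.
- exact: measurable_lne_dist.
- (apply/measurable_EFinP; exact: measurable_ln_dist).
apply: filterS (ae_neq z0) => y yz _.
by rewrite lne_EFin// modulus_gt0 subr_eq0 eq_sym.
Qed.

Variables (mu : probability (R * R)%type R) (M : R).
Hypothesis M0 : 0 <= M.
Hypothesis muD : forall z (r : R), 0 < r -> (mu (disc z r) <= (M * r ^+ 2)%:E)%E.

Lemma cauchy_kernelE z y : cauchy_kernel z y =
  ((z - y).1 / modulus (z - y) ^+ 2, - ((z - y).2 / modulus (z - y) ^+ 2)).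
Proof. by rewrite /cauchy_kernel cplxV /plane /= mulNr. Qed.

Lemma modulus_cauchy_kernel z y : modulus (cauchy_kernel z y) = inv_dist z y.
Proof. by rewrite /cauchy_kernel normc_plane ComplexField.Normc.normcV. Qed.

Lemma measurable_cauchy_kernel z : measurable_fun setT (cauchy_kernel z).
Proof.
apply/measurable_fun_pairP; split.
- rewrite (_ : fst \o _ = fun y => (z - y).1 * (modulus (z - y) ^+ 2)^-1); last first.
    by apply/funext => y; rewrite /comp cauchy_kernelE.
  apply: measurable_funM.
    exact: (measurableT_comp (@measurable_fst _ _ _ _) (measurable_subr2 z)).
  by apply: measurable_fun_inv; apply: measurable_funX; exact: measurable_dist.
- rewrite (_ : snd \o _ = fun y => - ((z - y).2 * (modulus (z - y) ^+ 2)^-1)); last first.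
    by apply/funext => y; rewrite /comp cauchy_kernelE.
  apply: measurable_funN; apply: measurable_funM.
    exact: (measurableT_comp (@measurable_snd _ _ _ _) (measurable_subr2 z)).
  by apply: measurable_fun_inv; apply: measurable_funX; exact: measurable_dist.
Qed.

Lemma le_inv_dist_integrable z (f : R * R -> R) : measurable_fun setT f ->
  (forall y, `|f y| <= inv_dist z y) -> mu.-integrable setT (EFin \o f).
Proof.
move=> mf fz; apply: le_integrable (integrable_inv_dist M0 muD z) => //.
  exact/measurable_EFinP.
by move=> y _; rewrite /= lee_fin (ger0_norm (inv_dist_ge0 _ _)).
Qed.

Lemma stieltjes_integrableP z : stieltjes_integrable mu z.
Proof.
have mk := measurable_cauchy_kernel z; split; apply: (le_inv_dist_integrable (z := z)).
- exact: (measurableT_comp (@measurable_fst _ _ _ _) mk).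
- by move=> y; rewrite -modulus_cauchy_kernel normr_fst_le.
- exact: (measurableT_comp (@measurable_snd _ _ _ _) mk).
- by move=> y; rewrite -modulus_cauchy_kernel normr_snd_le.
Qed.

(** The derivative of [ln_dist z y] in [z] along [v]. *)
Definition ker_dir v z y : R := v.1 * (cauchy_kernel z y).1 - v.2 * (cauchy_kernel z y).2.

Lemma ker_dirE v z y : ker_dir v z y = complex.Re (cplx v / cplx (z - y)).
Proof.
by rewrite /ker_dir /cauchy_kernel /plane; case: v => a b; case: (_^-1) => x w /=.
Qed.

Lemma measurable_ker_dir v z : measurable_fun setT (ker_dir v z).
Proof.
have mk := measurable_cauchy_kernel z.
apply: measurable_funB; apply: measurable_funM => //.
- exact: (measurableT_comp (@measurable_fst _ _ _ _) mk).
- exact: (measurableT_comp (@measurable_snd _ _ _ _) mk).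
Qed.

Lemma ker_dir_le v z y : modulus v = 1 -> `|ker_dir v z y| <= inv_dist z y.
Proof.
move=> v1; rewrite ker_dirE (le_trans (Re_le_normc _))//.
by rewrite ComplexField.Normc.normcM -/(modulus v) v1 mul1r ComplexField.Normc.normcV.
Qed.

Lemma diff_quotient_near v z y (e : R) : modulus v = 1 -> 0 < e -> y != z -> y != z + e *: v ->
  `|(ln_dist (z + e *: v) y - ln_dist z y) / e - ker_dir v z y| <=
    2 * inv_dist z y + inv_dist (z + e *: v) y.
Proof.
move=> v1 e0 yz yze.
have p1 : 0 < modulus (z - y) by rewrite modulus_gt0 subr_eq0 eq_sym.
have p2 : 0 < modulus (z + e *: v - y) by rewrite modulus_gt0 subr_eq0 eq_sym.
have H1 := normr_lnB_le p2 p1.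
have H2 : `|modulus (z + e *: v - y) - modulus (z - y)| <= e.
  have E : z + e *: v - y = (z - y) + e *: v by rewrite addrAC.
  have d := le_modulusD (z - y) (e *: v); have d' := le_modulusB (z - y) (- (e *: v)).
  rewrite E; rewrite opprK modulusN in d'.
  have ev : modulus (e *: v) = e by rewrite modulusZ v1 mulr1 gtr0_norm.
  by rewrite ev in d d'; rewrite ler_norml; apply/andP; split; lra.
have K := ker_dir_le z y v1.
have i1 := inv_dist_ge0 z y; have i2 := inv_dist_ge0 (z + e *: v) y.
apply: (le_trans (ler_normB _ _)).
have : `|(ln_dist (z + e *: v) y - ln_dist z y) / e| <= inv_dist (z + e *: v) y + inv_dist z y.
  rewrite normrM normfV (gtr0_norm e0) ler_pdivrMr// mulrC.
  by apply: (le_trans H1); rewrite ler_wpM2r// addr_ge0.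
lra.
Qed.

(** The quotient is [ln |1 + u| / e] with [u = e v / (z - y)], and [ln_normc_1D] applies because
    [|u| <= e / r <= 1/2]. *)
Lemma diff_quotient_far v z y (e r : R) : modulus v = 1 -> 0 < e -> e <= r / 2 ->
  r <= modulus (z - y) ->
  `|(ln_dist (z + e *: v) y - ln_dist z y) / e - ker_dir v z y| <= 13 * e / r ^+ 2.
Proof.
move=> v1 e0 er rz.
have r0 : 0 < r by lra.
have p1 : 0 < modulus (z - y) := lt_le_trans r0 rz.
pose u := e%:C * (cplx v / cplx (z - y)).
have d0 : cplx (z - y) != 0 by rewrite cplx_eq0 -modulus_gt0.
have nu : normc u = e / modulus (z - y).
  rewrite /u !ComplexField.Normc.normcM -/(modulus v) v1 mul1r ComplexField.Normc.normcV.
  by rewrite -/(modulus (z - y)) /= expr0n/= addr0 sqrtr_sqr gtr0_norm.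
have u2 : normc u <= 2^-1.
  by rewrite nu ler_pdivrMr// mulrC; lra.
have E : modulus (z + e *: v - y) = modulus (z - y) * normc (1 + u).
  rewrite /modulus -ComplexField.Normc.normcM mulrDr mulr1 /u; congr normc.
  have -> : z + e *: v - y = (z - y) + e *: v by rewrite addrAC.
  rewrite cplxD; congr (_ + _).
  by rewrite mulrCA (mulrCA (cplx (z - y))) divff// mulr1; case: (v) => a b; simpc.
have n1 : 0 < normc (1 + u).
  have := le_normcD (1 + u) (- u); rewrite addrK normcN ComplexField.Normc.normc1; lra.
have -> : ker_dir v z y = complex.Re u / e.
  rewrite ker_dirE /u; case: (cplx v / _) => a b /=; rewrite mul0r subr0.
  by field; rewrite gt_eqF.
rewrite /ln_dist E lnM ?posrE// addrAC subrr add0r -mulrBl normrM normfV (gtr0_norm e0).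
rewrite ler_pdivrMr//; apply: (le_trans (ln_normc_1D u2)).
have -> : 13 * e / r ^+ 2 * e = 13 * (e / r) ^+ 2 by field; rewrite gt_eqF.
rewrite ler_pM2l// nu ler_sqr ?nnegrE ?divr_ge0 ?(ltW e0) ?(ltW r0) ?(ltW p1)//.
by rewrite ler_pM2l// lef_pV2.
Qed.

Lemma integrable_ln_dist (B : R) z : mu [set y | B < modulus y] = 0%E ->
  mu.-integrable setT (EFin \o ln_dist z).
Proof.
set N := [set y | _] => N0.
have mN : measurable N.
  rewrite (_ : N = ~` [set y | modulus y <= B]).
    apply: measurableC; have := @measurable_modulus R.
    move=> /(_ measurableT `]-oo, B]%classic (measurable_itv _)).
    by rewrite setTI; congr measurable; apply/seteqP; split => y /=; rewrite in_itv.
  by apply/seteqP; split => y; rewrite /N /= ltNge => /negP.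
have mT : measurable (setT `\` N) by exact: measurableD.
have ml D : measurable_fun D (EFin \o ln_dist z).
  by apply/measurable_EFinP; apply: measurable_funTS; exact: measurable_ln_dist.
apply/(negligible_integrable mN measurableT (ml _) N0).
have i1 : mu.-integrable (setT `\` N) (fun y => (inv_dist z y)%:E + (modulus z + B)%:E)%E.
  apply: integrableD => //; last by apply: finite_measure_integrable_cst.
  by apply: integrableS (integrable_inv_dist M0 muD z).
apply: le_integrable i1 => // y [_ /negP]; rewrite -leNgt => yB.
have zyB : modulus (z - y) <= modulus z + B.
  by apply: (le_trans (le_modulusD z (- y))); rewrite modulusN lerD2l.
rewrite /= lee_fin (le_trans (normr_ln_le (modulus_ge0 _)))//.
by apply: le_trans (ler_norm _); rewrite lerD2l.
Qed.

Section stieltjes_of_potential.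
Variables (B : R) (P : R * R -> R) (z m : R * R) (C : R).
Hypothesis muB : mu [set y | B < modulus y] = 0%E.
Hypothesis muP : forall z, log_potential mu z = (P z)%:E.
Hypothesis Pdiff : forall v,
  `|P (z + v) - P z - (m.1 * v.1 - m.2 * v.2)| <= C * modulus v ^+ 2.

Lemma Rintegral_ln_dist z' : \int[mu]_y ln_dist z' y = P z'.
Proof.
by rewrite /Rintegral -log_potentialE ?muP//; exact: (mu_set1 M0 muD).
Qed.

(** Differentiation under the integral sign with explicit errors. On [disc z r] the quotient and the
    kernel are bounded by inverse distances to [z] and to [z + e v], which integrate to at most
    [2 (4 M r) + 4 M (2 r) = 16 M r]; off the disc the error is pointwise. *)
Lemma integral_ker_dir_le v (e r : R) : modulus v = 1 -> 0 < e -> e <= r / 2 ->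
  `|(m.1 * v.1 - m.2 * v.2) - \int[mu]_y ker_dir v z y| <=
    C * e + (16 * M * r + 13 * e / r ^+ 2).
Proof.
move=> v1 e0 er; have r0 : 0 < r by lra.
pose q y := (ln_dist (z + e *: v) y - ln_dist z y) / e.
have iln z' := integrable_ln_dist z' muB.
have iB : mu.-integrable setT (EFin \o (fun y => ln_dist (z + e *: v) y - ln_dist z y)).
  by apply: (eq_integrable measurableT _ _ _ (integrableB measurableT (iln (z + e *: v))
    (iln z))) => // y _; rewrite /= EFinB.
have iq : mu.-integrable setT (EFin \o q).
  apply: (eq_integrable measurableT _ _ _ (integrableZl measurableT e^-1 iB)) => y _.
  by rewrite /q /= -EFinM mulrC.
have ik : mu.-integrable setT (EFin \o ker_dir v z).
  apply: (le_inv_dist_integrable (z := z)); first exact: measurable_ker_dir.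
  by move=> y; exact: ker_dir_le.
have Eq : \int[mu]_y q y = (P (z + e *: v) - P z) / e.
  by rewrite RintegralZr// RintegralB// !Rintegral_ln_dist.
have ibk : mu.-integrable setT (EFin \o (fun y => q y - ker_dir v z y)).
  by apply: (eq_integrable measurableT _ _ _ (integrableB measurableT iq ik)) => // y _;
     rewrite /= EFinB.
have H1 : `|(m.1 * v.1 - m.2 * v.2) - \int[mu]_y q y| <= C * e.
  have := Pdiff (e *: v); rewrite modulusZ v1 mulr1 (gtr0_norm e0) /= /GRing.scale /= => Pe.
  rewrite Eq (_ : _ - _ - _ = - ((P (z + e *: v) - P z -
    (m.1 * (e * v.1) - m.2 * (e * v.2))) / e)); last by field; rewrite gt_eqF.
  by rewrite normrN normrM normfV (gtr0_norm e0) ler_pdivrMr// -mulrA -expr2.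
have H2 : `|\int[mu]_y q y - \int[mu]_y ker_dir v z y| <= 16 * M * r + 13 * e / r ^+ 2.
  rewrite -RintegralB//; apply: (le_trans (le_normr_Rintegral measurableT ibk)).
  pose D := disc z r.
  have mD : measurable D := measurable_disc z r.
  rewrite -lee_fin /Rintegral fineK; last first.
    by apply: integrable_fin_num => //; exact: integrable_norm.
  have mq A : measurable_fun A (fun y => (`|q y - ker_dir v z y|)%:E).
    have := measurable_int _ (integrable_norm ibk).
    by move=> H; apply: measurable_funTS.
  rewrite -[setT](setUv D) ge0_integral_setU//; last 2 first.
  - exact: measurableC.
  - by rewrite disj_set2E setICr.
  rewrite EFinD; apply: leeD.
    apply: (@le_trans _ _ (\int[mu]_(y in D) ((2 * inv_dist z y)%:E +
        (inv_dist (z + e *: v) y)%:E))%E).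
      apply: ae_ge0_le_integral => //.
      - by move=> y _; rewrite adde_ge0 ?lee_fin ?mulr_ge0 ?inv_dist_ge0.
      - apply: emeasurable_funD; last exact: measurable_inv_distE.
        apply/measurable_EFinP; apply: measurable_funM => //.
        by apply: measurable_funTS; exact: measurable_inv_dist.
      - have := ae_neq (mu_set1 M0 muD z); have := ae_neq (mu_set1 M0 muD (z + e *: v)).
        apply: filterS2 => y y1 y2 _; rewrite -EFinD lee_fin.
        exact: diff_quotient_near.
    rewrite ge0_integralD//; last 4 first.
    - by move=> y _; rewrite lee_fin mulr_ge0// inv_dist_ge0.
    - apply/measurable_EFinP; apply: measurable_funM => //.
      by apply: measurable_funTS; exact: measurable_inv_dist.
    - by move=> y _; rewrite lee_fin inv_dist_ge0.
    - exact: measurable_inv_distE.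
    under eq_integral do rewrite EFinM.
    rewrite ge0_integralZl//; last 2 first.
    - exact: measurable_inv_distE.
    - by move=> y _; rewrite lee_fin inv_dist_ge0.
    have r2 : 0 < 2 * r by rewrite mulr_gt0.
    have J1 := integral_inv_dist_disc M0 muD z r0.
    have J2 := integral_inv_dist_disc M0 muD (z + e *: v) r2.
    apply: (@le_trans _ _ (2%:E * (4 * M * r)%:E + (4 * M * (2 * r))%:E)%E); last first.
      by rewrite -EFinM -EFinD lee_fin; lra.
    apply: leeD; first by rewrite lee_pmul2l// lte_fin.
    apply: le_trans J2; apply: ge0_subset_integral => //.
    - exact: measurable_disc.
    - exact: measurable_inv_distE.
    - by move=> y _; rewrite lee_fin inv_dist_ge0.
    - move=> y yd; rewrite /disc /=.
      have -> : z + e *: v - y = (z - y) + e *: v by rewrite addrAC.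
      apply: (le_lt_trans (le_modulusD _ _)).
      rewrite modulusZ v1 mulr1 gtr0_norm//; have : modulus (z - y) < r := yd; lra.
  apply: (@le_trans _ _ (\int[mu]_(y in ~` D) (13 * e / r ^+ 2)%:E)%E).
    apply: ge0_le_integral => //.
    - exact: measurableC.
    - move=> y /negP; rewrite -leNgt => yr; rewrite lee_fin.
      exact: diff_quotient_far.
  rewrite integral_cst; last exact: measurableC.
  rewrite -[leRHS]mule1 lee_pmul2l ?lte_fin ?divr_gt0 ?mulr_gt0 ?exprn_gt0//.
  exact: probability_le1 (measurableC mD).
apply: le_trans (lerD H1 H2); apply: le_trans (ler_normD _ _).
by rewrite addrA subrK.
Qed.

Lemma integral_ker_dir v : modulus v = 1 ->
  \int[mu]_y ker_dir v z y = m.1 * v.1 - m.2 * v.2.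
Proof.
move=> v1; apply/eqP; rewrite eq_sym -subr_eq0 -normr_eq0 eq_le normr_ge0 andbT.
apply/ler_addgt0Pr => d d0; rewrite add0r.
(* With the step [e = r ^+ 3] the errors [C e], [16 M r] and [13 e / r^2] are all [O(r)], and [K]
   collects the constants; [r <= 1/2] ensures [e <= r / 2]. *)
pose K : R := `|C| + 16 * M + 13 + 1.
have K0 : 0 < K by rewrite ltr_wpDl// !addr_ge0// mulr_ge0.
pose r : R := Num.min 2^-1 (d / K).
have r0 : 0 < r by rewrite lt_min invr_gt0 ltr0n/= divr_gt0.
have r2 : r <= 2^-1 by rewrite ge_min lexx.
have rK : r * K <= d by rewrite -ler_pdivlMr// ge_min lexx orbT.
have e0 : 0 < r ^+ 3 by rewrite exprn_gt0.
have rr : r ^+ 2 <= 2^-1 by nra.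
have er : r ^+ 3 <= r / 2 by rewrite exprS ler_pM2l.
have er1 : r ^+ 3 <= r by lra.
apply: (le_trans (integral_ker_dir_le v1 e0 er)).
have -> : 13 * r ^+ 3 / r ^+ 2 = 13 * r by field; rewrite gt_eqF.
apply: le_trans rK; have : C * r ^+ 3 <= `|C| * r.
  by apply: (@le_trans _ _ (`|C| * r ^+ 3)); [rewrite ler_wpM2r ?ler_norm ?ltW|rewrite ler_wpM2l].
by rewrite /K; lra.
Qed.

Lemma stieltjesE : stieltjes mu z = m.
Proof.
have m1 : modulus (1 : R, 0 : R) = 1 by rewrite modulusE /= expr1n expr0n/= addr0 sqrtr1.
have m2 : modulus (0 : R, 1 : R) = 1 by rewrite modulusE /= expr1n expr0n/= add0r sqrtr1.
have := integral_ker_dir m1; have := integral_ker_dir m2; rewrite /= !mulr0 !mulr1 sub0r subr0.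
have E1 : (fun y => ker_dir (1, 0) z y) = (fun y => (cauchy_kernel z y).1).
  by apply/funext => y; rewrite /ker_dir mul1r mul0r subr0.
have E2 : (fun y => ker_dir (0, 1) z y) = (fun y => -1 * (cauchy_kernel z y).2).
  by apply/funext => y; rewrite /ker_dir mul1r mul0r sub0r mulN1r.
rewrite E1 E2 RintegralZl//; last by case: (stieltjes_integrableP z).
by rewrite mulN1r => /oppr_inj H2 H1; rewrite /stieltjes H1 H2; case: (m).
Qed.

End stieltjes_of_potential.

End potential.

(** * The outer Joukowski root *)

Section outer_root.
Context {R : realType}.
Implicit Types (a b t : R) (z u : R[i]).

Lemma Re_sqrtc_ge0 z : 0 <= complex.Re (sqrtc z).
Proof. by case: z => a b /=; exact: sqrtr_ge0. Qed.

(** [z - a] and [z + a] have the same imaginary part, hence the same sign choice in [sqrtc]. *)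
Lemma Im_sqrtcM_ge0 z (a : R) :
  0 <= complex.Im (sqrtc (z - a%:C)) * complex.Im (sqrtc (z + a%:C)).
Proof.
case: z => x y /=; rewrite subr0 addr0.
set e := if _ then _ else _; rewrite mulrACA; apply: mulr_ge0.
  by rewrite -expr2 sqr_ge0.
by rewrite mulr_ge0 ?sqrtr_ge0.
Qed.

Definition inv_joukowski z : R[i] := (z + sqrt_z24 z) / 2.

Lemma sqr_sqrt_z24 z : sqrt_z24 z ^+ 2 = z ^+ 2 - 4.
Proof. by rewrite /sqrt_z24 exprMn !sqr_sqrtc; ring. Qed.

Lemma inv_joukowskiM z : inv_joukowski z * (z - inv_joukowski z) = 1.
Proof.
rewrite /inv_joukowski; have := sqr_sqrt_z24 z; move: (sqrt_z24 z) => q e.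
transitivity ((z ^+ 2 - q ^+ 2) / 4); first by field.
by rewrite e; field.
Qed.

Lemma normcB_sqr z u : normc (z + u) ^+ 2 = normc z ^+ 2 + normc u ^+ 2 +
  2 * (complex.Re z * complex.Re u + complex.Im z * complex.Im u).
Proof.
rewrite -!normc_plane !sqr_modulus; case: z => a b; case: u => c d /=; ring.
Qed.

(** The value is [((p + q) / 2)^2] with [p], [q] the principal roots of [z - 2] and [z + 2]. Their
    real parts are nonnegative and their imaginary parts do not have opposite signs, so
    [|p + q|^2 >= |z - 2| + |z + 2| >= 4]. *)
Lemma inv_joukowski_ge1 z : 1 <= normc (inv_joukowski z).
Proof.
pose p := sqrtc (z - 2); pose q := sqrtc (z + 2).
have E : inv_joukowski z = (p + q) ^+ 2 / 4.
  by rewrite sqrrD !sqr_sqrtc /inv_joukowski /sqrt_z24 -/p -/q; field.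
have n4 : normc (4 : R[i]) = 4.
  have -> : (4 : R[i]) = (4 : R)%:C by rewrite rmorph_nat.
  by rewrite /= expr0n/= addr0 sqrtr_sqr ger0_norm.
rewrite E ComplexField.Normc.normcM ComplexField.Normc.normcV n4 normcX ler_pdivlMr// mul1r.
rewrite normcB_sqr.
have c2 : (2 : R[i]) = (2 : R)%:C by rewrite rmorph_nat.
have H1 : 0 <= complex.Im p * complex.Im q by rewrite /p /q c2 Im_sqrtcM_ge0.
have H2 : 0 <= complex.Re p * complex.Re q by rewrite mulr_ge0 ?Re_sqrtc_ge0.
have : 4 <= normc p ^+ 2 + normc q ^+ 2.
  rewrite -!normcX !sqr_sqrtc.
  have := le_normcD (z + 2) (- (z - 2)); rewrite normcN.
  by rewrite (_ : z + 2 - (z - 2) = 4) ?n4; [lra|ring].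
by move: H1 H2; clear; lra.
Qed.

(* The root of largest modulus of [W ^ 2 - z W + b = 0], that is, the inverse of
   the Joukowski map [W + b / W] outside the disc of radius [sqrt b]. *)
Definition outer b z : R[i] :=
  if b == 0 then z else (Num.sqrt b)%:C * inv_joukowski (z / (Num.sqrt b)%:C).

Lemma normcR (a : R) : normc a%:C = `|a|.
Proof. by rewrite /= expr0n/= addr0 sqrtr_sqr. Qed.

Lemma realc_eq0 (a : R) : (a%:C == 0 :> R[i]) = (a == 0).
Proof. by rewrite -normc_eq0 normcR normr_eq0. Qed.

Lemma outerM b z : 0 <= b -> outer b z * (z - outer b z) = b%:C.
Proof.
move=> b0; rewrite /outer; case: eqVneq => [->|bn]; first by rewrite subrr mulr0.
have s0 : (Num.sqrt b)%:C != 0 :> R[i].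
  by rewrite realc_eq0 gt_eqF// sqrtr_gt0 lt_neqAle eq_sym bn.
have := inv_joukowskiM (z / (Num.sqrt b)%:C).
move: (inv_joukowski _) => u e.
transitivity ((Num.sqrt b)%:C ^+ 2 * (u * (z / (Num.sqrt b)%:C - u))); first by field.
by rewrite e mulr1 -rmorphXn/= sqr_sqrtr.
Qed.

Lemma outer_ge b z : 0 <= b -> b <= normc (outer b z) ^+ 2.
Proof.
move=> b0; rewrite /outer; case: eqVneq => [->|bn]; first exact: sqr_ge0.
rewrite ComplexField.Normc.normcM normcR ger0_norm ?sqrtr_ge0// exprMn sqr_sqrtr//.
by rewrite ler_peMr// exprn_ege1// inv_joukowski_ge1.
Qed.

Lemma outer_eq0 b z : 0 <= b -> outer b z = 0 -> b = 0 /\ z = 0.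
Proof.
move=> b0 e; have := outer_ge z b0; rewrite e ComplexField.Normc.normc0 expr0n/= => b0'.
have bz : b = 0 by lra.
by split=> //; move: e; rewrite /outer bz eqxx.
Qed.

Lemma outerE b z : 0 <= b -> outer b z != 0 -> z = outer b z + b%:C / outer b z.
Proof. by move=> b0 W0; rewrite -(outerM z b0); field. Qed.

(** The second factor is the difference from the other root [z - outer b z]. Away from a double
    root, the change of the root is thereby controlled by the change of [b]. *)
Lemma outer_diff b b' z : 0 <= b -> 0 <= b' ->
  (outer b' z - outer b z) * (outer b' z - (z - outer b z)) = (b - b')%:C.
Proof.
move=> b0 b0'; rewrite rmorphB /= -(outerM z b0) -(outerM z b0'); ring.
Qed.

(* When both roots have the same modulus, [z] lies on the focal segment. *)
Lemma outer_seg b z : 0 < b -> normc (outer b z) ^+ 2 = b ->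
  [/\ complex.Im z = 0, (complex.Re z) ^+ 2 <= 4 * b &
      complex.Re (outer b z ^- 2) = (complex.Re z ^+ 2 / 2 - b) / b ^+ 2].
Proof.
move=> b0 e; have W0 : outer b z != 0.
  by rewrite -normc_eq0; apply/eqP => e0; move: e; rewrite e0 expr0n/=; lra.
have b_neq0 : b != 0 by rewrite gt_eqF.
have := outerE (ltW b0) W0; move: (outer b z) W0 e => W W0 e zE.
have := sqr_modulus (plane W); rewrite normc_plane e => /= pq.
have VE : W^-1 = (complex.Re W / b) +i* (- (complex.Im W / b)).
  by rewrite -(planeK W) cplxV normc_plane planeK e mulNr.
rewrite {}zE -exprVn {}VE; case: W W0 e pq => p q W0 e /= pq.
rewrite pq in b_neq0 *; simpc.
split.
- by rewrite /=; field.
- rewrite /= (_ : (p + _ * (p / _)) ^+ 2 = 4 * p ^+ 2); last by field.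
  by rewrite ler_pM2l// lerDl sqr_ge0.
- by rewrite expr2; simpc => /=; field.
Qed.

(** The converse of [outer_seg] between the foci: if [|W|^2 > b], then [Im z = 0] forces [W] to be
    real, and [(W + b / W)^2 >= 4 b]. *)
Lemma outer_out_seg b z : 0 < b -> complex.Im z = 0 -> complex.Re z ^+ 2 < 4 * b ->
  normc (outer b z) ^+ 2 = b.
Proof.
move=> b0 Iz Rz; apply/eqP; rewrite eq_le (outer_ge z (ltW b0)) andbT leNgt; apply/negP => bW.
have W0 : outer b z != 0.
  by rewrite -normc_eq0; apply: contraTneq bW => ->; rewrite expr0n/= -leNgt ltW.
have := outerE (ltW b0) W0; move: (outer b z) W0 bW => W W0 bW zE.
have n0 : 0 < normc W ^+ 2 by apply: lt_trans bW.
have VE : W^-1 = (complex.Re W / normc W ^+ 2) +i* (- (complex.Im W / normc W ^+ 2)).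
  by rewrite -[in LHS](planeK W) cplxV normc_plane mulNr.
have := sqr_modulus (plane W); rewrite normc_plane /= => pq.
move: Iz Rz; rewrite {}zE {}VE; move: (normc W ^+ 2) bW n0 pq => n bn n0.
case: W W0 => p q W0 /= pq; simpc => /= Iz Rz.
have q0 : q = 0.
  have : q * (n - b) = 0.
    transitivity (n * (q - b * (q / n))); first by field; rewrite gt_eqF.
    by rewrite Iz mulr0.
  by move/eqP; rewrite mulf_eq0 [n - b == 0]gt_eqF ?subr_gt0// orbF => /eqP.
move: Rz; apply/negP; rewrite -leNgt.
have pn : n = p ^+ 2 by rewrite pq q0 expr0n/= addr0.
have p0 : p != 0 by apply: contraTneq n0 => p0; rewrite pn p0 expr0n/= ltxx.
rewrite pn (_ : (_ + _) ^+ 2 = (p ^+ 2 + b) ^+ 2 / p ^+ 2); last by field.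
rewrite ler_pdivlMr -?pn//; have := sqr_ge0 (n - b); lra.
Qed.

End outer_root.

(** * Criteria for differentiability and continuity on the line *)

Section quadratic.
Context {R : realType}.

Lemma is_derive_quadratic (f : R -> R) (x l C e : R) : 0 < e ->
  (forall y, `|y - x| < e -> `|f y - f x - (y - x) * l| <= C * (y - x) ^+ 2) ->
  is_derive x 1 f l.
Proof.
move=> e0 fC; apply/is_derive1_caratheodory.
exists (fun y => if y == x then l else (f y - f x) / (y - x)); split.
- by move=> y; case: eqVneq => [->|yx]; rewrite ?subrr ?mulr0// divfK// subr_eq0.
- apply/cvgrPdist_lt => d d0; rewrite /= eqxx; near=> y.
  case: eqVneq => [_|yx]; first by rewrite subrr normr0.
  have yx0 : 0 < `|y - x| by rewrite normr_gt0 subr_eq0.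
  have ye : `|y - x| < e by near: y; exists e => //= u; rewrite /= distrC.
  have yd : `|y - x| * (`|C| + 1) < d.
    rewrite -ltr_pdivlMr ?ltr_wpDl//; near: y.
    by exists (d / (`|C| + 1)); rewrite /= ?divr_gt0 ?ltr_wpDl// => u; rewrite /= distrC.
  apply: le_lt_trans yd; rewrite distrC.
  rewrite (_ : _ - l = (f y - f x - (y - x) * l) / (y - x)); last by field; rewrite subr_eq0.
  rewrite normrM normfV ler_pdivrMr//; apply: (le_trans (fC y ye)).
  rewrite -real_normK ?num_real// expr2 mulrA mulrC !mulrA ler_wpM2r//.
  rewrite [X in _ <= X]mulrC [X in X <= _]mulrC.
  by rewrite ler_wpM2r// (le_trans (ler_norm C))// lerDl.
- by rewrite eqxx.
Unshelve. all: by end_near. Qed.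

End quadratic.

Section continuity.
Context {R : realType}.

Lemma continuous_lip (f : R -> R) (x C e : R) : 0 < e ->
  (forall y, `|y - x| < e -> `|f y - f x| <= C * `|y - x|) -> {for x, continuous f}.
Proof.
move=> e0 fC; apply/cvgrPdist_lt => d d0; near=> y.
have ye : `|y - x| < e by near: y; exists e => //= u; rewrite /= distrC.
rewrite distrC (le_lt_trans (fC _ ye))//.
apply: (@le_lt_trans _ _ ((`|C| + 1) * `|y - x|)).
  by rewrite ler_wpM2r// (le_trans (ler_norm C))// lerDl.
have C0 : 0 < `|C| + 1 by rewrite ltr_wpDl.
rewrite mulrC -ltr_pdivlMr//; near: y.
by exists (d / (`|C| + 1)); rewrite /= ?divr_gt0// => u; rewrite /= distrC.
Unshelve. all: by end_near. Qed.

Lemma continuous_sqrt0 (f : R -> R) (C e : R) : 0 < e -> f 0 = 0 ->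
  (forall y, `|y| < e -> `|f y| <= C * Num.sqrt `|y|) -> {for 0, continuous f}.
Proof.
move=> e0 f0 fC; apply/cvgrPdist_lt => d d0.
have C0 : 0 < `|C| + 1 by rewrite ltr_wpDl.
have dC : 0 < d / (`|C| + 1) by rewrite divr_gt0.
have dC2 : 0 < (d / (`|C| + 1)) ^+ 2 by rewrite exprn_gt0.
near=> y.
have ye : `|y| < e by near: y; exists e => //= u; rewrite /= sub0r normrN.
rewrite f0 sub0r normrN (le_lt_trans (fC _ ye))//.
apply: (@le_lt_trans _ _ ((`|C| + 1) * Num.sqrt `|y|)).
  by rewrite ler_wpM2r ?sqrtr_ge0// (le_trans (ler_norm C))// lerDl.
rewrite mulrC -ltr_pdivlMr// -ltr_sqr ?nnegrE ?sqrtr_ge0 ?(ltW dC)// sqr_sqrtr ?normr_ge0.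
by near: y; exists ((d / (`|C| + 1)) ^+ 2) => // u; rewrite /= sub0r normrN.
Unshelve. all: by end_near. Qed.

End continuity.

(** * The part of f_t that depends on z, as a function of a *)

Section phi.
Context {R : realType}.
Implicit Types (a b t : R) (z : R[i]).

(** Writing the argument of [Psi] as [u + 1 / u] gives [Psi = ln |u| + Re (u ^- 2) / 2]; rescaling
    [u] by [sqrt (t a)] to the outer root yields this form, which remains meaningful at [t = 0] and
    at [a = 0]. *)
Definition phi t z a : R :=
  a * ln (normc (outer (t * a) z)) + t * a ^+ 2 / 2 * complex.Re (outer (t * a) z ^- 2).

Lemma ReZ (a : R) z : complex.Re (a%:C * z) = a * complex.Re z.
Proof. by case: z => x y /=; rewrite mul0r subr0. Qed.

Lemma f_E (g : R -> R) t (z : R * R) a : 0 < t -> 0 <= a ->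
  f_ g t z a = g a + phi t (cplx z) a.
Proof.
move=> t0; rewrite /f_ /phi le_eqVlt => /predU1P[<-|a0].
  by rewrite eqxx !mul0r expr0n/= !mulr0 !mul0r !addr0.
rewrite (gt_eqF a0) (gtr0_norm t0) -addrA; congr (_ + _).
have b0 : 0 < t * a by rewrite mulr_gt0.
rewrite /outer (gt_eqF b0).
have q0 : 0 < Num.sqrt (t * a) by rewrite sqrtr_gt0.
have q2 : Num.sqrt (t * a) ^+ 2 = t * a by rewrite sqr_sqrtr// ltW.
move: (Num.sqrt (t * a)) q0 q2 => q q0 q2.
have qc0 : q%:C != 0 :> R[i] by rewrite realc_eq0 gt_eqF.
move: (cplx z / q%:C) => z'; rewrite /Psi -/(inv_joukowski z').
have := inv_joukowskiM z'; have := inv_joukowski_ge1 z'.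
have -> : sqrt_z24 z' = 2 * inv_joukowski z' - z' by rewrite /inv_joukowski; field.
move: (inv_joukowski z') => u u1 uz.
have u0 : u != 0 by rewrite -normc_gt0; lra.
have z'E : z' = u + u^-1.
  by rewrite -[z'](subrK u) addrC; congr (_ + _); apply: (mulfI u0); rewrite uz divff.
have -> : z' ^+ 2 - z' * (2 * u - z') = 2 + (2%:C : R[i]) * u ^- 2.
  by rewrite z'E rmorph_nat; field.
rewrite complex_ReD ReZ /= ComplexField.Normc.normcM normcR (gtr0_norm q0).
rewrite lnM ?posrE ?normc_gt0//.
have -> : (q%:C * u) ^- 2 = ((q ^+ 2)^-1)%:C * u ^- 2.
  by rewrite fmorphV rmorphXn /=; field; rewrite qc0 u0.
rewrite q2 ReZ.
move: (complex.Re _) (ln _) (ln _) => x y w; field.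
by rewrite !gt_eqF.
Qed.

(** Why the slope is [ln |W|]: as [W + t a / W] is fixed, [t (a' / W' - a / W) = - d]. By this
    identity the change of the second term of [phi] cancels the linear part [a' Re x] of the change
    of the logarithm, up to [K]. Both [K] and [ln |1 + x| - Re x] are of second order in [d] and
    [a' - a]. *)
Lemma phi_est t z a a' (W := outer (t * a) z) (W' := outer (t * a') z) :
  0 <= t -> 0 <= a -> 0 <= a' -> W != 0 -> normc (W' - W) <= normc W / 2 ->
  `|phi t z a' - phi t z a - (a' - a) * ln (normc W)| <=
    14 * a' * normc (W' - W) ^+ 2 / normc W ^+ 2 +
    normc (W' - W) * `|a' - a| / normc W.
Proof.
move=> t0 a0 a0' W0 dW.
have n0 : 0 < normc W by rewrite normc_gt0.
have nW' : normc W / 2 <= normc W'.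
  have := le_normcD W' (- (W' - W)); rewrite normcN opprB addrCA subrr addr0; lra.
have n0' : 0 < normc W' by lra.
have W0' : W' != 0 by rewrite -normc_gt0.
have zE : z = W + (t * a)%:C / W by rewrite /W -outerE// mulr_ge0.
have zE' : z = W' + (t * a')%:C / W' by rewrite /W' -outerE// mulr_ge0.
rewrite /phi -/W -/W'; set d := W' - W in dW *.
pose x := d / W.
have nx : normc x = normc d / normc W.
  by rewrite ComplexField.Normc.normcM ComplexField.Normc.normcV.
have x2 : normc x <= 2^-1 by rewrite nx ler_pdivrMr// mulrC.
have E1 : W' = W * (1 + x) by rewrite /x /d; field.
have p1 : 0 < normc (1 + x).
  by rewrite normc_gt0; apply: contraNneq W0' => e; rewrite E1 e mulr0.
pose K : R[i] := d * ((a' - a)%:C / (2 * W) + a'%:C * d / (2 * W * W')).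
have EK : t * a' ^+ 2 / 2 * complex.Re (W' ^- 2) - t * a ^+ 2 / 2 * complex.Re (W ^- 2) +
    a' * complex.Re x = complex.Re K.
  rewrite -!ReZ; have -> (u v w : R[i]) : complex.Re u - complex.Re v + complex.Re w =
    complex.Re (u - v + w) by case: u; case: v; case: w.
  congr complex.Re.
  have tE : t%:C * (a'%:C / W' - a%:C / W) = - d.
    have : W' + (t * a')%:C / W' - (W + (t * a)%:C / W) = 0 by rewrite -zE -zE' subrr.
    rewrite !rmorphM /= /d => h; apply/eqP; rewrite -subr_eq0; apply/eqP; rewrite -h; ring.
  transitivity ((t%:C * (a'%:C / W' - a%:C / W)) * (a'%:C / W' + a%:C / W) / 2 + a'%:C * x).
    rewrite expr2 !rmorphM !fmorphV /= rmorph_nat /x; field.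
    by rewrite W0 W0'.
  by rewrite tE /K /x /d rmorphB /=; field; rewrite W0 W0'.
have -> : a' * ln (normc W') + t * a' ^+ 2 / 2 * complex.Re (W' ^- 2) -
    (a * ln (normc W) + t * a ^+ 2 / 2 * complex.Re (W ^- 2)) - (a' - a) * ln (normc W) =
    a' * (ln (normc (1 + x)) - complex.Re x) + complex.Re K.
  rewrite -EK {1}E1 ComplexField.Normc.normcM lnM ?posrE//; ring.
apply: (le_trans (ler_normD _ _)).
have n2 (u : R[i]) : normc (2 * u) = 2 * normc u.
  have -> : (2 : R[i]) = 2%:C by rewrite rmorph_nat.
  by rewrite ComplexField.Normc.normcM normcR ger0_norm.
have H1 : `|a' * (ln (normc (1 + x)) - complex.Re x)| <= 13 * a' * normc d ^+ 2 / normc W ^+ 2.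
  rewrite normrM (ger0_norm a0').
  rewrite (_ : 13 * a' * normc d ^+ 2 / normc W ^+ 2 = a' * (13 * normc x ^+ 2)).
    by rewrite ler_wpM2l// ln_normc_1D.
  by rewrite nx; field; rewrite gt_eqF.
have d0 := normc_ge0 d.
have H2 : `|complex.Re K| <= normc d * (`|a' - a| / normc W + a' * normc d / normc W ^+ 2).
  apply: (le_trans (Re_le_normc _)); rewrite /K ComplexField.Normc.normcM ler_wpM2l//.
  apply: (le_trans (le_normcD _ _)); rewrite !ComplexField.Normc.normcM !ComplexField.Normc.normcV.
  rewrite !ComplexField.Normc.normcM -/d !normcR (ger0_norm a0').
  have -> : normc (2 : R[i]) = 2 by rewrite -[2]mulr1 n2 ComplexField.Normc.normc1 mulr1.
  apply: lerD.
    by rewrite ler_wpM2l// lef_pV2 ?posrE ?mulr_gt0//; lra.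
  rewrite ler_wpM2l ?mulr_ge0// lef_pV2 ?posrE ?mulr_gt0 ?exprn_gt0//.
  by rewrite expr2 -mulrA mulrCA ler_pM2l//; lra.
apply: (le_trans (lerD H1 H2)).
rewrite le_eqVlt; apply/orP; left; apply/eqP; field.
by rewrite gt_eqF.
Qed.

(** By [outer_diff] it suffices to keep [W'] away from the other root [z - W]. That root has modulus
    [t a / |W|], below [q = sqrt (t a)] by the gap [e0], while [|W'| >= sqrt (t a')], which is at
    least [q - e0 / 2] for [a'] close to [a]. *)
Lemma outer_lip t z a : 0 <= t -> 0 < a -> t * a < normc (outer (t * a) z) ^+ 2 ->
  exists L e : R, [/\ 0 <= L, 0 < e & forall a', `|a' - a| < e -> 0 <= a' /\
    normc (outer (t * a') z - outer (t * a) z) <= L * `|a' - a|].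
Proof.
rewrite le_eqVlt => /predU1P[<-|t0] a0 aW.
  exists 0, a; split=> // a' aa'; rewrite !mul0r subrr ComplexField.Normc.normc0; split=> //.
  by move: aa'; rewrite ltr_norml => /andP[h _]; lra.
set W := outer (t * a) z in aW *.
have b0 : 0 < t * a by rewrite mulr_gt0.
have q0 : 0 < Num.sqrt (t * a) by rewrite sqrtr_gt0.
have q2 : Num.sqrt (t * a) ^+ 2 = t * a by rewrite sqr_sqrtr// ltW.
set q := Num.sqrt (t * a) in q0 q2.
have n0 := normc_ge0 W.
have qW : q < normc W by rewrite -ltr_sqr ?nnegrE ?(ltW q0)// q2.
have nW : 0 < normc W := lt_trans q0 qW.
have W0 : W != 0 by rewrite -normc_gt0.
pose e0 := q - t * a / normc W.
have e00 : 0 < e0 by rewrite subr_gt0 ltr_pdivrMr// -q2 expr2 ltr_pM2l.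
exists (2 * t / e0), (Num.min a (e0 * q / (2 * t))); split.
- by rewrite divr_ge0 ?mulr_ge0 ?ltW.
- by rewrite lt_min a0 divr_gt0 ?mulr_gt0.
move=> a'; rewrite lt_min => /andP[aa ae].
have a0' : 0 <= a' by move: aa; rewrite ltr_norml => /andP[h _]; lra.
split=> //.
have b0' : 0 <= t * a' by rewrite mulr_ge0// ltW.
have := outer_diff z (ltW b0) b0'; rewrite -/W; set W' := outer (t * a') z
  => /(congr1 (fun v : R[i] => normc v)).
rewrite ComplexField.Normc.normcM normcR -mulrBr normrM (gtr0_norm t0) distrC => dE.
have zW : normc (z - W) = t * a / normc W.
  rewrite {1}(outerE (ltW b0) W0) -/W addrAC subrr add0r.
  by rewrite ComplexField.Normc.normcM ComplexField.Normc.normcV normcR gtr0_norm.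
have q0' := sqrtr_ge0 (t * a'); have q2' : Num.sqrt (t * a') ^+ 2 = t * a' by rewrite sqr_sqrtr.
set q' := Num.sqrt (t * a') in q0' q2'.
have qW' : q' <= normc W'.
  by rewrite -ler_sqr ?nnegrE ?normc_ge0// q2' outer_ge.
have qq' : q - q' <= e0 / 2.
  have : (q - q') * q <= t * `|a' - a|.
    have [qq|qq] := leP q q'.
      apply: (@le_trans _ _ 0); last by rewrite mulr_ge0// ltW.
      by rewrite mulr_le0_ge0 ?subr_le0// ltW.
    apply: (@le_trans _ _ ((q - q') * (q + q'))).
      by rewrite ler_wpM2l ?subr_ge0 ?(ltW qq)// lerDl.
    rewrite -subr_sqr q2 q2' -mulrBr ler_wpM2l ?(ltW t0)// distrC; exact: ler_norm.
  move: ae; rewrite ltr_pdivlMr ?mulr_gt0// => ae h.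
  rewrite -(ler_pM2r q0) (le_trans h)//; lra.
have e2 : e0 / 2 <= normc (W' - (z - W)).
  have := le_normcD (W' - (z - W)) (z - W); rewrite subrK zW.
  move: qq' qW'; rewrite /e0; lra.
have e2_gt0 : 0 < e0 / 2 by rewrite divr_gt0.
rewrite -(ler_pM2r e2_gt0).
apply: (@le_trans _ _ (normc (W' - W) * normc (W' - (z - W)))).
  by rewrite ler_wpM2l ?normc_ge0.
rewrite dE le_eqVlt; apply/orP; left; apply/eqP; field.
by rewrite gt_eqF.
Qed.

Lemma quadratic_bound (a A d m L n : R) : 0 <= a -> a <= A -> 0 <= d -> 0 <= m ->
  0 < n -> d <= L * m ->
  14 * a * d ^+ 2 / n ^+ 2 + d * m / n <= (14 * A * L ^+ 2 / n ^+ 2 + L / n) * m ^+ 2.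
Proof.
move=> a0 aA d0 m0 n0 dL.
have dL2 : d ^+ 2 <= (L * m) ^+ 2 by rewrite ler_sqr ?nnegrE// (le_trans d0).
have -> : (14 * A * L ^+ 2 / n ^+ 2 + L / n) * m ^+ 2 =
  14 * A * (L * m) ^+ 2 / n ^+ 2 + L * m * m / n by field; rewrite gt_eqF.
apply: lerD; last by rewrite ler_wpM2r ?invr_ge0 ?(ltW n0)// ler_wpM2r.
rewrite ler_wpM2r ?invr_ge0 ?sqr_ge0// ler_pM ?mulr_ge0 ?sqr_ge0//.
by rewrite ler_pM2l.
Qed.

Lemma phi_derive t z a : 0 <= t -> 0 < a -> t * a < normc (outer (t * a) z) ^+ 2 ->
  is_derive a 1 (phi t z) (ln (normc (outer (t * a) z))).
Proof.
move=> t0 a0 aW; have [L [e [L0 e0 Le]]] := outer_lip t0 a0 aW.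
have n0 : 0 < normc (outer (t * a) z).
  rewrite lt_neqAle normc_ge0 andbT eq_sym; apply: contraTneq aW => ->.
  by rewrite expr0n/= -leNgt mulr_ge0// ltW.
have W0 : outer (t * a) z != 0 by rewrite -normc_gt0.
set n := normc (outer (t * a) z) in n0 *.
apply: (@is_derive_quadratic _ _ _ _ (14 * (a + e) * L ^+ 2 / n ^+ 2 + L / n)
  (Num.min e (n / (2 * (L + 1))))).
  by rewrite lt_min e0 divr_gt0// mulr_gt0// ltr_wpDl.
move=> a'; rewrite lt_min => /andP[ae an].
have [a0' dL] := Le _ ae.
have L1 : 0 < 2 * (L + 1) by rewrite mulr_gt0// ltr_wpDl.
have dn : normc (outer (t * a') z - outer (t * a) z) <= n / 2.
  apply: (le_trans dL); move: an; rewrite ltr_pdivlMr//.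
  have := normr_ge0 (a' - a); nra.
apply: (le_trans (phi_est t0 (ltW a0) a0' W0 dn)); rewrite -/n.
have a'e : a' <= a + e by move: ae; rewrite ltr_norml => /andP[_ h]; lra.
have d0 := normc_ge0 (outer (t * a') z - outer (t * a) z).
move: (normc (_ - _)) d0 dL {dn} => d d0 dL.
rewrite -(real_normK (num_real (a' - a))).
exact: quadratic_bound.
Qed.

(** On the focal segment [|W|^2 = t a], and [outer_seg] supplies [Re (W ^- 2)], so the root drops
    out of [phi]. *)
Lemma phi_seg t z a : 0 < t -> 0 < a -> normc (outer (t * a) z) ^+ 2 = t * a ->
  phi t z a = a * ln (t * a) / 2 + complex.Re z ^+ 2 / (4 * t) - a / 2.
Proof.
move=> t0 a0 e; have b0 : 0 < t * a by rewrite mulr_gt0.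
have n0 : 0 < normc (outer (t * a) z).
  rewrite lt_neqAle normc_ge0 andbT eq_sym; apply: contraTneq b0 => n0.
  by rewrite -e n0 expr0n/= ltxx.
have [_ _ H] := outer_seg b0 e.
have := congr1 (@ln R) e; rewrite lnXn// => <-.
rewrite /phi H mulr2n; field.
by rewrite !gt_eqF.
Qed.

(** Strictly between the foci the closed form of [phi_seg] holds for all nearby [a]; its derivative
    is [ln (t a) / 2], which is [ln |W|] there. *)
Lemma phi_derive_seg t z a : 0 < t -> 0 < a -> complex.Im z = 0 ->
  complex.Re z ^+ 2 < 4 * (t * a) -> is_derive a 1 (phi t z) (ln (normc (outer (t * a) z))).
Proof.
move=> t0 a0 Iz Rz; have b0 : 0 < t * a by rewrite mulr_gt0.
have e := outer_out_seg b0 Iz Rz.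
have n0 : 0 < normc (outer (t * a) z).
  rewrite lt_neqAle normc_ge0 andbT eq_sym; apply: contraTneq b0 => n0.
  by rewrite -e n0 expr0n/= ltxx.
pose F : R -> R := (2^-1 *: (id * (cst (ln t) + @ln R) - id) + cst (complex.Re z ^+ 2 / (4 * t)))%R.
have near_eq : \forall x \near a, F x = phi t z x.
  near=> x; have x0 : 0 < x by near: x; exact: lt_nbhsr.
  have xR : complex.Re z ^+ 2 / (4 * t) < x.
    by near: x; apply: lt_nbhsr; rewrite ltr_pdivrMr ?mulr_gt0//; lra.
  have tx0 : 0 < t * x by rewrite mulr_gt0.
  rewrite phi_seg//.
    rewrite lnM ?posrE// /F /= !fctE /GRing.scale /=; field.
    by rewrite gt_eqF.
  apply: outer_out_seg => //.
  by move: xR; rewrite ltr_pdivrMr ?mulr_gt0//; lra.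
have dl : is_derive a 1 (@ln R) a^-1 := is_derive1_ln a0.
have dF : is_derive a 1 F (ln (normc (outer (t * a) z))).
  apply: is_derive_eq.
  have := congr1 (@ln R) e; rewrite lnXn//.
  rewrite lnM ?posrE// mulr2n /GRing.scale /= !fctE /= => E.
  rewrite addr0 mulr1 add0r mulfV ?gt_eqF//; lra.
exact: (near_eq_is_derive near_eq dF).
Unshelve. all: by end_near. Qed.

(** Default values only: for [a < 0] the square root is 0, hence so are the root, its [ln] and its
    inverse. Thus [phi] extends by 0 to the left, and its continuity at 0 can be stated on the whole
    line. *)
Lemma phi_le0 t z a : 0 < t -> a <= 0 -> phi t z a = 0.
Proof.
move=> t0; rewrite le_eqVlt => /predU1P[->|a0].
  by rewrite /phi expr0n/= mul0r mulr0 !mul0r addr0.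
have ta : t * a < 0 by rewrite pmulr_rlt0.
rewrite /phi /outer (lt_eqF ta) (ler0_sqrtr (ltW ta)) mul0r.
by rewrite ComplexField.Normc.normc0 ln0// -exprVn invr0 expr0n /= !mulr0 addr0.
Qed.

(** All terms are controlled by [sqrt (t a) <= |W| <= |z| + sqrt t], together with [normr_ln_le]. *)
Lemma phi_sqrt_le t z a : 0 < t -> 0 < a <= 1 -> `|phi t z a| <=
  ((Num.sqrt t)^-1 + normc z + Num.sqrt t + 2^-1) * Num.sqrt a.
Proof.
move=> t0 /andP[a0 a1]; have b0 : 0 < t * a by rewrite mulr_gt0.
have W2 := outer_ge z (ltW b0).
have n0 : 0 < normc (outer (t * a) z).
  rewrite lt_neqAle normc_ge0 andbT eq_sym; apply: contraTneq W2 => ->.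
  by rewrite expr0n/= -ltNge.
have W0 : outer (t * a) z != 0 by rewrite -normc_gt0.
have zE := outerE (ltW b0) W0.
have st : 0 < Num.sqrt t by rewrite sqrtr_gt0.
have sa : 0 < Num.sqrt a by rewrite sqrtr_gt0.
have sta : Num.sqrt (t * a) = Num.sqrt t * Num.sqrt a by rewrite sqrtrM// ltW.
have Wq : Num.sqrt t * Num.sqrt a <= normc (outer (t * a) z).
  by rewrite -sta -ler_sqr ?nnegrE ?sqrtr_ge0 ?(ltW n0)// sqr_sqrtr// ltW.
have saa : Num.sqrt a ^+ 2 = a by rewrite sqr_sqrtr// ltW.
have stt : Num.sqrt t ^+ 2 = t by rewrite sqr_sqrtr// ltW.
have sa1 : Num.sqrt a <= 1 by rewrite -sqrtr1 ler_sqrt.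
have nW : normc (outer (t * a) z) <= normc z + Num.sqrt t.
  have := le_normcD z (- ((t * a)%:C / outer (t * a) z)).
  rewrite {1}zE addrK normcN ComplexField.Normc.normcM ComplexField.Normc.normcV normcR gtr0_norm//.
  move=> /le_trans; apply; rewrite lerD2l ler_pdivrMr//.
  rewrite -{1}stt expr2 -mulrA ler_pM2l// (le_trans _ Wq)// ler_pM2l//.
  by rewrite -{1}saa expr2 -[X in _ <= X]mulr1 ler_pM2l.
have aW : a / normc (outer (t * a) z) <= (Num.sqrt t)^-1 * Num.sqrt a.
  rewrite ler_pdivrMr// -mulrA ler_pdivlMl// -{1}saa expr2 mulrA mulrC.
  by rewrite ler_pM2l.
have aa : a <= Num.sqrt a by rewrite -{1}saa expr2 -[X in _ <= X]mulr1 ler_pM2l.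
have p1 : `|a * ln (normc (outer (t * a) z))| <=
    ((Num.sqrt t)^-1 + normc z + Num.sqrt t) * Num.sqrt a.
  rewrite normrM (gtr0_norm a0).
  apply: (le_trans (ler_wpM2l (ltW a0) (normr_ln_le (ltW n0)))).
  rewrite mulrDr -addrA mulrDl lerD// mulrC ler_pM ?(ltW n0) ?(ltW a0)//.
have p2 : `|t * a ^+ 2 / 2 * complex.Re (outer (t * a) z ^- 2)| <= 2^-1 * Num.sqrt a.
  have ta0 : 0 <= t * a ^+ 2 / 2 by rewrite divr_ge0// mulr_ge0 ?sqr_ge0// ltW.
  rewrite normrM (ger0_norm ta0).
  apply: (@le_trans _ _ (t * a ^+ 2 / 2 * (t * a)^-1)).
    apply: ler_wpM2l => //.
    apply: (le_trans (Re_le_normc _)).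
    by rewrite -exprVn normcX ComplexField.Normc.normcV exprVn lef_pV2 ?posrE ?exprn_gt0.
  rewrite (_ : _ / _ = 2^-1 * a); last by field; rewrite !gt_eqF.
  by rewrite ler_pM2l.
by rewrite /phi mulrDl (le_trans (ler_normD _ _))// lerD.
Qed.

(** At a focus the two roots coincide, so the two factors in [outer_diff] are equal and the root
    varies like a square root. *)
Lemma outer_double t z a a' : 0 < t -> 0 < a -> 0 <= a' ->
  normc (outer (t * a) z) ^+ 2 = t * a -> complex.Re z ^+ 2 = 4 * (t * a) ->
  normc (outer (t * a') z - outer (t * a) z) ^+ 2 = t * `|a' - a|.
Proof.
move=> t0 a0 a0' e Rz; have b0 : 0 < t * a by rewrite mulr_gt0.
have b0' : 0 <= t * a' by rewrite mulr_ge0// ltW.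
have W0 : outer (t * a) z != 0.
  by rewrite -normc_eq0; apply/eqP => h; move: e; rewrite h expr0n/= => h'; move: b0; rewrite -h' ltxx.
have zW : z - outer (t * a) z = outer (t * a) z.
  have := outerE (ltW b0) W0; move: (outer (t * a) z) W0 e => W W0 e zE.
  have := sqr_modulus (plane W); rewrite normc_plane e => /= pq.
  have VE : W^-1 = (complex.Re W / (t * a)) +i* (- (complex.Im W / (t * a))).
    by rewrite -(planeK W) cplxV normc_plane planeK e mulNr.
  move: Rz b0; rewrite {}zE {}VE; case: W W0 e pq => p q W0 e /= pq Rz b0.
  have q0 : q = 0.
    apply/eqP; rewrite -sqrf_eq0; apply/eqP; move: Rz; simpc.
    rewrite /= (_ : p + _ = 2 * p); last by field; rewrite gt_eqF// gt_eqF.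
    by rewrite exprMn pq; lra.
  rewrite addrAC subrr add0r q0; simpc; congr (_ +i* _); first by field; rewrite gt_eqF// gt_eqF.
have := outer_diff z (ltW b0) b0'; rewrite zW => /(congr1 (fun v : R[i] => normc v)).
by rewrite ComplexField.Normc.normcM -expr2 normcR -mulrBr normrM (gtr0_norm t0) distrC.
Qed.

Lemma phi_continuous t z : 0 <= t -> continuous (phi t z).
Proof.
rewrite le_eqVlt => /predU1P[<-|t0] a.
  have -> : phi 0 z = (fun a => a * ln (normc z)).
    by apply/funext => x; rewrite /phi !mul0r addr0 /outer eqxx.
  by apply: cvgM; [exact: cvg_id|exact: cvg_cst].
have [a0|a0|->] := ltgtP a 0.
- apply: (@continuous_lip _ _ _ 0 (- a)); first by rewrite oppr_gt0.
  move=> y; rewrite ltr_norml => /andP[_ ya].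
  by rewrite !phi_le0 ?subrr ?normr0 ?mul0r//; lra.
- have b0 : 0 < t * a by rewrite mulr_gt0.
  have := outer_ge z (ltW b0); rewrite le_eqVlt => /orP[/eqP|] aW; last first.
    have h := phi_derive (ltW t0) a0 aW.
    by apply: differentiable_continuous; apply/derivable1_diffP.
  have [Iz Rz _] := outer_seg b0 (esym aW).
  move: Rz; rewrite le_eqVlt => /predU1P[Rz|Rz]; last first.
    have h := phi_derive_seg t0 a0 Iz Rz.
    by apply: differentiable_continuous; apply/derivable1_diffP.
  have n0 : 0 < normc (outer (t * a) z).
    rewrite lt_neqAle normc_ge0 andbT eq_sym; apply: contraTneq b0 => n0.
    by rewrite aW n0 expr0n/= ltxx.
  have W0 : outer (t * a) z != 0 by rewrite -normc_gt0.
  (* At a focus [d^2 = t |a' - a|], so the quadratic error of [phi_est] is only linear in [a' - a]: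
     this gives a Lipschitz bound instead of a derivative. The radius [a / 4] ensures
     [d <= |W| / 2]. *)
  apply: (@continuous_lip _ _ _ (14 * (a + a) * t / normc (outer (t * a) z) ^+ 2 + 2^-1 +
     `|ln (normc (outer (t * a) z))|) (Num.min a (a / 4))).
    by rewrite lt_min a0 divr_gt0.
  move=> a'; rewrite lt_min => /andP[aa aa4].
  have a0' : 0 <= a' by move: aa; rewrite ltr_norml => /andP[h _]; lra.
  have a2 : a' <= a + a by move: aa; rewrite ltr_norml => /andP[_ h]; lra.
  have d2 := outer_double t0 a0 a0' (esym aW) Rz.
  have m0 := normr_ge0 (a' - a).
  have dn : normc (outer (t * a') z - outer (t * a) z) <= normc (outer (t * a) z) / 2.
    rewrite -ler_sqr ?nnegrE ?normc_ge0 ?divr_ge0 ?normc_ge0// d2 exprMn -aW.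
    by rewrite -mulrA ler_pM2l// exprVn -natrX (le_trans (ltW aa4))// ler_pM2l// lef_pV2 ?posrE.
  have := phi_est (ltW t0) (ltW a0) a0' W0 dn; rewrite d2.
  have dn' : normc (outer (t * a') z - outer (t * a) z) / normc (outer (t * a) z) <= 2^-1.
    by rewrite ler_pdivrMr// [X in _ <= X]mulrC.
  move=> E; rewrite -[phi t z a' - _](subrK ((a' - a) * ln (normc (outer (t * a) z)))).
  rewrite (le_trans (ler_normD _ _))// [X in _ <= X]mulrDl [X in _ + X]normrM
    [`|a' - a| * _]mulrC lerD2r.
  rewrite (le_trans E)// [X in _ <= X]mulrDl lerD//.
    rewrite [X in _ <= X](_ : _ = 14 * (a + a) * (t * `|a' - a|) / normc (outer (t * a) z) ^+ 2).
      rewrite ler_wpM2r ?invr_ge0 ?sqr_ge0// ler_wpM2r ?mulr_ge0 ?(ltW t0)//.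
      by rewrite ler_pM2l.
    by field; rewrite gt_eqF.
  by rewrite mulrAC ler_wpM2r.
apply: (@continuous_sqrt0 _ _ ((Num.sqrt t)^-1 + normc z + Num.sqrt t + 2^-1) 1) => //.
  by rewrite phi_le0.
move=> y; rewrite ltr_norml => /andP[_ y1].
have [y0|y0] := leP y 0.
  by rewrite phi_le0// normr0 mulr_ge0 ?sqrtr_ge0// !addr_ge0 ?normc_ge0 ?invr_ge0 ?sqrtr_ge0.
by rewrite (gtr0_norm y0) phi_sqrt_le// y0 ltW.
Qed.

End phi.

(** * The maximizer of f_t *)

Section mean_value.
Context {R : realType}.

Lemma mvt_lt (f : R -> R) (x y K : R) : x < y -> {within `[x, y], continuous f} ->
  (forall a, x < a < y -> exists2 l, l < K & is_derive a 1 f l) ->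
  f y - f x < K * (y - x).
Proof.
move=> xy fc fd.
have dfE a : a \in `]x, y[ -> is_derive a 1 f (derive1 f a).
  rewrite in_itv /= => /fd[l _ dl]; rewrite derive1E.
  by apply: DeriveDef; [exact: ex_derive|].
have [a axy ->] := MVT xy dfE fc.
have := axy; rewrite in_itv /= => /fd[l lK dl].
by rewrite ltr_pM2r ?subr_gt0// derive1E derive_val.
Qed.

(** Made for the focus: [f] is continuous at [e], so the strict bounds on both sides of it add
    up. *)
Lemma mvt_except_lt (f : R -> R) (x y e K : R) : x < y -> {within `[x, y], continuous f} ->
  (forall a, x < a < y -> a != e -> exists2 l, l < K & is_derive a 1 f l) ->
  f y - f x < K * (y - x).
Proof.
move=> xy fc fd.
have [/andP[xe ey]|Nxey] := boolP (x < e < y); last first.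
  apply: mvt_lt => // a axy; apply: fd => //.
  by apply: contraNneq Nxey => <-.
have h1 : f e - f x < K * (e - x).
  apply: mvt_lt => //; first exact: within_sub fc (lexx _) (ltW ey).
  by move=> a /andP[xa ae]; apply: fd; rewrite ?xa ?(lt_trans ae)// lt_eqF.
have h2 : f y - f e < K * (y - e).
  apply: mvt_lt => //; first exact: within_sub fc (ltW xe) (lexx _).
  by move=> a /andP[ea ay]; apply: fd; rewrite ?ay ?(lt_trans xe)// gt_eqF.
by move: h1 h2; rewrite !mulrBr; lra.
Qed.

Lemma mvt_except_le (f : R -> R) (x y e K : R) : x <= y -> {within `[x, y], continuous f} ->
  (forall a, x < a < y -> a != e -> exists2 l, l <= K & is_derive a 1 f l) ->
  f y - f x <= K * (y - x).
Proof.
rewrite le_eqVlt => /predU1P[->|xy] fc fd; first by rewrite !subrr mulr0.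
apply/ler_addgt0Pr => d d0.
have yx : 0 < y - x by rewrite subr_gt0.
have -> : K * (y - x) + d = (K + d / (y - x)) * (y - x).
  by rewrite mulrDl divfK// gt_eqF.
apply/ltW/(mvt_except_lt (e := e)) => // a axy ae.
have [l lK dl] := fd a axy ae; exists l => //.
by rewrite (le_lt_trans lK)// ltrDl divr_gt0.
Qed.

Lemma sup_maximizer01 (F : R -> R) (a : R) : maximizer01 (fun x => (F x)%:E) a ->
  sup [set F x | x in `[0, 1]] = F a.
Proof.
move=> [a01 Fa].
have ub : ubound [set F x | x in `[0, 1]] (F a).
  by move=> _ [x /= x01 <-]; rewrite -lee_fin; apply: Fa; move: x01; rewrite in_itv.
apply/eqP; rewrite eq_le; apply/andP; split.
  by apply: ge_sup => //; exists (F a), a => //=; rewrite in_itv.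
by apply: ub_le_sup; [exists (F a)|exists a => //=; rewrite in_itv].
Qed.

End mean_value.

Lemma le_mul_sqr (R : realType) (b n r : R) : 0 <= b -> 0 <= n -> 0 <= r ->
  b <= n ^+ 2 -> b <= r ^+ 2 -> b <= n * r.
Proof.
move=> b0 n0 r0 bn br; have nr : 0 <= n * r by exact: mulr_ge0.
by rewrite -ler_sqr ?nnegrE// exprMn expr2 ler_pM.
Qed.

(** * Confocal ellipses and the outer root of T(w) *)

Section geometry.
Context {R : realType}.
Variables (g : R -> R) (c t : R).
Hypothesis c0 : 0 <= c.
Hypothesis t0 : 0 <= t.
Hypothesis tc : t * c < 1.
Let h (r : R) := alpha0 g r / r.
Hypothesis h0 : forall r, 0 <= r -> 0 <= h r.
Hypothesis hL : forall x y : R, 0 <= x -> 0 <= y -> `|h x - h y| <= c * `|x - y|.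
Hypothesis al0 : alpha0 g 0 = 0.
Local Notation T := (transport g t).
Implicit Types (w z : R * R) (r b : R).

Lemma alpha_hE r : 0 <= r -> alpha0 g r = r * h r.
Proof. exact: alpha0_h. Qed.

Lemma talpha_ge0 r : 0 <= r -> 0 <= t * alpha0 g r.
Proof. by move=> r0; rewrite mulr_ge0// alpha_hE// mulr_ge0// h0. Qed.

Lemma talpha_le r : 0 <= r -> t * alpha0 g r <= t * c * r ^+ 2.
Proof.
move=> r0; have -> : t * c * r ^+ 2 = t * (r * (c * r)) by ring.
apply: ler_wpM2l => //; rewrite alpha_hE//; apply: ler_wpM2l => //.
exact: (h_le h0 hL).
Qed.

Lemma talpha_lt r : 0 < r -> t * alpha0 g r < r ^+ 2.
Proof.
move=> r0; apply: (le_lt_trans (talpha_le (ltW r0))).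
by rewrite -[X in _ < X]mul1r ltr_pM2r// exprn_gt0.
Qed.

Lemma axis1E r : 0 < r -> axis1 g t r = r + t * alpha0 g r / r.
Proof. by move=> r0; rewrite /axis1 mulrA. Qed.

Lemma axis2E r : 0 < r -> axis2 g t r = r - t * alpha0 g r / r.
Proof. by move=> r0; rewrite /axis2 mulrA. Qed.

Lemma joukowski_coord b (W : R[i]) : W != 0 ->
  complex.Re (W + b%:C / W) = complex.Re W / normc W * (normc W + b / normc W) /\
  complex.Im (W + b%:C / W) = complex.Im W / normc W * (normc W - b / normc W).
Proof.
move=> W0; have n0 : 0 < normc W by rewrite normc_gt0.
have VE : W^-1 = (complex.Re W / normc W ^+ 2) +i* (- (complex.Im W / normc W ^+ 2)).
  by rewrite -[in LHS](planeK W) cplxV normc_plane mulNr.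
rewrite VE; move: (normc W) n0 => n n0; case: W {W0 VE} => p q; simpc => /=.
by split; field; rewrite gt_eqF.
Qed.

Lemma unit_normc (W : R[i]) : W != 0 ->
  (complex.Re W / normc W) ^+ 2 + (complex.Im W / normc W) ^+ 2 = 1.
Proof. by move=> W0; rewrite -(unit_modulus (z := plane W)) -?cplx_eq0 ?planeK// normc_plane. Qed.

Lemma ell_joukowski r z (W := outer (t * alpha0 g r) (cplx z)) : 0 < r -> W != 0 ->
  (normc W <= r -> ell g t r z <= 1) /\ (r <= normc W -> 1 <= ell g t r z).
Proof.
move=> r0 W0; have b0 := talpha_ge0 (ltW r0).
have bW := outer_ge (cplx z) b0; rewrite -/W in bW.
have zE := outerE b0 W0; rewrite -/W in zE.
have br := talpha_lt r0.
have := axis1_gt0 t0 h0 r0; have := axis2_gt0 t0 tc h0 hL r0.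
rewrite /ell axis1E// axis2E//.
have [] := joukowski_coord (t * alpha0 g r) W0; rewrite -zE /= => -> ->.
have := unit_normc W0; have n0 : 0 < normc W by rewrite normc_gt0.
move: (complex.Re W / _) (complex.Im W / _) => p q.
move: {zE W0 W} (normc W) n0 bW => n n0.
move: (t * alpha0 g r) b0 br => b b0 br bn pq B0 A0.
have e : p ^+ 2 + q ^+ 2 = 1 by [].
have E (u v w : R) : (u * v) ^+ 2 / w ^+ 2 = u ^+ 2 * (v / w) ^+ 2.
  by rewrite !exprMn exprVn [RHS]mulrA.
rewrite !E.
have D1 : r + b / r - (n + b / n) = (r - n) * (r * n - b) / (r * n).
  by field; rewrite !gt_eqF.
have D2 : r - b / r - (n - b / n) = (r - n) * (r * n + b) / (r * n).
  by field; rewrite !gt_eqF.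
have rn0 : 0 < r * n by rewrite mulr_gt0.
have brn : 0 <= r * n - b.
  by rewrite subr_ge0 le_mul_sqr// ltW.
have n1 : 0 <= n - b / n by rewrite subr_ge0 ler_pdivrMr.
have n2 : 0 <= n + b / n by rewrite addr_ge0 ?divr_ge0 ?(ltW n0).
have q1 : 0 <= (n + b / n) / (r + b / r) by rewrite divr_ge0 ?(ltW A0).
have q2 : 0 <= (n - b / n) / (r - b / r) by rewrite divr_ge0 ?(ltW B0).
have brn' : 0 <= r * n + b by rewrite addr_ge0 ?(ltW rn0).
split=> nr; rewrite -e; apply: lerD.
- rewrite -[X in _ <= X]mulr1 ler_wpM2l ?sqr_ge0// expr_le1//.
  by rewrite ler_pdivrMr// mul1r -subr_ge0 D1 divr_ge0 ?(ltW rn0)// mulr_ge0// subr_ge0.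
- rewrite -[X in _ <= X]mulr1 ler_wpM2l ?sqr_ge0// expr_le1//.
  by rewrite ler_pdivrMr// mul1r -subr_ge0 D2 divr_ge0 ?(ltW rn0)// mulr_ge0// subr_ge0.
- rewrite -[X in X <= _]mulr1 ler_wpM2l ?sqr_ge0// expr_ge1//.
  rewrite ler_pdivlMr// mul1r -subr_le0 D1 pmulr_lle0 ?invr_gt0//.
  by rewrite mulr_le0_ge0// subr_le0.
- rewrite -[X in X <= _]mulr1 ler_wpM2l ?sqr_ge0// expr_ge1//.
  rewrite ler_pdivlMr// mul1r -subr_le0 D2 pmulr_lle0 ?invr_gt0//.
  by rewrite mulr_le0_ge0// subr_le0.
Qed.

Lemma outer_transport_neq0 r w : 0 < r -> w != 0 ->
  outer (t * alpha0 g r) (cplx (T w)) != 0.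
Proof.
move=> r0; apply: contra_neq => /(outer_eq0 (talpha_ge0 (ltW r0)))[_ Tw].
apply: (transport_inj c0 t0 tc h0 hL); rewrite transport0//.
by apply/cplx_inj; rewrite Tw.
Qed.

Lemma outer_gt r w : 0 < r -> r < modulus w ->
  r < normc (outer (t * alpha0 g r) (cplx (T w))).
Proof.
move=> r0 rw; have w0 : w != 0 by rewrite -modulus_gt0 (lt_trans r0).
have [H _] := ell_joukowski r0 (outer_transport_neq0 r0 w0).
rewrite ltNge; apply/negP => /H; apply/negP; rewrite -ltNge.
exact: (ell_transport_gt t0 tc h0 hL).
Qed.

Lemma outer_lt r w : 0 < r -> modulus w < r ->
  normc (outer (t * alpha0 g r) (cplx (T w))) < r.
Proof.
move=> r0 rw.
have [->|W0] := eqVneq (outer (t * alpha0 g r) (cplx (T w))) 0.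
  by rewrite ComplexField.Normc.normc0.
have [_ H] := ell_joukowski r0 W0.
rewrite ltNge; apply/negP => /H; apply/negP; rewrite -ltNge.
exact: (ell_transport_lt t0 tc h0 hL).
Qed.

(** A quantitative form of [outer_gt] and [outer_lt]. Let [w'] be the point of the circle of radius
    [r] in the direction of [W]. Then [T w] and [T w'] are the values of [x + b / x] at [W] and
    [w'], at most [2 |W - w'|] apart, while [T] shrinks no distance by more than [1 - t c]. *)
Lemma outer_dist r w : 0 < r ->
  (1 - t * c) / 2 * `|modulus w - r| <=
  `|normc (outer (t * alpha0 g r) (cplx (T w))) - r|.
Proof.
move=> r0; have b0 := talpha_ge0 (ltW r0); have br := talpha_lt r0.
have k0 : 0 < 1 - t * c by rewrite subr_gt0.
have bW := outer_ge (cplx (T w)) b0.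
have [E|W0] := eqVneq (outer (t * alpha0 g r) (cplx (T w))) 0.
  have [_ Tw] := outer_eq0 b0 E.
  have w0 : w = 0 by apply: (transport_inj c0 t0 tc h0 hL); rewrite transport0//; apply/cplx_inj.
  rewrite E w0 modulus0 ComplexField.Normc.normc0 ler_piMl//.
  by rewrite ler_pdivrMr// mul1r lerBlDr (@le_trans _ _ 2) ?lerDl ?mulr_ge0// ler1n.
have zE := outerE b0 W0.
set W := outer _ _ in bW W0 zE *; have n0 : 0 < normc W by rewrite normc_gt0.
pose w' : R * R := plane ((r / normc W)%:C * W).
have w'r : modulus w' = r.
  rewrite normc_plane ComplexField.Normc.normcM normcR ger0_norm ?divr_ge0 ?(ltW r0) ?(ltW n0)//.
  by rewrite divfK// gt_eqF.
have w'0 : cplx w' != 0 by rewrite cplx_eq0 -modulus_gt0 w'r.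
have Tw' : cplx (T w') = cplx w' + (t * alpha0 g r)%:C / cplx w'.
  rewrite /transport -cplx_eq0 (negPf w'0) planeK w'r; congr (_ + _ / _).
  by rewrite rmorphM.
have cw' : cplx w' = (r / normc W)%:C * W by rewrite planeK.
have dE : cplx (T w - T w') = (W - cplx w') * (1 - (t * alpha0 g r)%:C / (W * cplx w')).
  by rewrite cplxB Tw' {1}zE; field; rewrite W0 w'0.
have d1 : normc (W - cplx w') = `|normc W - r|.
  have -> : W - cplx w' = ((normc W - r) / normc W)%:C * W.
    rewrite cw' -{1}[W]mul1r -mulrBl; congr (_ * _).
    by rewrite mulrBl divff ?gt_eqF// rmorphB.
  by rewrite ComplexField.Normc.normcM normcR normrM normfV (gtr0_norm n0) divfK// gt_eqF.
have d2 : normc (1 - (t * alpha0 g r)%:C / (W * cplx w')) <= 2.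
  apply: (le_trans (le_normcD _ _)); rewrite normcN ComplexField.Normc.normc1.
  rewrite ComplexField.Normc.normcM ComplexField.Normc.normcV ComplexField.Normc.normcM normcR.
  rewrite -[normc (cplx w')]/(modulus w') w'r (ger0_norm b0).
  rewrite -[X in _ <= X]/(1 + 1) lerD2l ler_pdivrMr ?mulr_gt0// mul1r.
  exact: (le_mul_sqr b0 (ltW n0) (ltW r0) bW (ltW br)).
have := transport_expand c0 t0 h0 hL w w'; rewrite {2}/modulus dE ComplexField.Normc.normcM d1.
have H : `|modulus w - r| <= modulus (w - w').
  rewrite ler_norml -w'r le_modulusB andbT lerNl opprB modulusBC; exact: le_modulusB.
move=> H2; rewrite mulrAC ler_pdivrMr//.
apply: (@le_trans _ _ ((1 - t * c) * modulus (w - w'))).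
  by rewrite ler_wpM2l// ltW.
by apply: (le_trans H2); rewrite ler_wpM2l.
Qed.

(** The two roots are [w] and [t alpha0 / w], and [talpha_lt] makes the first one the larger in
    modulus. *)
Lemma outer_transport w : outer (t * alpha0 g (modulus w)) (cplx (T w)) = cplx w.
Proof.
have [->|w0] := eqVneq w 0; first by rewrite transport0// modulus0 al0 mulr0 /outer eqxx.
have r0 : 0 < modulus w by rewrite modulus_gt0.
have w0' : cplx w != 0 by rewrite cplx_eq0.
have b0 := talpha_ge0 (ltW r0); have br := talpha_lt r0.
have Tw : cplx (T w) = cplx w + (t * alpha0 g (modulus w))%:C / cplx w.
  rewrite /transport (negPf w0) planeK; congr (_ + _ / _).
  by rewrite rmorphM.
have bW := outer_ge (cplx (T w)) b0; have := outerM (cplx (T w)) b0.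
set W := outer _ _ in bW *; move=> E.
have : (W - cplx w) * (W - (t * alpha0 g (modulus w))%:C / cplx w) = 0.
  transitivity ((t * alpha0 g (modulus w))%:C - W * (cplx (T w) - W)).
    by rewrite Tw; field.
  by rewrite E subrr.
move/eqP; rewrite mulf_eq0 !subr_eq0 => /orP[/eqP//|/eqP WE].
have [bz|bn] := eqVneq (t * alpha0 g (modulus w)) 0.
  by rewrite /W bz /outer eqxx Tw bz mul0r addr0.
exfalso; move: bW; rewrite WE ComplexField.Normc.normcM ComplexField.Normc.normcV.
rewrite normcR (ger0_norm b0).
rewrite -[normc (cplx w)]/(modulus w); apply/negP.
rewrite -ltNge expr_div_n ltr_pdivrMr ?exprn_gt0//.
by rewrite expr2 ltr_pM2l// lt_neqAle eq_sym bn.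
Qed.

End geometry.

Section maximizer.
Context {R : realType}.
Variable g : R -> R.
Hypothesis g_cont : {within `[0, 1], continuous g}.
Hypothesis dg1_cvg : cvg ((g 1 - g (1 - h)) / h @[h --> 0^'+]).
Hypothesis A3 : condA3 g.
Variables c t : R.
Hypothesis c0 : 0 <= c.
Hypothesis cP : forall r, rad0 g < r < rad1 g ->
  `|derive1 (fun r => alpha0 g r / r) r| <= c.
Hypothesis t0 : 0 <= t.
Hypothesis tc : t * c < 1.
Local Notation T := (transport g t).
Let h (r : R) := alpha0 g r / r.

Lemma h_lip (x y : R) : 0 <= x -> 0 <= y -> `|h x - h y| <= c * `|x - y|.
Proof.
move=> x0 y0; have H := h_lip_le g_cont dg1_cvg A3 c0 cP.
have [xy|yx] := leP x y.
  rewrite distrC [`|x - y|]distrC (ger0_norm (x := y - x)) ?subr_ge0//; exact: H.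
rewrite (ger0_norm (x := x - y)) ?subr_ge0 ?(ltW yx)//; exact: (H y x y0 (ltW yx)).
Qed.

Let h0 (r : R) : 0 <= r -> 0 <= h r.
Proof. exact: (h_ge0 g_cont dg1_cvg A3). Qed.

Let al0 : alpha0 g 0 = 0 := alpha0_0 g.

Definition obj z a : R := g a + phi t (cplx z) a.

Lemma obj_cont z : {within `[0, 1], continuous (obj z)}.
Proof.
apply: (@within_continuousD _ _ _ _ g (phi t (cplx z))) => //.
by apply: continuous_subspaceT; exact: phi_continuous.
Qed.

(** Below the maximizer [|W_a| > s(a)] and [s(a)^2 > t a], so no focus occurs on this side. The sign
    is stated as [- l < 0] to suit [mvt_lt] for the opposite function. *)
Lemma obj_derive_low w a : 0 < a -> a < alpha0 g (modulus w) -> a < 1 ->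
  exists2 l, - l < 0 & is_derive a 1 (obj (T w)) l.
Proof.
move=> a0 aw a1; have a01 : 0 < a < 1 by rewrite a0.
have sw : expR (- derive1 g a) < modulus w.
  by rewrite -(lt_alpha0 g_cont dg1_cvg A3)// modulus_ge0.
have s0 : 0 < expR (- derive1 g a) := expR_gt0 _.
have as_ := alpha0_s g_cont A3 a01.
have := outer_gt c0 t0 tc h0 h_lip al0 s0 sw; rewrite as_ => sW.
have := talpha_lt t0 tc h0 h_lip al0 s0; rewrite as_ => ts.
have aW : t * a < normc (outer (t * a) (cplx (T w))) ^+ 2.
  by rewrite (lt_trans ts)// ltr_sqr ?nnegrE ?expR_ge0 ?normc_ge0.
exists (derive1 g a + ln (normc (outer (t * a) (cplx (T w))))); last first.
  exact: (is_deriveD (dgP A3 a01) (phi_derive t0 a0 aW)).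
rewrite oppr_lt0 -ltrBlDl sub0r -[- derive1 g a]expRK ltr_ln// posrE (lt_trans s0)//.
Qed.

(* [phi t z] fails to be differentiable where [z] is a focus [+-2 sqrt (t a)]. *)
Definition crit z : R := complex.Re z ^+ 2 / (4 * t).

Lemma phi_derive_crit z a : 0 < a -> a != crit z ->
  is_derive a 1 (phi t z) (ln (normc (outer (t * a) z))).
Proof.
move=> a0 ae; have ta : 0 <= t * a by rewrite mulr_ge0// ltW.
have := outer_ge z ta; rewrite le_eqVlt => /predU1P[e|]; last exact: phi_derive.
have [tz|tn] := eqVneq t 0.
  have [z0|zn] := eqVneq z 0.
    have -> : phi t z = cst 0.
      apply/funext => x; rewrite /phi tz !mul0r addr0 /outer eqxx z0.
      by rewrite ComplexField.Normc.normc0 ln0// mulr0.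
    by rewrite z0 tz mul0r /outer eqxx ComplexField.Normc.normc0 ln0//; exact: is_derive_cst.
  apply: phi_derive => //; rewrite tz mul0r /outer eqxx exprn_gt0//.
  by rewrite normc_gt0.
have tp : 0 < t by rewrite lt_neqAle eq_sym tn.
have [Iz Rz _] := outer_seg (mulr_gt0 tp a0) (esym e).
apply: phi_derive_seg => //; rewrite lt_neqAle Rz andbT.
apply: contraNneq ae => Rz'; rewrite /crit Rz'; apply/eqP.
by field; rewrite gt_eqF.
Qed.

(** The case [t = 0], [w = 0] is set apart because the root is then 0, and [ln 0 = 0] would lose the
    sign of the derivative. *)
Lemma obj_derive_high w a : 0 < t \/ w != 0 -> a != crit (cplx (T w)) ->
  alpha0 g (modulus w) < a -> a < 1 ->
  exists2 l, l < 0 & is_derive a 1 (obj (T w)) l.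
Proof.
move=> tw ae aw a1.
have a0 : 0 < a.
  by apply: le_lt_trans aw; have /andP[] := alpha0_01 g_cont dg1_cvg A3 (modulus_ge0 w).
have a01 : 0 < a < 1 by rewrite a0.
have sw : modulus w < expR (- derive1 g a).
  by rewrite -(alpha0_lt g_cont dg1_cvg A3)// modulus_ge0.
have s0 : 0 < expR (- derive1 g a) := expR_gt0 _.
have as_ := alpha0_s g_cont A3 a01.
have := outer_lt t0 tc h0 h_lip al0 s0 sw; rewrite as_ => sW.
exists (derive1 g a + ln (normc (outer (t * a) (cplx (T w))))); last first.
  exact: (is_deriveD (dgP A3 a01) (phi_derive_crit a0 ae)).
have W0 : 0 < normc (outer (t * a) (cplx (T w))).
  rewrite normc_gt0; apply/eqP => /(outer_eq0 (mulr_ge0 t0 (ltW a0)))[/eqP].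
  rewrite mulf_eq0 (gt_eqF a0) orbF => /eqP t00 Tw0.
  case: tw => [tp|/eqP]; first by move: tp; rewrite t00 ltxx.
  apply; apply: (transport_inj c0 t0 tc h0 h_lip); rewrite transport0.
  exact: cplx_inj.
rewrite -ltrBrDl sub0r -[- derive1 g a]expRK ltr_ln// posrE//.
Qed.

Lemma phi_transport w (a := alpha0 g (modulus w)) : phi t (cplx (T w)) a =
  a * ln (modulus w) + t * a ^+ 2 / 2 * complex.Re (cplx w ^- 2).
Proof. by rewrite /phi (outer_transport t0 tc h0 h_lip al0). Qed.

Lemma obj_max w (tw : 0 < t \/ w != 0) (a := alpha0 g (modulus w)) :
  (forall x y : R, 0 <= x -> x < y -> y <= a -> obj (T w) x < obj (T w) y) /\
  (forall x y : R, a <= x -> x < y -> y <= 1 -> obj (T w) y < obj (T w) x).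
Proof.
have /andP[a0 a1] := alpha0_01 g_cont dg1_cvg A3 (modulus_ge0 w).
split=> x y.
  move=> x0 xy ya; rewrite -ltrN2 -subr_lt0 -(mul0r (y - x)).
  have := @mvt_lt _ (fun a => - obj (T w) a) x y 0 xy.
  apply.
    apply: (@within_sub _ _ 0 1) => //; last exact: le_trans ya a1.
    by move=> p; apply: cvgN; exact: obj_cont.
  move=> b /andP[xb bey]; have b0 : 0 < b by rewrite (le_lt_trans x0).
  have ba : b < a by rewrite (lt_le_trans bey).
  have [l l0 dl] := obj_derive_low b0 ba (lt_le_trans ba a1).
  by exists (- l) => //; exact: is_deriveN.
move=> ax xy y1; rewrite -subr_lt0 -(mul0r (y - x)).
apply: (mvt_except_lt (e := crit (cplx (T w)))) => //.
  by apply: (@within_sub _ _ 0 1) => //; [exact: obj_cont|exact: le_trans a0 ax].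
move=> b /andP[xb bey] be; apply: obj_derive_high => //.
  by rewrite (le_lt_trans ax).
by rewrite (lt_le_trans bey).
Qed.

Lemma f_max w : 0 < t ->
  unique_maximizer01 (fun a => (f_ g t (T w) a)%:E) (alpha0 g (modulus w)).
Proof.
move=> tp; have [H1 H2] := obj_max (or_introl tp : _ \/ w != 0).
have /andP[a0 a1] := alpha0_01 g_cont dg1_cvg A3 (modulus_ge0 w).
apply: unique_maximizer01_mono; rewrite ?a0// => x y.
  by move=> x0 xy ya; rewrite !f_E ?(le_trans x0 (ltW xy))//; exact: H1.
by move=> ax xy y1; rewrite !f_E ?(le_trans a0) ?(le_trans ax (ltW xy))//; exact: H2.
Qed.

Lemma alpha_transport w : 0 < t -> alpha_ g t (T w) = alpha0 g (modulus w).
Proof. by move=> /(f_max w)/argmax01E. Qed.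

(** The value of the potential at [T w], written in [w]; at [t = 0] it is the potential of [nu_0] at
    [w]. *)
Definition pot w : R := let a := alpha0 g (modulus w) in
  g a + a * ln (modulus w) + t * a ^+ 2 / 2 * complex.Re (cplx w ^- 2) - g 1.

Lemma potE w : pot w = obj (T w) (alpha0 g (modulus w)) - g 1.
Proof. by rewrite /obj phi_transport addrA. Qed.

Lemma U_transport w : 0 < t -> U_ g t (T w) = pot w.
Proof.
move=> tp; have [m _] := f_max w tp; rewrite /U_ (sup_maximizer01 m) potE f_E//.
by have /andP[] := alpha0_01 g_cont dg1_cvg A3 (modulus_ge0 w).
Qed.

(** The outer ellipse is the image of the circle of radius [rad1], as [expR (dg1 g) = h (rad1 g)].
    The map fixes the disc of radius [rad0], and outside it the short semi-axis already exceeds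
    [axis2 (rad0 g) = rad0 g]. *)
Lemma Rset_transport w : Rset g t (T w) <-> rad0 g < modulus w < rad1 g.
Proof.
have r0 : 0 <= rad0 g := rad0_ge0 g.
have r1 : 0 < rad1 g := rad1_gt0 g.
have e1 : expR (dg1 g) = h (rad1 g).
  by rewrite /h (alpha0_ge_rad1 g_cont dg1_cvg A3)// mul1r /rad1 expRN invrK.
have HE : (T w).1 ^+ 2 / (rad1 g + t * expR (dg1 g)) ^+ 2 +
   (T w).2 ^+ 2 / (rad1 g - t * expR (dg1 g)) ^+ 2 = ell g t (rad1 g) (T w).
  by rewrite e1.
rewrite /Rset /= HE; split.
  move=> [z0 e]; apply/andP; split; last first.
    rewrite ltNge le_eqVlt; apply/negP => /predU1P[E|wr]; last first.
      by move: e; apply/negP; rewrite -leNgt ltW// (ell_transport_gt t0 tc h0 h_lip).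
    by move: e; rewrite E (ell_transport_eq t0 tc h0 h_lip) ?ltxx// -modulus_gt0 -E.
  rewrite ltNge; apply/negP => w0; move: z0; apply/negP; rewrite -leNgt.
  have H0 : hvec g w = 0.
    apply/eqP; rewrite -modulus_eq0 (modulus_hvec h0).
    by rewrite (alpha0_le_rad0 g_cont A3) ?modulus_ge0// mul0r.
  by rewrite transportE H0 scaler0 addr0.
move=> /andP[w0 w1]; split; last exact: (ell_transport_lt t0 tc h0 h_lip).
apply: lt_le_trans (axis2_le_modulus t0 tc h0 h_lip w).
have [_] := axis_incr t0 tc h_lip r0 w0; apply: le_lt_trans.
by rewrite /axis2 (alpha0_le_rad0 g_cont A3)// mul0r mulr0 subr0.
Qed.

End maximizer.

(** * The potential of the transported measure *)

Section joukowski_average.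
Context {R : realType}.
Implicit Types (u v w W : R[i]) (q : R) (N : nat).

Lemma ln_normc_subX N u v q : u != 0 -> 0 <= q -> normc v <= q * normc u -> q ^+ N <= 2^-1 ->
  u ^+ N - v ^+ N != 0 /\ `|ln (normc (u ^+ N - v ^+ N)) - N%:R * ln (normc u)| <= 1.
Proof.
move=> u0 q0 vu qN; have n0 : 0 < normc u by rewrite normc_gt0.
pose x := v / u.
have xq : normc (x ^+ N) <= 2^-1.
  rewrite normcX (le_trans _ qN)// lerXn2r ?nnegrE ?normc_ge0//.
  by rewrite ComplexField.Normc.normcM ComplexField.Normc.normcV ler_pdivrMr.
have E : u ^+ N - v ^+ N = u ^+ N * (1 - x ^+ N).
  by rewrite mulrBr mulr1 -exprMn /x mulrC divfK.
have x1 : 2^-1 <= normc (1 - x ^+ N).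
  have := le_normcD (1 - x ^+ N) (x ^+ N); rewrite subrK ComplexField.Normc.normc1; lra.
have x2 : normc (1 - x ^+ N) <= 3 / 2.
  apply: (le_trans (le_normcD _ _)); rewrite normcN ComplexField.Normc.normc1; lra.
have p0 : 0 < normc (1 - x ^+ N) by apply: lt_le_trans x1; rewrite invr_gt0.
split.
  by rewrite E mulf_neq0 ?expf_neq0// -normc_gt0.
have u0N : 0 < normc u ^+ N by rewrite exprn_gt0.
rewrite E ComplexField.Normc.normcM normcX lnM ?posrE// lnXn// mulr_natl addrAC subrr add0r.
rewrite ler_norml; apply/andP; split.
  apply: le_trans (ln_ge_1Binv p0); rewrite lerBrDr addrC -lerBrDr opprK.
  by rewrite -[X in _ <= X]/(2 : R) -[2]invrK lef_pV2 ?posrE ?invr_gt0.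
by apply: (le_trans (ln_le_subr1 p0)); lra.
Qed.

Lemma expr_le_half_lt1 N q : (0 < N)%N -> q ^+ N <= 2^-1 -> 0 <= q -> q < 1.
Proof.
move=> N0 qN q0; rewrite ltNge; apply/negP => q1.
have := exprn_ege1 N q1; lra.
Qed.

(** With [v = u w] the argument is [- (W1 - v) (W2 - v) / v], so the sum is explicit. The first
    factor contributes [N ln max]; the second contributes [N ln |w|], which the denominator cancels.
    The ratio [q] keeps each error below 1. *)
Lemma sum_ln_joukowski N W1 W2 w q : (0 < N)%N -> 0 <= q -> q ^+ N <= 2^-1 -> w != 0 ->
  normc W2 <= q * normc w -> (normc W1 <= q * normc w \/ normc w <= q * normc W1) ->
  `|\sum_(u <- unity_roots N) ln (normc (W1 + W2 - u * w - W1 * W2 / (u * w))) -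
    N%:R * ln (Num.max (normc W1) (normc w))| <= 2.
Proof.
move=> N0 q0 qN w0 W2q W1q.
have q1 := expr_le_half_lt1 N0 qN q0.
have r0 : 0 < normc w by rewrite normc_gt0.
have qr : q * normc w < normc w by rewrite gtr_pMl.
have neq1 u : normc u = 1 -> W1 - u * w != 0.
  move=> u1; rewrite subr_eq0; apply/eqP => E.
  have e : normc W1 = normc w by rewrite E ComplexField.Normc.normcM u1 mul1r.
  by move: W1q; rewrite e; case => /le_lt_trans/(_ qr); rewrite ltxx.
have neq2 u : normc u = 1 -> W2 - u * w != 0.
  move=> u1; rewrite subr_eq0; apply/eqP => E.
  have e : normc W2 = normc w by rewrite E ComplexField.Normc.normcM u1 mul1r.
  by move: W2q; rewrite e => /le_lt_trans/(_ qr); rewrite ltxx.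
have [d2 h2] := ln_normc_subX w0 q0 W2q qN.
have d2' : W2 ^+ N - w ^+ N != 0 by rewrite -opprB oppr_eq0.
have [d1 h1] : W1 ^+ N - w ^+ N != 0 /\
    `|ln (normc (W1 ^+ N - w ^+ N)) - N%:R * ln (Num.max (normc W1) (normc w))| <= 1.
  case: W1q => H.
    have [d1 h1] := ln_normc_subX w0 q0 H qN.
    by rewrite -opprB oppr_eq0 normcN max_r// (le_trans H)// ltW.
  have W10 : W1 != 0.
    by apply: contraTneq H => ->; rewrite ComplexField.Normc.normc0 mulr0 -ltNge.
  have [d1 h1] := ln_normc_subX W10 q0 H qN.
  by rewrite max_l// (le_trans H)// ler_piMl ?normc_ge0// ltW.
have E : \sum_(u <- unity_roots N) ln (normc (W1 + W2 - u * w - W1 * W2 / (u * w))) =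
    ln (normc (W1 ^+ N - w ^+ N)) + ln (normc (W2 ^+ N - w ^+ N)) - N%:R * ln (normc w).
  rewrite -(sum_const_unity_roots (ln (normc w)) N0).
  rewrite -!sum_ln_unity_roots// -big_split -sumrB/=.
  apply: eq_big_seq => u uN; have u1 := normc_unity_root N0 uN.
  have u0 : u != 0 by rewrite -normc_gt0 u1.
  have -> : W1 + W2 - u * w - W1 * W2 / (u * w) = - ((W1 - u * w) * (W2 - u * w) / (u * w)).
    by field; rewrite u0 w0.
  rewrite normcN ComplexField.Normc.normcM ComplexField.Normc.normcV.
  rewrite [normc (u * w)]ComplexField.Normc.normcM u1 mul1r.
  rewrite ln_div ?posrE// ?ComplexField.Normc.normcM ?mulr_gt0 ?normc_gt0 ?neq1 ?neq2//.
  by rewrite lnM ?posrE ?normc_gt0 ?neq1 ?neq2.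
have h2' : `|ln (normc (W2 ^+ N - w ^+ N)) - N%:R * ln (normc w)| <= 1.
  by rewrite -[W2 ^+ N - _]opprB normcN.
rewrite E; move: h1 h2'; move: (ln (normc (W1 ^+ N - _))) (ln (normc (W2 ^+ N - _))) => x y.
move: (N%:R * _) (N%:R * _) => a b h1 h2'.
rewrite (_ : x + y - a - b = (x - b) + (y - a)); last by ring.
by rewrite (le_trans (ler_normD _ _))// -[X in _ <= X]/(1 + 1) lerD.
Qed.

End joukowski_average.

Section level_sets.
Context {R : realType}.
Variable g : R -> R.
Hypothesis g_cont : {within `[0, 1], continuous g}.
Hypothesis dg1_cvg : cvg ((g 1 - g (1 - h)) / h @[h --> 0^'+]).
Hypothesis A3 : condA3 g.
Variables c t : R.
Hypothesis c0 : 0 <= c.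
Hypothesis cP : forall r, rad0 g < r < rad1 g ->
  `|derive1 (fun r => alpha0 g r / r) r| <= c.
Hypothesis t0 : 0 <= t.
Hypothesis tc : t * c < 1.
Variable nu : probability (R * R)%type R.
Hypothesis nuP : nu0_spec g nu.
Local Notation T := (transport g t).
Let h (r : R) := alpha0 g r / r.
Let hL := h_lip g_cont dg1_cvg A3 c0 cP.
Let h0 (r : R) : 0 <= r -> 0 <= h r.
Proof. exact: (h_ge0 g_cont dg1_cvg A3). Qed.
Let al0 : alpha0 g 0 = 0 := alpha0_0 g.

Lemma measurable_h_modulus : measurable_fun setT (fun w : R * R => h (modulus w)).
Proof.
have -> : (fun w : R * R => h (modulus w)) = (fun r => h `|r|) \o @modulus R.
  by apply/funext => w /=; rewrite ger0_norm ?modulus_ge0.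
apply: measurableT_comp; last exact: measurable_modulus.
by apply: continuous_measurable_fun => r; exact: (h_continuous c0 hL).
Qed.

Lemma measurable_alpha_modulus : measurable_fun setT (fun w : R * R => alpha0 g (modulus w)).
Proof.
have -> : (fun w : R * R => alpha0 g (modulus w)) =
    (fun w => modulus w * h (modulus w)).
  by apply/funext => w; rewrite (alpha0_h al0)// modulus_ge0.
by apply: measurable_funM; [exact: measurable_modulus|exact: measurable_h_modulus].
Qed.

Lemma measurable_transport : measurable_fun setT T.
Proof.
have mq : measurable_fun setT (fun w : R * R => t * (h (modulus w) / modulus w)).
  apply: measurable_funM => //; apply: measurable_funM; first exact: measurable_h_modulus.
  by apply: measurable_fun_inv; exact: measurable_modulus.
apply/measurable_fun_pairP; split.
- rewrite (_ : fst \o _ = fun w : R * R => w.1 + w.1 * (t * (h (modulus w) / modulus w))).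
    by apply: measurable_funD => //; apply: measurable_funM.
  by apply/funext => w /=; rewrite transportE /hvec/= /GRing.scale/= mulrCA.
- rewrite (_ : snd \o _ = fun w : R * R => w.2 - w.2 * (t * (h (modulus w) / modulus w))).
    by apply: measurable_funB => //; apply: measurable_funM.
  by apply/funext => w /=; rewrite transportE /hvec/= /GRing.scale/= mulrN mulrCA.
Qed.

(* Under [nu] the variable [alpha0 g (modulus w)] is uniform on [0, 1]. *)
Definition level (a : R) : set (R * R) := [set w | alpha0 g (modulus w) < a].
Definition ring_ (a b : R) : set (R * R) := [set w | a <= alpha0 g (modulus w) < b].

Lemma measurable_level a : measurable (level a).
Proof.
have := measurable_alpha_modulus measurableT (measurable_itv `]-oo, a[).
by rewrite setTI; congr measurable; apply/seteqP; split => w /=; rewrite in_itv.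
Qed.

Lemma ring_E a b : ring_ a b = level b `\` level a.
Proof.
apply/seteqP; split=> w; rewrite /ring_ /level /=.
  by move=> /andP[aw wb]; split=> //; apply/negP; rewrite -leNgt.
by move=> [-> /negP]; rewrite -leNgt => ->.
Qed.

Lemma measurable_ring_ a b : measurable (ring_ a b).
Proof. by rewrite ring_E; apply: measurableD; exact: measurable_level. Qed.

Lemma nu_level a : 0 <= a <= 1 -> nu (level a) = a%:E.
Proof.
move=> /andP[]; rewrite le_eqVlt => /predU1P[<- _|a0].
  rewrite (_ : level 0 = set0) ?measure0//; apply/seteqP; split=> w //.
  rewrite /level /= => /lt_geF/negbT/negP; apply.
  by have /andP[] := alpha0_01 g_cont dg1_cvg A3 (modulus_ge0 w).
rewrite le_eqVlt => /predU1P[->|a1].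
  have -> : level 1 = [set w | modulus w < rad1 g].
    apply/seteqP; split=> w; rewrite /level /=.
      rewrite ltNge => /negP w1; rewrite ltNge; apply/negP => wr; apply: w1.
      by rewrite (alpha0_ge_rad1 g_cont dg1_cvg A3).
    move=> /(lt_rad1 g_cont dg1_cvg A3)[b b01 wb].
    rewrite -(alpha0_lt g_cont dg1_cvg A3) ?modulus_ge0// in wb.
    by rewrite (lt_trans wb)//; case/andP: b01.
  have [_ ->] := nuP; last exact: rad1_gt0.
  by rewrite (alpha0_ge_rad1 g_cont dg1_cvg A3).
have a01 : 0 < a < 1 by rewrite a0.
have -> : level a = [set w | modulus w < expR (- derive1 g a)].
  by apply/seteqP; split=> w; rewrite /level /= (alpha0_lt g_cont dg1_cvg A3) ?modulus_ge0.
have [_ ->] := nuP; last exact: expR_gt0.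
by rewrite (alpha0_s g_cont A3).
Qed.

Lemma nu_setC_level1 : nu (~` level 1) = 0%E.
Proof.
have n1 : nu (level 1) = 1%:E by rewrite nu_level// ler01 lexx.
by rewrite (probability_setC nu (measurable_level 1)) n1 subee.
Qed.

Lemma nu_ring_ a b : 0 <= a -> a <= b -> b <= 1 -> nu (ring_ a b) = (b - a)%:E.
Proof.
move=> a0 ab b1; rewrite ring_E measureD; [|exact: measurable_level..|].
  have -> : level b `&` level a = level a.
    by apply/setIidPr => w; rewrite /level /= => /lt_le_trans; exact.
  have a01 : 0 <= a <= 1 by rewrite a0 (le_trans ab).
  have b01 : 0 <= b <= 1 by rewrite b1 (le_trans a0).
  by rewrite EFinB; congr (_ - _)%E; exact: nu_level.
by apply: (le_lt_trans (probability_le1 _ _)); [exact: measurable_level|exact: ltry].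
Qed.

Lemma level1_rad1 w : level 1 w -> modulus w < rad1 g.
Proof.
rewrite /level /= => w1; rewrite ltNge; apply: contraTN w1 => wr.
by rewrite (alpha0_ge_rad1 g_cont dg1_cvg A3)// ltxx.
Qed.

Section fixed_point.
Variable w0 : R * R.
Let z := T w0.
Let L (w : R * R) := ln_dist z (T w).

Lemma measurable_L D : measurable_fun D L.
Proof.
apply: measurable_funTS.
exact: (measurableT_comp (measurable_ln_dist z) measurable_transport).
Qed.

Let k0 : 0 < 1 - t * c. Proof. by rewrite subr_gt0. Qed.

Let B := (1 + t * c) * (modulus w0 + rad1 g).

Let B0 : 0 <= B.
Proof.
by rewrite mulr_ge0 ?addr_ge0 ?modulus_ge0 ?mulr_ge0 ?(ltW (rad1_gt0 g)).
Qed.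

Lemma L_le w : level 1 w -> `|L w| <= (1 - t * c)^-1 * inv_dist w0 w + B.
Proof.
move=> /level1_rad1 w1; rewrite /L /ln_dist.
apply: (le_trans (normr_ln_le (modulus_ge0 _))); apply: lerD.
  have [ww|ww] := eqVneq w0 w; first by rewrite /z /inv_dist ww !subrr modulus0 invr0 mulr0.
  rewrite /inv_dist -invfM lef_pV2 ?posrE.
  - exact: (transport_expand c0 t0 h0 hL).
  - rewrite modulus_gt0 subr_eq0; apply: contra_neq ww.
    exact: (transport_inj c0 t0 tc h0 hL).
  - by rewrite mulr_gt0// modulus_gt0 subr_eq0.
apply: (le_trans (transport_lip c0 t0 h0 hL w0 w)).
rewrite ler_wpM2l ?addr_ge0 ?mulr_ge0//.
by apply: (le_trans (le_modulusD _ _)); rewrite modulusN lerD2l ltW.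
Qed.

Let M := 108 * c.
Let M0 : 0 <= M. Proof. by rewrite mulr_ge0. Qed.
Let muD y (r : R) : 0 < r -> (nu (disc y r) <= (M * r ^+ 2)%:E)%E.
Proof. by move=> r0; exact: (nu_disc_le c0 h0 hL al0 nuP). Qed.

Lemma integrable_bound D : measurable D ->
  nu.-integrable D (fun w => ((1 - t * c)^-1 * inv_dist w0 w + B)%:E).
Proof.
move=> mD.
have -> : (fun w => ((1 - t * c)^-1 * inv_dist w0 w + B)%:E) =
    (fun w => ((1 - t * c)^-1)%:E * (inv_dist w0 w)%:E + B%:E)%E by [].
apply: integrableD => //; last by apply: finite_measure_integrable_cst.
apply: integrableZl => //.
exact: integrableS (integrable_inv_dist M0 muD w0).
Qed.

Lemma integrable_L : nu.-integrable setT (EFin \o L).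
Proof.
have mN : measurable (~` level 1) by apply: measurableC; exact: measurable_level.
have N0 := nu_setC_level1.
have mL D : measurable_fun D (EFin \o L) by apply/measurable_EFinP; exact: measurable_L.
apply/(negligible_integrable mN measurableT (mL _) N0).
rewrite setTD setCK.
apply: le_integrable (integrable_bound (measurable_level 1)) => //.
  exact: measurable_level.
by move=> w w1; rewrite /= lee_fin (le_trans (L_le w1))// ler_norm.
Qed.

Let iL D : measurable D -> nu.-integrable D (EFin \o L).
Proof. by move=> mD; exact: integrableS integrable_L. Qed.

Definition level_integral a : R := \int[nu]_(w in level a) L w.

Lemma level_integral_diff a b : a <= b ->
  level_integral b - level_integral a = \int[nu]_(w in ring_ a b) L w.
Proof.
move=> ab; have E : level b = level a `|` ring_ a b.
  rewrite ring_E setDE setUIr setUv setIT; apply/esym/setUidPr => w.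
  by rewrite /level /= => /lt_le_trans; exact.
rewrite /level_integral E Rintegral_setU.
- by rewrite addrAC subrr add0r.
- exact: measurable_level.
- exact: measurable_ring_.
- by rewrite -E; apply: iL; exact: measurable_level.
- by apply/disj_setPS => w [/= wa]; rewrite ring_E => -[_].
Qed.

Lemma level_integral0 : level_integral 0 = 0.
Proof.
rewrite /level_integral (_ : level 0 = set0) ?Rintegral_set0//.
apply/seteqP; split=> w //; rewrite /level /= => /lt_geF/negbT/negP; apply.
by have /andP[] := alpha0_01 g_cont dg1_cvg A3 (modulus_ge0 w).
Qed.

Lemma level_integral1 : \int[nu]_w L w = level_integral 1.
Proof.
have mN : measurable (~` level 1) by apply: measurableC; exact: measurable_level.
rewrite /level_integral /Rintegral (negligible_integral mN) ?setTD ?setCK//.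
  exact: integrable_L.
exact: nu_setC_level1.
Qed.

(** The choice [r = sqrt (b - a)] in [integral_inv_dist_le] balances [4 M r] against [nu A / r]. It
    gives continuity at the levels where no derivative is computed: 0, 1 and that of [w0]. *)
Lemma level_integral_sqrt a b : 0 <= a -> a <= b -> b <= 1 ->
  `|level_integral b - level_integral a| <=
    ((1 - t * c)^-1 * (4 * M + 1) + B) * Num.sqrt (b - a).
Proof.
move=> a0; rewrite le_eqVlt => /predU1P[->|ab] b1; first by rewrite !subrr normr0 sqrtr0 mulr0.
have r0 : 0 < Num.sqrt (b - a) by rewrite sqrtr_gt0 subr_gt0.
have rr : Num.sqrt (b - a) ^+ 2 = b - a by rewrite sqr_sqrtr// subr_ge0 ltW.
have mR := measurable_ring_ a b.
rewrite level_integral_diff ?(ltW ab)//.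
apply: (le_trans (le_normr_Rintegral mR (iL mR))).
apply: (@le_trans _ _ (\int[nu]_(w in ring_ a b) ((1 - t * c)^-1 * inv_dist w0 w + B))).
  apply: le_Rintegral => //; first by apply/integrable_norm; exact: iL.
    exact: integrable_bound.
  move=> w /andP[_ wb]; apply: L_le; rewrite /level /=; exact: lt_le_trans b1.
have iI : nu.-integrable (ring_ a b) (EFin \o inv_dist w0).
  by apply: integrableS (integrable_inv_dist M0 muD w0).
rewrite RintegralD//; last 2 first.
  by have := integrableZl mR (1 - t * c)^-1 iI; apply: eq_integrable.
  by apply: finite_measure_integrable_cst.
have nR := nu_ring_ a0 (ltW ab) b1.
have -> : \int[nu]_(x in ring_ a b) cst B x = B * (b - a).
  by rewrite Rintegral_cst//; congr (_ * _); exact: (congr1 fine nR).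
rewrite RintegralZl// mulrDl -mulrA lerD//.
  rewrite ler_wpM2l ?invr_ge0 ?(ltW k0)//.
  have := integral_inv_dist_le M0 muD w0 r0 mR; rewrite nu_ring_ ?(ltW ab)//.
  rewrite /Rintegral -lee_fin fineK ?integrable_fin_num// => /le_trans; apply.
  have -> : (4 * M + 1) * Num.sqrt (b - a) =
      4 * M * Num.sqrt (b - a) + (Num.sqrt (b - a))^-1 * (b - a).
    by move: r0 rr; move: (Num.sqrt (b - a)) => q; move: (b - a) => x q0 <-; field; rewrite gt_eqF.
  by [].
rewrite ler_wpM2l// -{1}rr expr2 ler_piMr ?(ltW r0)//.
by rewrite -sqrtr1 ler_sqrt// lerBlDr (le_trans b1)// lerDl.
Qed.

End fixed_point.
End level_sets.

(** * Derivatives and continuity from bounds on increments *)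

Section derivative_criteria.
Context {R : realType}.

Lemma is_derive_littleo (f : R -> R) (x l : R) :
  (forall d : R, 0 < d -> exists2 e : R, 0 < e & forall y, `|y - x| < e ->
     `|f y - f x - (y - x) * l| <= d * `|y - x|) ->
  is_derive x 1 f l.
Proof.
move=> fC; apply/is_derive1_caratheodory.
exists (fun y => if y == x then l else (f y - f x) / (y - x)); split.
- by move=> y; case: eqVneq => [->|yx]; rewrite ?subrr ?mulr0// divfK// subr_eq0.
- apply/cvgrPdist_le => d d0; rewrite /= eqxx.
  have [e e0 fe] := fC d d0; near=> y.
  case: eqVneq => [_|yx]; first by rewrite subrr normr0 ltW.
  have yx0 : 0 < `|y - x| by rewrite normr_gt0 subr_eq0.
  have ye : `|y - x| < e by near: y; exists e => //= u; rewrite /= distrC.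
  rewrite distrC (_ : _ - l = (f y - f x - (y - x) * l) / (y - x)); last by field; rewrite subr_eq0.
  by rewrite normrM normfV ler_pdivrMr//; exact: fe.
- by rewrite eqxx.
Unshelve. all: by end_near. Qed.

(** The fundamental theorem of calculus for an [F] known only through its increments: these are
    squeezed between the bounds of the continuous function [lam]. *)
Lemma is_derive_slope (F lam : R -> R) (x e : R) : 0 < e ->
  {for x, continuous lam} ->
  (forall a b K, x - e < a -> a < b -> b < x + e ->
    (forall y, a <= y <= b -> lam y <= K) -> F b - F a <= K * (b - a)) ->
  (forall a b K, x - e < a -> a < b -> b < x + e ->
    (forall y, a <= y <= b -> K <= lam y) -> K * (b - a) <= F b - F a) ->
  is_derive x 1 F (lam x).
Proof.
move=> e0 lc Fu Fl; apply: is_derive_littleo => d d0.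
have /cvgrPdist_le/(_ d d0)[e' /= e'0 le'] := lc.
exists (Num.min e e'); first by rewrite lt_min e0.
move=> y; rewrite lt_min => /andP[ye ye'].
have lb u : `|u - x| <= `|y - x| -> lam x - d <= lam u <= lam x + d.
  move=> uy; have := le' u; rewrite /= distrC => /(_ (le_lt_trans uy ye')).
  by rewrite ler_distlC.
have [yx|xy|->] := ltgtP y x; last by rewrite !subrr mul0r subrr normr0 mulr0.
- move: ye; rewrite ltr_distl => /andP[ye _].
  have xe : x < x + e by rewrite ltrDl.
  have B u : y <= u <= x -> lam x - d <= lam u <= lam x + d.
    move=> /andP[yu ux]; apply: lb; rewrite !ler0_norm ?subr_le0 ?(ltW yx)//.
    by rewrite lerN2 lerD2r.
  have := Fu _ _ (lam x + d) ye yx xe (fun u h => proj2 (andP (B u h))).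
  have := Fl _ _ (lam x - d) ye yx xe (fun u h => proj1 (andP (B u h))).
  rewrite (ltr0_norm (x := y - x)) ?subr_lt0// ler_norml.
  move: (F y) (F x) (lam x) => p q l h1 h2; clear - h1 h2; apply/andP; split; lra.
- move: ye; rewrite ltr_distl => /andP[_ ye].
  have xe : x - e < x by rewrite ltrBlDr ltrDl.
  have B u : x <= u <= y -> lam x - d <= lam u <= lam x + d.
    move=> /andP[xu uy]; apply: lb; rewrite !ger0_norm ?subr_ge0 ?(ltW xy)//.
    by rewrite lerD2r.
  have := Fu _ _ (lam x + d) xe xy ye (fun u h => proj2 (andP (B u h))).
  have := Fl _ _ (lam x - d) xe xy ye (fun u h => proj1 (andP (B u h))).
  rewrite (gtr0_norm (x := y - x)) ?subr_gt0// ler_norml.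
  move: (F y) (F x) (lam x) => p q l h1 h2; clear - h1 h2; apply/andP; split; lra.
Qed.

Lemma within_continuous_modulus (f : R -> R) (a b K : R) :
  (forall x y, a <= x -> x <= y -> y <= b -> `|f y - f x| <= K * Num.sqrt (y - x)) ->
  {within `[a, b], continuous f}.
Proof.
move=> fK; apply/subspace_continuousP => x; rewrite /= in_itv /= => /andP[ax xb].
apply/cvgrPdist_lt => d d0.
have K0 : 0 < `|K| + 1 by rewrite ltr_wpDl.
have dK : 0 < d / (`|K| + 1) by rewrite divr_gt0.
have dK2 : 0 < (d / (`|K| + 1)) ^+ 2 by rewrite exprn_gt0.
exists ((d / (`|K| + 1)) ^+ 2) => //= y xy; rewrite in_itv /= => /andP[ay yb].
have H : `|f x - f y| <= K * Num.sqrt `|x - y|.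
  have [h|/ltW h] := leP x y.
    by rewrite distrC [`|x - y|]distrC (ger0_norm (x := y - x)) ?subr_ge0//; exact: fK.
  by rewrite (ger0_norm (x := x - y)) ?subr_ge0//; exact: fK.
apply: (le_lt_trans H).
apply: (@le_lt_trans _ _ ((`|K| + 1) * Num.sqrt `|x - y|)).
  by rewrite ler_wpM2r ?sqrtr_ge0// (le_trans (ler_norm K))// lerDl.
rewrite mulrC -ltr_pdivlMr// -ltr_sqr ?nnegrE ?sqrtr_ge0 ?(ltW dK)//.
by rewrite sqr_sqrtr ?normr_ge0.
Qed.

Lemma exists_power_half (q e : R) : 0 <= q < 1 -> 0 < e ->
  exists N, [/\ (0 < N)%N, q ^+ N <= 2^-1 & 2 <= N%:R * e].
Proof.
move=> /andP[q0 q1] e0.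
have [N1 N10 qN] : exists2 N, (0 < N)%N & q ^+ N <= 2^-1.
  move: q0; rewrite le_eqVlt => /predU1P[<-|q0].
    by exists 1%N => //; rewrite expr1 invr_ge0.
  have [|N N0 h] := @exprn_ge2 _ q^-1; first by rewrite invf_gt1.
  exists N => //; move: h; rewrite exprVn -[2]invrK lef_pV2 ?posrE ?invr_gt0//.
    by rewrite invrK.
  by rewrite exprn_gt0.
(* The factor [k] pushes the exponent above [2 / e], and a multiple of [N1] keeps the power of [q]
   below one half. *)
pose k := (Num.truncn (2 / e)).+1.
exists (N1 * k)%N; split; first by rewrite muln_gt0 N10.
  rewrite exprM /k exprS; have h0 : 0 <= q ^+ N1 by rewrite exprn_ge0.
  rewrite (le_trans _ qN)// ler_piMr// exprn_ile1//.
  by rewrite (le_trans qN)// invf_le1 ?ler1n.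
rewrite -ler_pdivrMr//; have := truncnS_gt (2 / e); rewrite -/k => /ltW/le_trans; apply.
by rewrite ler_nat leq_pmull.
Qed.

End derivative_criteria.

Lemma ratio_up (R : realType) (x b r d : R) : 0 < x -> x <= b -> 0 < d -> d <= r - x ->
  x <= b / (b + d) * r.
Proof.
move=> x0 xb d0 dr; have bd : 0 < b + d by rewrite addr_gt0// (lt_le_trans x0).
rewrite mulrAC ler_pdivlMr//; nra.
Qed.

Lemma ratio_down (R : realType) (x b r d : R) : 0 < x -> x <= b -> 0 < d -> d <= x - r ->
  r <= (1 - d / b) * x.
Proof.
move=> x0 xb d0 dr; have b0 : 0 < b by rewrite (lt_le_trans x0).
rewrite mulrBl mul1r lerBrDr -lerBrDl mulrAC ler_pdivrMr//; nra.
Qed.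

Lemma max_lt1 (R : realType) (k q : R) : k < 1 -> q < 1 -> k <= Num.max k q < 1.
Proof. by move=> k1 q1; rewrite le_max lexx gt_max k1 q1. Qed.

(** * Differentiating the layer integrals *)

Section level_derivative.
Context {R : realType}.
Variable g : R -> R.
Hypothesis g_cont : {within `[0, 1], continuous g}.
Hypothesis dg1_cvg : cvg ((g 1 - g (1 - h)) / h @[h --> 0^'+]).
Hypothesis A3 : condA3 g.
Variables c t : R.
Hypothesis c0 : 0 <= c.
Hypothesis cP : forall r, rad0 g < r < rad1 g ->
  `|derive1 (fun r => alpha0 g r / r) r| <= c.
Hypothesis t0 : 0 <= t.
Hypothesis tc : t * c < 1.
Variable nu : probability (R * R)%type R.
Hypothesis nuP : nu0_spec g nu.
Variable w0 : R * R.
Local Notation T := (transport g t).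
Let h (r : R) := alpha0 g r / r.
Let hL := h_lip g_cont dg1_cvg A3 c0 cP.
Let h0 (r : R) : 0 <= r -> 0 <= h r.
Proof. exact: (h_ge0 g_cont dg1_cvg A3). Qed.
Let al0 : alpha0 g 0 = 0 := alpha0_0 g.
Let s (a : R) : R := expR (- derive1 g a).
Let rho (a : R) : R := normc (outer (t * a) (cplx (T w0))).
Let lam (a : R) : R := ln (Num.max (rho a) (s a)).
Let L (w : R * R) := ln_dist (T w0) (T w).
Let Q := level_integral g t nu w0.

Let s_gt0 a : 0 < s a. Proof. exact: expR_gt0. Qed.

Let tc_ge0 : 0 <= t * c. Proof. exact: mulr_ge0. Qed.

(** On the circle of radius [s x] the map [T] is [v + t x / v], and [T w0 = W1 + W2] with
    [W1 W2 = t x]: this is the situation of [sum_ln_joukowski]. The condition [t c <= q] bounds the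
    inner root when the outer one exceeds [s x], through [t x <= t c (s x)^2]. *)
Lemma sum_ln_transport N (q x : R) w : 0 < x < 1 -> modulus w = s x -> (0 < N)%N ->
  t * c <= q -> q ^+ N <= 2^-1 -> (rho x <= q * s x \/ s x <= q * rho x) ->
  `|\sum_(u <- unity_roots N) L (rot u w) - N%:R * lam x| <= 2.
Proof.
move=> x01 wx N0 kq qN H.
have q0 : 0 <= q by exact: le_trans kq.
have q1 := expr_le_half_lt1 N0 qN q0.
have as_ : alpha0 g (s x) = x := alpha0_s g_cont A3 x01.
have b0 : 0 <= t * x by rewrite mulr_ge0//; case/andP: x01 => /ltW.
have ts : t * x <= t * c * s x ^+ 2.
  by have := talpha_le t0 h0 hL al0 (ltW (s_gt0 x)); rewrite as_.
have w_0 : cplx w != 0 by rewrite cplx_eq0 -modulus_gt0 wx.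
rewrite /lam /rho; set W := outer (t * x) (cplx (T w0)).
have WM := outerM (cplx (T w0)) b0; have Wge := outer_ge (cplx (T w0)) b0.
rewrite -/W in WM Wge.
have W2q : normc (cplx (T w0) - W) <= q * normc (cplx w).
  have -> : normc (cplx w) = s x by [].
  have E2 : normc W * normc (cplx (T w0) - W) = t * x.
    by rewrite -ComplexField.Normc.normcM WM normcR ger0_norm.
  case: H => H.
    apply: le_trans H; rewrite /rho -/W.
    have [W0|W0] := eqVneq W 0.
      have [_ Tw0] := outer_eq0 b0 W0.
      by rewrite W0 Tw0 subr0.
    by rewrite -(ler_pM2l (x := normc W)) ?normc_gt0// E2 -expr2.
  have r0 : 0 < rho x.
    rewrite ltNge; apply/negP => r0; move: (s_gt0 x); apply/negP; rewrite -leNgt.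
    by apply: (le_trans H); rewrite mulr_ge0_le0.
  rewrite -(ler_pM2l r0) /rho -/W E2 (le_trans ts)//.
  have -> : normc W * (q * s x) = q * (normc W * s x) by rewrite mulrCA.
  apply: ler_pM => //; first by rewrite sqr_ge0.
  rewrite expr2; apply: ler_wpM2r; first exact: (ltW (s_gt0 x)).
  apply: (le_trans H); rewrite -[X in _ <= X]mul1r; apply: ler_wpM2r; first exact: ltW r0.
  exact: ltW q1.
have := @sum_ln_joukowski _ N W (cplx (T w0) - W) (cplx w) q N0 q0 qN w_0 W2q.
have -> : normc (cplx w) = s x by [].
move=> /(_ H); congr (`| _ - _ | <= _); apply: eq_big_seq => u uN.
have u1 := normc_unity_root N0 uN.
have u0 : u != 0 by rewrite -normc_gt0 u1.
rewrite WM addrCA subrr addr0 /L /ln_dist /modulus cplxB; congr (ln (normc _)).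
rewrite [transport g t (rot u w)]/transport -[rot u w == 0]cplx_eq0 cplx_rot mulf_eq0.
rewrite (negPf u0) (negPf w_0) planeK modulus_rot// wx as_ opprD addrA; congr (_ - _ / _).
by rewrite rmorphM.
Qed.

(** Away from the circle of [w0], [outer_dist] separates [rho x] from [s x] by a fixed [d] on the
    whole interval; since [s x <= s b], this difference becomes a ratio below 1. *)
Lemma modulus_ratio a b : 0 < a -> a < b -> b < 1 -> (s b < modulus w0 \/ modulus w0 < s a) ->
  exists2 q : R, t * c <= q < 1 & forall x, a <= x <= b ->
    rho x <= q * s x \/ s x <= q * rho x.
Proof.
move=> a0 ab b1 H.
have k0 : 0 < (1 - t * c) / 2 by rewrite divr_gt0// subr_gt0.
have sx x : a <= x <= b -> [/\ 0 < x < 1, s a <= s x & s x <= s b].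
  move=> /andP[ax xb]; split.
  - by rewrite (lt_le_trans a0 ax) (le_lt_trans xb b1).
  - exact: (s_ndecr A3 a0 ax (le_lt_trans xb b1)).
  - exact: (s_ndecr A3 (lt_le_trans a0 ax) xb b1).
have D x : 0 < x < 1 -> (1 - t * c) / 2 * `|modulus w0 - s x| <= `|rho x - s x|.
  move=> x01; have := outer_dist c0 t0 tc h0 hL al0 w0 (s_gt0 x).
  by rewrite (alpha0_s g_cont A3 x01).
case: H => H.
  have [d d0 dH] : exists2 d : R, 0 < d & forall x, a <= x <= b -> d <= rho x - s x.
    exists ((1 - t * c) / 2 * (modulus w0 - s b)); first by rewrite mulr_gt0// subr_gt0.
    move=> x axb; have [x01 sa sb] := sx x axb.
    have sw : s x < modulus w0 by apply: le_lt_trans H.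
    have rs : s x < rho x.
      have := outer_gt c0 t0 tc h0 hL al0 (s_gt0 x) sw.
      by rewrite (alpha0_s g_cont A3 x01).
    have := D x x01; rewrite (gtr0_norm (x := rho x - s x)); last by rewrite subr_gt0.
    rewrite (gtr0_norm (x := modulus w0 - s x)); last by rewrite subr_gt0.
    apply: le_trans; apply: ler_wpM2l; first exact: ltW k0.
    rewrite lerD2l lerN2; exact: sb.
  have sd : 0 < s b + d by apply: addr_gt0.
  exists (Num.max (t * c) (s b / (s b + d))).
    apply: (max_lt1 tc); rewrite ltr_pdivrMr; last exact: sd.
    rewrite mul1r ltrDl; exact: d0.
  move=> x axb; have [x01 sa sb] := sx x axb; right.
  apply: (le_trans (ratio_up (s_gt0 x) sb d0 (dH x axb))).
  apply: ler_wpM2r; first exact: normc_ge0.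
  by rewrite le_max lexx orbT.
have [d d0 dH] : exists2 d : R, 0 < d & forall x, a <= x <= b -> d <= s x - rho x.
  exists ((1 - t * c) / 2 * (s a - modulus w0)); first by rewrite mulr_gt0// subr_gt0.
  move=> x axb; have [x01 sa sb] := sx x axb.
  have sw : modulus w0 < s x by apply: lt_le_trans sa.
  have rs : rho x < s x.
    have := outer_lt t0 tc h0 hL al0 (s_gt0 x) sw.
    by rewrite (alpha0_s g_cont A3 x01).
  have := D x x01; rewrite (ltr0_norm (x := rho x - s x)); last by rewrite subr_lt0.
  rewrite opprB (ltr0_norm (x := modulus w0 - s x)); last by rewrite subr_lt0.
  rewrite opprB; apply: le_trans; apply: ler_wpM2l; first exact: ltW k0.
  rewrite lerD2r; exact: sa.
exists (Num.max (t * c) (1 - d / s b)).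
  apply: (max_lt1 tc); rewrite ltrBlDr ltrDl; exact: (divr_gt0 d0 (s_gt0 b)).
move=> x axb; have [x01 sa sb] := sx x axb; left.
apply: (le_trans (ratio_down (s_gt0 x) sb d0 (dH x axb))).
apply: ler_wpM2r; first exact: ltW (s_gt0 x).
by rewrite le_max lexx orbT.
Qed.

(** The mean of [L] over the roots of unity is within [2 / N] of [lam], and the ring has mass
    [b - a]. The ring must avoid the circle of [w0], so that one ratio [q], hence one [N], serves
    all its circles. *)
Lemma level_integral_bounds a b : 0 < a -> a < b -> b < 1 ->
  (s b < modulus w0 \/ modulus w0 < s a) ->
  (forall K, (forall x, a <= x <= b -> lam x <= K) -> Q b - Q a <= K * (b - a)) /\
  (forall K, (forall x, a <= x <= b -> K <= lam x) -> K * (b - a) <= Q b - Q a).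
Proof.
move=> a0 ab b1 H; have [q /andP[kq q1] qP] := modulus_ratio a0 ab b1 H.
have q01 : 0 <= q < 1 by rewrite q1 (le_trans tc_ge0).
have nuR := (proj1 nuP).
have mR := measurable_ring_ g_cont dg1_cvg A3 c0 cP a b.
have nR := nu_ring_ g_cont dg1_cvg A3 c0 cP nuP (ltW a0) (ltW ab) (ltW b1).
have iL : nu.-integrable (ring_ g a b) (EFin \o L).
  exact: integrableS (integrable_L g_cont dg1_cvg A3 c0 cP t0 tc nuP w0).
have QE : Q b - Q a = \int[nu]_(w in ring_ g a b) L w.
  exact: (level_integral_diff g_cont dg1_cvg A3 c0 cP t0 tc nuP w0 (ltW ab)).
have st : rot_stable (ring_ g a b) := modulus_stable [set r | a <= alpha0 g r < b].
have avg N w : (0 < N)%N -> q ^+ N <= 2^-1 -> ring_ g a b w -> exists2 x, a <= x <= b &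
    `|\sum_(u <- unity_roots N) L (rot u w) - N%:R * lam x| <= 2.
  move=> N0 qN /andP[aw wb]; exists (alpha0 g (modulus w)); first by rewrite aw ltW.
  have x01 : 0 < alpha0 g (modulus w) < 1 by rewrite (lt_le_trans a0) ?(lt_trans wb).
  apply: (@sum_ln_transport N q) => //; last by apply: qP; rewrite aw ltW.
  have [[_ e]|[y y01 [<- e]]|[_ e]] := alpha0_cases g_cont dg1_cvg A3 (modulus_ge0 w).
  - by move: x01; rewrite e ltxx.
  - by rewrite (alpha0_s g_cont A3 y01).
  - by move: x01; rewrite e ltxx andbF.
have ba0 : 0 < b - a by rewrite subr_gt0.
have up (f : R * R -> R) (K : R) : nu.-integrable (ring_ g a b) (EFin \o f) ->
    (forall e N w, 0 < e -> (0 < N)%N -> q ^+ N <= 2^-1 -> 2 <= N%:R * e -> ring_ g a b w ->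
      \sum_(u <- unity_roots N) f (rot u w) <= N%:R * (K + e)) ->
    \int[nu]_(w in ring_ g a b) f w <= K * (b - a).
  move=> fi fK; apply/ler_addgt0Pr => e e0.
  have [N [N0 qN Ne]] := exists_power_half q01 (divr_gt0 e0 ba0).
  have := le_integral_average nuR N0 mR st fi
    (fun w => fK _ _ w (divr_gt0 e0 ba0) N0 qN Ne).
  rewrite nR -EFinM mulrDl divfK ?gt_eqF// -lee_fin /Rintegral fineK//.
  exact: integrable_fin_num.
rewrite QE; split=> K KP.
  apply: up => // e N w e0 N0 qN Ne Sw; have [x axb] := avg N w N0 qN Sw.
  rewrite ler_norml => /andP[_]; have lK := KP x axb.
  rewrite lerBlDl => /le_trans; apply; rewrite mulrDr; apply: lerD; last exact: Ne.
  by apply: ler_wpM2l.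
have iL' : nu.-integrable (ring_ g a b) (EFin \o (fun w => - L w)).
  by have := integrableN iL; apply: eq_integrable.
have := up _ (- K) iL'; rewrite mulNr.
have -> : \int[nu]_(w in ring_ g a b) - L w = - \int[nu]_(w in ring_ g a b) L w.
  rewrite -[RHS]mulN1r -RintegralZl//; apply: eq_Rintegral => w _; by rewrite mulN1r.
rewrite lerN2; apply => e N w e0 N0 qN Ne Sw; have [x axb] := avg N w N0 qN Sw.
rewrite ler_norml => /andP[+ _]; have lK := KP x axb.
rewrite lerBrDl sumrN lerNl; apply: le_trans.
rewrite mulrDr mulrN opprD opprK; apply: lerD; last by rewrite lerN2; exact: Ne.
by apply: ler_wpM2l.
Qed.

Lemma outer_low x : 0 < x < 1 -> x < alpha0 g (modulus w0) ->
  s x < rho x /\ t * x < rho x ^+ 2.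
Proof.
move=> x01 xw.
have sw : s x < modulus w0.
  by rewrite -(lt_alpha0 g_cont dg1_cvg A3 x01 (modulus_ge0 w0)).
have as_ : alpha0 g (s x) = x := alpha0_s g_cont A3 x01.
have := outer_gt c0 t0 tc h0 hL al0 (s_gt0 x) sw; rewrite as_ => sr; split=> //.
have := talpha_lt t0 tc h0 hL al0 (s_gt0 x); rewrite as_ => /lt_trans; apply.
by rewrite ltr_sqr ?nnegrE ?normc_ge0 ?(ltW (s_gt0 x)).
Qed.

Lemma level_derive_low x : 0 < x < 1 -> x < alpha0 g (modulus w0) ->
  is_derive x 1 Q (ln (rho x)).
Proof.
move=> x01 xw; have /andP[x0 x1] := x01.
have /andP[w00 w01] := alpha0_01 g_cont dg1_cvg A3 (modulus_ge0 w0).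
have [sx tW] := outer_low x01 xw.
have rx : 0 < rho x := lt_trans (s_gt0 x) sx.
have rc : {for x, continuous rho}.
  have [K [e' [K0 e'0 H]]] := outer_lip t0 x0 tW.
  apply: (@continuous_lip _ _ _ K e' e'0) => y ye'; have [_] := H y ye'.
  apply: le_trans; rewrite ler_norml; apply/andP; split.
    rewrite lerNl opprB lerBlDr -normcN opprB; apply: le_trans (le_normcD _ _).
    by rewrite subrK.
  rewrite lerBlDr; apply: le_trans (le_normcD _ _).
  by rewrite subrK.
have lc : {for x, continuous (fun y => ln (rho y))}.
  exact: (@continuous_comp _ _ _ rho (@ln R) x rc (continuous_ln rx)).
have [e e0 eP] : exists2 e : R, 0 < e & forall a b, x - e < a -> a < b -> b < x + e ->
    [/\ 0 < a, b < alpha0 g (modulus w0), b < 1 & s b < modulus w0].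
  exists (Num.min x (alpha0 g (modulus w0) - x)); first by rewrite lt_min x0 subr_gt0.
  move=> a b xa ab bx; have a0 : 0 < a.
    by apply: le_lt_trans xa; rewrite subr_ge0 ge_min lexx.
  have bw : b < alpha0 g (modulus w0).
    by apply: lt_le_trans bx _; rewrite -lerBrDl ge_min lexx orbT.
  have b1 : b < 1 by apply: lt_le_trans w01.
  split=> //; rewrite -(lt_alpha0 g_cont dg1_cvg A3 _ (modulus_ge0 w0))//.
  by rewrite (lt_trans a0 ab).
have lamE a b y : x - e < a -> a < b -> b < x + e -> a <= y <= b -> lam y = ln (rho y).
  move=> xa ab bx /andP[ay yb]; have [a0 bw b1 _] := eP _ _ xa ab bx.
  have y01 : 0 < y < 1 by rewrite (lt_le_trans a0 ay) (le_lt_trans yb b1).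
  have [/ltW sy _] := outer_low y01 (le_lt_trans yb bw).
  by rewrite /lam max_l.
apply: (is_derive_slope e0 lc) => a b K xa ab bx KP; have [a0 bw b1 sb] := eP _ _ xa ab bx;
  have [B1 B2] := level_integral_bounds a0 ab b1 (or_introl sb).
- by apply: B1 => y ayb; rewrite (lamE _ _ _ xa ab bx ayb); exact: KP.
- by apply: B2 => y ayb; rewrite (lamE _ _ _ xa ab bx ayb); exact: KP.
Qed.

Lemma level_derive_high x : 0 < x < 1 -> alpha0 g (modulus w0) < x ->
  is_derive x 1 Q (- derive1 g x).
Proof.
move=> x01 wx; have /andP[x0 x1] := x01.
have /andP[w00 w01] := alpha0_01 g_cont dg1_cvg A3 (modulus_ge0 w0).
have lc : {for x, continuous (fun y => - derive1 g y)}.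
  by apply: cvgN; exact: (dg_cont A3 x01).
have [e e0 eP] : exists2 e : R, 0 < e & forall a b, x - e < a -> a < b -> b < x + e ->
    [/\ 0 < a, alpha0 g (modulus w0) < a, b < 1 & modulus w0 < s a].
  exists (Num.min (x - alpha0 g (modulus w0)) (1 - x)); first by rewrite lt_min !subr_gt0 wx.
  move=> a b xa ab bx; have b1 : b < 1.
    by apply: lt_le_trans bx _; rewrite -lerBrDl ge_min lexx orbT.
  have wa : alpha0 g (modulus w0) < a.
    by apply: le_lt_trans xa; rewrite lerBrDr -lerBrDl ge_min lexx.
  have a0 : 0 < a by apply: le_lt_trans wa.
  split=> //; rewrite -(alpha0_lt g_cont dg1_cvg A3 _ (modulus_ge0 w0))//.
  by rewrite a0 (lt_trans ab b1).
have lamE a b y : x - e < a -> a < b -> b < x + e -> a <= y <= b -> lam y = - derive1 g y.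
  move=> xa ab bx /andP[ay yb]; have [a0 wa b1 _] := eP _ _ xa ab bx.
  have y01 : 0 < y < 1 by rewrite (lt_le_trans a0 ay) (le_lt_trans yb b1).
  have sw : modulus w0 < s y.
    by rewrite -(alpha0_lt g_cont dg1_cvg A3 y01 (modulus_ge0 w0)) (lt_le_trans wa ay).
  have := outer_lt t0 tc h0 hL al0 (s_gt0 y) sw.
  rewrite (alpha0_s g_cont A3 y01) => /ltW rs.
  by rewrite /lam max_r// /s expRK.
apply: (is_derive_slope e0 lc) => a b K xa ab bx KP; have [a0 wa b1 sa] := eP _ _ xa ab bx;
  have [B1 B2] := level_integral_bounds a0 ab b1 (or_intror sa).
- by apply: B1 => y ayb; rewrite (lamE _ _ _ xa ab bx ayb); exact: KP.
- by apply: B2 => y ayb; rewrite (lamE _ _ _ xa ab bx ayb); exact: KP.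
Qed.

(** [Q - phi] has derivative 0 below the level of [w0], where [lam = ln rho], and [Q + g] has
    derivative 0 above it, where [lam = - g']. Joining the two constants at that level gives
    [Q 1]. *)
Lemma integral_ln_transport : \int[nu]_w L w = pot g t w0.
Proof.
have /andP[w00 w01] := alpha0_01 g_cont dg1_cvg A3 (modulus_ge0 w0).
set al := alpha0 g (modulus w0) in w00 w01.
have Qc : {within `[0, 1], continuous Q}.
  apply: within_continuous_modulus => x y x0 xy y1.
  exact: (level_integral_sqrt g_cont dg1_cvg A3 c0 cP t0 tc nuP w0 x0 xy y1).
have const (f : R -> R) (x y : R) : x <= y -> {within `[x, y], continuous f} ->
    (forall a, x < a < y -> is_derive a 1 f 0) -> f y = f x.
  move=> xy fc fd; apply/eqP; rewrite eq_le; apply/andP; split.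
    rewrite -subr_le0 -(mul0r (y - x)); apply: (mvt_except_le (e := x)) => // a /fd da _.
    by exists 0.
  rewrite -subr_le0 -(mul0r (y - x)).
  have := @mvt_except_le _ (fun a => - f a) x y x 0 xy; rewrite opprK addrC; apply.
    by move=> p; apply: cvgN; exact: fc.
  by move=> a /fd da _; exists 0 => //; rewrite -oppr0; exact: is_deriveN.
have E1 : Q al - phi t (cplx (T w0)) al = Q 0 - phi t (cplx (T w0)) 0.
  apply: (const (fun a => Q a - phi t (cplx (T w0)) a)) => //.
    apply: (@within_continuousB _ _ _ _ Q (phi t (cplx (T w0)))).
      exact: (within_sub Qc (lexx _) w01).
    by apply: continuous_subspaceT; exact: phi_continuous.
  move=> a /andP[a0 aw]; have a01 : 0 < a < 1 by rewrite a0 (lt_le_trans aw).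
  have [_ tW] := outer_low a01 aw.
  rewrite -(subrr (ln (rho a))).
  exact: (is_deriveB (level_derive_low a01 aw) (phi_derive t0 a0 tW)).
have E2 : Q 1 + g 1 = Q al + g al.
  apply: (const (fun a => Q a + g a)) => //.
    apply: (@within_continuousD _ _ _ _ Q g).
      exact: (within_sub Qc w00 (lexx _)).
    exact: (within_sub g_cont w00 (lexx _)).
  move=> a /andP[aw a1]; have a01 : 0 < a < 1 by rewrite a1 (le_lt_trans w00).
  rewrite -(addNr (derive1 g a)).
  exact: (is_deriveD (level_derive_high a01 aw) (dgP A3 a01)).
have Q0 : Q 0 = 0 := level_integral0 g_cont dg1_cvg A3 t nu w0.
have Q1 : \int[nu]_w L w = Q 1.
  exact: (level_integral1 g_cont dg1_cvg A3 c0 cP t0 tc nuP w0).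
have p0 : phi t (cplx (T w0)) 0 = 0.
  by rewrite /phi expr0n/= mulr0 !mul0r addr0.
rewrite (potE g_cont dg1_cvg A3 c0 cP t0 tc) /obj Q1 -/al.
move: E1 E2; rewrite Q0 p0 subrr; move: (phi _ _ _) (Q al) (Q 1) (g al) (g 1).
by move=> p q q1 gal g1 E1 E2; lra.
Qed.

End level_derivative.

Lemma abs_sandwich (R : realDomainType) (p q u v X Y : R) : u <= p -> p <= v ->
  q - u <= Y -> v - q <= X -> 0 <= X -> 0 <= Y -> `|p - q| <= X + Y.
Proof. by move=> *; rewrite ler_norml; apply/andP; split; lra. Qed.

(** * Quadratic expansion of the potential *)

Section radial_potential.
Context {R : realType}.
Variable g : R -> R.
Hypothesis g_cont : {within `[0, 1], continuous g}.
Hypothesis dg1_cvg : cvg ((g 1 - g (1 - h)) / h @[h --> 0^'+]).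
Hypothesis A3 : condA3 g.
Variables c : R.
Hypothesis c0 : 0 <= c.
Hypothesis cP : forall r, rad0 g < r < rad1 g ->
  `|derive1 (fun r => alpha0 g r / r) r| <= c.
Let h (r : R) := alpha0 g r / r.
Let hL := h_lip g_cont dg1_cvg A3 c0 cP.
Let h0 (r : R) : 0 <= r -> 0 <= h r.
Proof. exact: (h_ge0 g_cont dg1_cvg A3). Qed.
Let al0 : alpha0 g 0 = 0 := alpha0_0 g.

(** Up to [- g 1], the radial potential of [nu_0]: the Legendre transform of [- g] in the variable
    [ln r]. *)
Definition V (r : R) : R := g (alpha0 g r) + alpha0 g r * ln r.

Lemma V_ge (r a : R) : 0 < r -> 0 <= a <= 1 -> g a + a * ln r <= V r.
Proof.
move=> r0 a01; have [[_ H] _] := alpha0_max g_cont dg1_cvg A3 r0.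
by have := H a a01; rewrite lee_fin.
Qed.

(** [alpha0 g x] is a subgradient of [V] as a convex function of [ln x]. *)
Lemma V_diff (x y : R) : 0 < x -> 0 < y -> alpha0 g x * (ln y - ln x) <= V y - V x.
Proof.
move=> x0 y0; have := V_ge y0 (alpha0_01 g_cont dg1_cvg A3 (ltW x0)).
rewrite /V mulrBr; lra.
Qed.

(** [V_diff] with [r] and [y] in both orders squeezes the increment between multiples of
    [ln y - ln r] by [alpha0 g r] and [alpha0 g y]. No derivative of [alpha0] enters, so [rad0] and
    [rad1] are ordinary points here. *)
Lemma V_derive (r : R) : 0 < r -> is_derive r 1 V (h r).
Proof.
move=> r0; have r20 : 0 < r / 2 by rewrite divr_gt0.
apply: (@is_derive_quadratic _ _ _ _ (c * (r + 2 * r) / r +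
  alpha0 g r / (r * (r / 2))) _ r20) => y yr.
have [y1 y2] : r / 2 <= y /\ y <= 2 * r.
  by move: yr; rewrite ltr_norml => /andP[h1 h2]; split; lra.
have y0 : 0 < y by exact: lt_le_trans y1.
have lo := V_diff r0 y0; have up := V_diff y0 r0.
have /andP[ar0 _] := alpha0_01 g_cont dg1_cvg A3 (ltW r0).
have /andP[ay0 _] := alpha0_01 g_cont dg1_cvg A3 (ltW y0).
have ad : `|alpha0 g y - alpha0 g r| <= c * (r + 2 * r) * `|y - r|.
  have H (a b : R) : 0 <= a -> a <= b -> b <= 2 * r -> a <= r \/ b <= r ->
      `|alpha0 g b - alpha0 g a| <= c * (r + 2 * r) * (b - a).
    move=> a0' ab b2 abr; apply: (le_trans (alpha0_diff h0 hL al0 a0' ab)).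
    apply: ler_wpM2r; first by rewrite subr_ge0.
    by apply: ler_wpM2l => //; case: abr => ?; lra.
  have [ry|/ltW yr'] := leP r y.
    by rewrite (ger0_norm (x := y - r)) ?subr_ge0//; apply: H => //; [exact: ltW|left].
  rewrite distrC (ler0_norm (x := y - r)) ?subr_le0// opprB.
  by apply: H => //; [exact: ltW|lra|right].
have ly : ln y - ln r <= (y - r) / r.
  rewrite -ln_div ?posrE//; apply: (le_trans (ln_le_subr1 (divr_gt0 y0 r0))).
  by rewrite mulrBl divff ?gt_eqF.
have ly' : (y - r) / y <= ln y - ln r.
  rewrite -ln_div ?posrE//; apply: le_trans (ln_ge_1Binv (divr_gt0 y0 r0)).
  by rewrite invf_div mulrBl divff ?gt_eqF.
have A1 : alpha0 g r * ((y - r) / y) <= V y - V r.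
  by apply: le_trans lo; apply: ler_wpM2l.
have A2 : V y - V r <= alpha0 g y * ((y - r) / r).
  apply: (@le_trans _ _ (alpha0 g y * (ln y - ln r))); last by apply: ler_wpM2l.
  by move: up; rewrite !mulrBr; lra.
have d2 : 0 <= (y - r) ^+ 2 by exact: sqr_ge0.
have B2 : (alpha0 g y - alpha0 g r) * ((y - r) / r) <= c * (r + 2 * r) / r * (y - r) ^+ 2.
  apply: (le_trans (ler_norm _)); rewrite normrM [`|(y - r) / r|]normrM normfV (gtr0_norm r0).
  rewrite -(real_normK (num_real (y - r))).
  have -> : c * (r + 2 * r) / r * `|y - r| ^+ 2 = c * (r + 2 * r) * `|y - r| * (`|y - r| / r).
    by rewrite expr2; field; rewrite gt_eqF.
  by apply: ler_wpM2r => //; rewrite divr_ge0// ltW.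
have B1 : alpha0 g r * ((y - r) / r) - alpha0 g r * ((y - r) / y) <=
    alpha0 g r / (r * (r / 2)) * (y - r) ^+ 2.
  have -> : alpha0 g r * ((y - r) / r) - alpha0 g r * ((y - r) / y) =
      alpha0 g r * (y - r) ^+ 2 / (r * y) by field; rewrite !gt_eqF.
  rewrite [X in _ <= X]mulrAC; apply: ler_wpM2l; first by rewrite mulr_ge0.
  by rewrite lef_pV2 ?posrE ?mulr_gt0// ler_pM2l.
have C1 : 0 <= c * (r + 2 * r) / r * (y - r) ^+ 2.
  by rewrite mulr_ge0// divr_ge0 ?(ltW r0)// mulr_ge0// addr_ge0 ?mulr_ge0 ?(ltW r0).
have C2 : 0 <= alpha0 g r / (r * (r / 2)) * (y - r) ^+ 2.
  by rewrite mulr_ge0// divr_ge0// mulr_ge0 ?(ltW r0)// divr_ge0 ?(ltW r0).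
have E : (y - r) * h r = alpha0 g r * ((y - r) / r) by rewrite /h mulrCA mulrA.
rewrite E [X in _ <= X]mulrDl; rewrite mulrBl in B2.
exact: (abs_sandwich A1 A2 B1 B2 C1 C2).
Qed.

(** [alpha0 g r <= c r^2] absorbs the logarithm, and [g] is continuous at 0. *)
Lemma V_cont0 : {for (0 : R), continuous (fun r : R => V `|r|)}.
Proof.
have V0 : V `|0 : R| = g 0 by rewrite normr0 /V al0 mul0r addr0.
apply/cvgrPdist_lt => e e0; rewrite V0.
have e20 : 0 < e / 2 by rewrite divr_gt0.
have : \forall x \near within `[0, 1] (nbhs (0 : R)), `|g 0 - g x| < e / 2.
  have /subspace_continuousP/(_ 0) := g_cont; rewrite /= in_itv /= lexx ler01.
  by move=> /(_ isT)/cvgrPdist_lt/(_ _ e20).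
move=> [d /= d0 dP].
have c20 : 0 < 2 * c + 1 by rewrite ltr_wpDl ?mulr_ge0.
have ec0 : 0 < e / 2 / (2 * c + 1) by rewrite divr_gt0.
near=> r.
have r1 : `|r| < 1.
  by near: r; exists 1 => //= u; rewrite /= sub0r normrN.
have rc : `|r| * (c + 1) < d.
  rewrite -ltr_pdivlMr ?ltr_wpDl//; near: r.
  exists (d / (c + 1)); rewrite /= ?divr_gt0 ?ltr_wpDl// => u.
  by rewrite /= sub0r normrN.
have re : `|r| * (2 * c + 1) < e / 2.
  rewrite -ltr_pdivlMr; last exact: c20.
  near: r; exists (e / 2 / (2 * c + 1)); first exact: ec0.
  by move=> u; rewrite /= sub0r normrN.
have rr := normr_ge0 r.
have /andP[a0 a1] := alpha0_01 g_cont dg1_cvg A3 rr.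
have ac : alpha0 g `|r| <= c * `|r| ^+ 2.
  have -> : c * `|r| ^+ 2 = `|r| * (c * `|r|) by ring.
  rewrite (alpha0_h al0 rr); apply: ler_wpM2l => //.
  exact: (h_le h0 hL).
have r2 : `|r| ^+ 2 <= `|r| by rewrite expr2 ler_piMr// ltW.
have gr : `|g 0 - g (alpha0 g `|r|)| < e / 2.
  apply: dP; rewrite /= ?in_itv /= ?a0// sub0r normrN ger0_norm//.
  apply: le_lt_trans ac _; apply: le_lt_trans rc; rewrite [X in _ <= X]mulrC.
  by apply: ler_pM => //; rewrite ?sqr_ge0// lerDl.
have ar : `|alpha0 g `|r| * ln `|r| | <= `|r| * (2 * c).
  rewrite normrM (ger0_norm a0).
  have [-> | rn] := eqVneq `|r| 0; first by rewrite al0 !mul0r.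
  have r0 : 0 < `|r| by rewrite lt_neqAle eq_sym rn.
  apply: (@le_trans _ _ (c * `|r| ^+ 2 * (`|r|^-1 + `|r|))).
    by apply: ler_pM => //; exact: normr_ln_le.
  rewrite (_ : c * `|r| ^+ 2 * (`|r|^-1 + `|r|) = `|r| * (c * (1 + `|r| ^+ 2))); last by field.
  apply: ler_wpM2l => //; rewrite mulrC; apply: ler_wpM2r => //.
  by rewrite -[X in _ <= X]/(1 + 1 : R) lerD2l (le_trans r2)// ltW.
rewrite /V opprD addrA (le_lt_trans (ler_normB _ _))//.
have -> : e = e / 2 + e / 2 by field.
apply: ltrD => //; apply: le_lt_trans ar _; apply: le_lt_trans re.
by apply: ler_wpM2l => //; rewrite lerDl.
Unshelve. all: by end_near. Qed.

Lemma V_mvt (x y : R) : 0 <= x -> x < y -> exists2 u, x < u < y & V y - V x = h u * (y - x).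
Proof.
move=> x0 xy.
pose W (r : R) : R := V `|r|.
have WV r : 0 <= r -> W r = V r by move=> r0; rewrite /W ger0_norm.
have Wd (u : R) : 0 < u -> is_derive u 1 W (h u).
  move=> u0; have near_eq : \forall r \near u, V r = W r.
    by near=> r; rewrite WV//; apply: ltW; near: r; exact: lt_nbhsr.
  exact: (near_eq_is_derive near_eq (V_derive u0)).
have Wc : {within `[x, y], continuous W}.
  apply: continuous_in_subspaceT => u; rewrite inE /= in_itv /= => /andP[xu uy].
  have := le_trans x0 xu; rewrite le_eqVlt => /predU1P[<-|u0]; first exact: V_cont0.
  have du := Wd u u0; apply: differentiable_continuous; apply/derivable1_diffP.
  exact: ex_derive.
have Wd' u : u \in `]x, y[ -> is_derive u 1 W (h u).
  by rewrite in_itv /= => /andP[xu _]; apply: Wd; exact: le_lt_trans xu.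
have [u] := MVT xy Wd' Wc.
rewrite in_itv /= => uxy E; exists u => //; rewrite -E.
by rewrite -!WV// (le_trans x0 (ltW xy)).
Unshelve. all: by end_near. Qed.

Lemma V_quad (x y : R) : 0 <= x -> 0 <= y -> `|V y - V x - h x * (y - x)| <= c * (y - x) ^+ 2.
Proof.
move=> x0 y0; rewrite -(real_normK (num_real (y - x))).
have [xy|yx|->] := ltgtP x y; last by rewrite !subrr mulr0 subrr normr0 expr0n/= mulr0.
- have [u /andP[xu uy] ->] := V_mvt x0 xy.
  rewrite -mulrBl normrM expr2 mulrA; apply: ler_wpM2r => //.
  apply: (le_trans (hL (le_trans x0 (ltW xu)) x0)); apply: ler_wpM2l => //.
  rewrite !ger0_norm ?subr_ge0 ?(ltW xu) ?(ltW xy)// lerD2r; exact: ltW.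
- have [u /andP[yu ux] E] := V_mvt y0 yx.
  have -> : V y - V x - h x * (y - x) = (h u - h x) * (y - x).
    by rewrite mulrBl -[V y - V x]opprB E; ring.
  rewrite normrM expr2 mulrA; apply: ler_wpM2r => //.
  apply: (le_trans (hL (le_trans y0 (ltW yu)) x0)); apply: ler_wpM2l => //.
  rewrite !ler0_norm ?subr_le0 ?(ltW ux) ?(ltW yx)// lerN2 lerD2r; exact: ltW.
Qed.

Variable t : R.
Hypothesis t0 : 0 <= t.
Hypothesis tc : t * c < 1.
Local Notation T := (transport g t).
Local Notation H := (hvec g).

Definition re_mul (m v : R * R) : R := m.1 * v.1 - m.2 * v.2.

Lemma re_mulE m v : re_mul m v = complex.Re (cplx m * cplx v).
Proof. by case: m; case: v. Qed.

Lemma re_mul_le m v : `|re_mul m v| <= modulus m * modulus v.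
Proof. by rewrite re_mulE (le_trans (Re_le_normc _))// ComplexField.Normc.normcM. Qed.

Lemma pot_V w : pot g t w = V (modulus w) + t / 2 * re_mul (H w) (H w) - g 1.
Proof.
rewrite /pot /V re_mulE hvec_cplx; congr (_ + _ - _).
have -> : (alpha0 g (modulus w))%:C / cplx w * ((alpha0 g (modulus w))%:C / cplx w) =
    (alpha0 g (modulus w) ^+ 2)%:C * cplx w ^- 2.
  by rewrite mulrACA -invfM rmorphXn.
by rewrite ReZ; ring.
Qed.

(** The radial expansion leaves [k (|w| |v| - w.v)], where [k = h(|w|) / |w| <= c] and [w.v] is the
    scalar product; twice the bracket is [|v - w|^2 - (|v| - |w|)^2]. *)
Lemma V_quad_plane w v :
  `|V (modulus v) - V (modulus w) - re_mul (H w) (v - w)| <= 2 * c * modulus (v - w) ^+ 2.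
Proof.
have r0 := modulus_ge0 w; have q0 := modulus_ge0 v.
pose k := h (modulus w) / modulus w.
have k0 : 0 <= k by rewrite divr_ge0 ?h0.
have kc : k <= c.
  have [wz|wn] := eqVneq w 0; first by rewrite /k wz modulus0 invr0 mulr0.
  by rewrite ler_pdivrMr ?modulus_gt0//; exact: (h_le h0 hL).
have hk : h (modulus w) = k * modulus w.
  have [->|wn] := eqVneq w 0; first by rewrite modulus0 mulr0 /h invr0 mulr0.
  by rewrite divfK// modulus_eq0.
have E : re_mul (H w) (v - w) = k * (w.1 * v.1 + w.2 * v.2 - modulus w ^+ 2).
  by rewrite /re_mul /hvec /= -/h -/k sqr_modulus; ring.
have d1 : `|modulus v - modulus w| <= modulus (v - w).
  by rewrite ler_norml le_modulusB andbT lerNl opprB modulusBC; exact: le_modulusB.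
have d2 : (modulus v - modulus w) ^+ 2 <= modulus (v - w) ^+ 2.
  by rewrite -real_normK ?num_real// ler_sqr ?nnegrE ?modulus_ge0.
have E2 : modulus w * modulus v - (w.1 * v.1 + w.2 * v.2) =
    (modulus (v - w) ^+ 2 - (modulus v - modulus w) ^+ 2) / 2.
  by rewrite sqrrB !sqr_modulus /=; field.
have e0 : 0 <= modulus w * modulus v - (w.1 * v.1 + w.2 * v.2).
  by rewrite E2 divr_ge0// subr_ge0.
have e1 : modulus w * modulus v - (w.1 * v.1 + w.2 * v.2) <= modulus (v - w) ^+ 2.
  rewrite E2 ler_pdivrMr//; have := sqr_ge0 (modulus v - modulus w).
  by have := sqr_ge0 (modulus (v - w)); move: (_ ^+ 2) (_ ^+ 2) => X Y; lra.
have -> : V (modulus v) - V (modulus w) - re_mul (H w) (v - w) =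
  (V (modulus v) - V (modulus w) - h (modulus w) * (modulus v - modulus w)) +
  k * (modulus w * modulus v - (w.1 * v.1 + w.2 * v.2)).
  by rewrite E hk; ring.
have -> : 2 * c * modulus (v - w) ^+ 2 = c * modulus (v - w) ^+ 2 + c * modulus (v - w) ^+ 2.
  by ring.
apply: (le_trans (ler_normD _ _)); apply: lerD.
  by apply: (le_trans (V_quad r0 q0)); apply: ler_wpM2l.
by rewrite ger0_norm; [apply: ler_pM|apply: mulr_ge0].
Qed.

(** Since [T = id + t H], the linear terms cancel exactly: the error is that of [V] plus
    [t / 2 Re ((H v - H w)^2)]. Both are quadratic in [v - w], which [transport_expand] bounds by
    [T v - T w]. *)
Lemma pot_quad w v :
  `|pot g t v - pot g t w - re_mul (H w) (T v - T w)| <=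
    (2 * c + t * c ^+ 2) / (1 - t * c) ^+ 2 * modulus (T v - T w) ^+ 2.
Proof.
have k0 : 0 < 1 - t * c by rewrite subr_gt0.
have E : pot g t v - pot g t w - re_mul (H w) (T v - T w) =
  (V (modulus v) - V (modulus w) - re_mul (H w) (v - w)) +
  t / 2 * re_mul (H v - H w) (H v - H w).
  rewrite !pot_V !transportE; move: (V _) (V _) (H v) (H w) => X Y p q.
  by rewrite /re_mul /= /GRing.scale /=; field.
have A : modulus (v - w) ^+ 2 <= modulus (T v - T w) ^+ 2 / (1 - t * c) ^+ 2.
  rewrite ler_pdivlMr ?exprn_gt0// -exprMn ler_sqr ?nnegrE ?mulr_ge0 ?modulus_ge0 ?(ltW k0)//.
  by rewrite mulrC; exact: (transport_expand c0 t0 h0 hL).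
rewrite E [X in _ <= X]mulrAC -[X in _ <= X]mulrA.
apply: (@le_trans _ _ ((2 * c + t * c ^+ 2) * modulus (v - w) ^+ 2)); last first.
  by apply: ler_wpM2l => //; rewrite addr_ge0 ?mulr_ge0 ?sqr_ge0.
rewrite mulrDl; apply: (le_trans (ler_normD _ _)); apply: lerD; first exact: V_quad_plane.
rewrite normrM ger0_norm ?divr_ge0//.
apply: (@le_trans _ _ (t * (c * modulus (v - w)) ^+ 2)); last by rewrite exprMn mulrA.
apply: ler_pM; rewrite ?divr_ge0//; first by rewrite ler_pdivrMr// ler_peMr// ler1n.
apply: (le_trans (re_mul_le _ _)); rewrite -expr2 ler_sqr ?nnegrE ?mulr_ge0 ?modulus_ge0//.
exact: (hvec_lip c0 h0 hL).
Qed.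

End radial_potential.

(** * Comparison of measures on dyadic cells *)

Section algebra_approximation.
Context {d : measure_display} {T : measurableType d} {R : realType}.
Variable G : set (set T).
Hypothesis G_measurable : G `<=` measurable.
Hypothesis G0 : G set0.
Hypothesis GC : forall A, G A -> G (~` A).
Hypothesis GU : forall A B, G A -> G B -> G (A `|` B).

Section approximation.
Variable rho : {measure set T -> \bar R}.
Hypothesis rho_fin : (rho setT < +oo)%E.

Let approx A := measurable A /\
  forall e : R, 0 < e -> exists2 B, G B & (rho (A `+` B) <= e%:E)%E.

Let mY A B : measurable A -> G B -> measurable (A `+` B).
Proof.
by move=> mA /G_measurable mB; rewrite /setY; apply: measurableU; exact: measurableD.
Qed.

Let approxC A : approx A -> approx (~` A).
Proof.
move=> [mA HA]; split=> [|e e0]; first exact: measurableC.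
have [B GB AB] := HA e e0; exists (~` B); first exact: GC.
apply: le_trans AB; apply: le_measure; rewrite ?inE.
- by apply: mY; [exact: measurableC|exact: GC].
- exact: mY.
- move=> x [] [/= h1 h2]; [right|left]; split=> //; exact: contrapT.
Qed.

Let approxU A A' : approx A -> approx A' -> approx (A `|` A').
Proof.
move=> [mA HA] [mA' HA']; split=> [|e e0]; first exact: measurableU.
have e20 : 0 < e / 2 by rewrite divr_gt0.
have [B GB AB] := HA _ e20; have [B' GB' AB'] := HA' _ e20.
exists (B `|` B'); first exact: GU.
apply: (@le_trans _ _ (rho ((A `+` B) `|` (A' `+` B')))).
  apply: le_measure; rewrite ?inE.
  - by apply: mY; [exact: measurableU|exact: GU].
  - by apply: measurableU; exact: mY.
  - move=> x [[h1 /not_orP[h2 h3]]|[h1 /not_orP[h2 h3]]].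
      by case: h1 => h; [left; left|right; left].
    by case: h1 => h; [left; right|right; right].
apply: (le_trans (measureU2 _ _ _)); [exact: mY..|].
by rewrite [e]splitr EFinD leeD.
Qed.

Let approx_bigcup (F : (set T)^nat) : (forall n, approx (F n)) -> approx (\bigcup_k F k).
Proof.
move=> HF; have mF n : measurable (F n) by case: (HF n).
have mU : measurable (\bigcup_k F k) by exact: bigcup_measurable.
split=> // e e0; have e20 : 0 < e / 2 by rewrite divr_gt0.
pose S n := \big[setU/set0]_(i < n) F i.
have HS n : approx (S n).
  rewrite /S; elim: n => [|n IH]; last by rewrite big_ord_recr; exact: approxU.
  rewrite big_ord0; split=> // e' e'0; exists set0 => //.
  by rewrite setYK measure0 lee_fin ltW.
have mS n : measurable (S n) by case: (HS n).
pose D n := \bigcup_k F k `\` S n.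
have mD n : measurable (D n) by exact: measurableD.
have Dcvg : rho (D n) @[n --> \oo] --> 0%E.
  rewrite -(measure0 rho); have <- : \bigcap_n D n = set0.
    apply/seteqP; split=> x // Dx; have [[k _ Fk] _] := Dx 0%N I.
    have [_] := Dx k.+1 I; apply; rewrite /S big_ord_recr; by right.
  apply: nonincreasing_cvg_mu => //.
  - apply: le_lt_trans rho_fin; apply: le_measure; rewrite ?inE//; exact: mD.
  - exact: bigcap_measurable.
  - move=> m n mn; apply/subsetPset => x [Ux Sx]; split=> // Sx'; apply: Sx.
    by move: Sx'; rewrite /S -!bigcup_mkord => -[k /= km Fk]; exists k => //=; exact: leq_trans mn.
have [N DN] : exists N, (rho (D N) <= (e / 2)%:E)%E.
  move: Dcvg => /fine_cvgP[Dfin /cvgrPdist_lt/(_ _ e20) Dlt].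
  have [N _ NP] : \forall n \near \oo, rho (D n) \is a fin_num /\ `|0 - fine (rho (D n))| < e / 2.
    by near=> n; split; near: n.
  have [fN hN] := NP N (leqnn N); exists N; rewrite -(fineK fN) lee_fin.
  by apply/ltW/(le_lt_trans _ hN); rewrite sub0r normrN ler_norm.
have [B GB SB] := (HS N).2 _ e20.
exists B => //; apply: (@le_trans _ _ (rho (D N `|` (S N `+` B)))).
  apply: le_measure; rewrite ?inE.
  - exact: mY.
  - by apply: measurableU => //; exact: mY.
  - move=> x [[Ux Bx]|[Bx Ux]].
      by have [Sx|Sx] := pselect (S N x); [right; left|left].
    right; right; split=> // Sx; apply: Ux.
    by move: Sx; rewrite /S -bigcup_mkord => -[k _ Fk]; exists k.
apply: (le_trans (measureU2 _ _ _)); [exact: mD|exact: mY|].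
by rewrite [e]splitr EFinD leeD.
Unshelve. all: by end_near. Qed.

(** The sets that [G] approximates in measure form a sigma-algebra; for a countable union,
    finiteness of [rho] makes the tail small, so that a finite union is enough. *)
Lemma sigma_algebra_approx A (e : R) : <<s G >> A -> 0 < e ->
  measurable A /\ exists2 B, G B & (rho (A `+` B) <= e%:E)%E.
Proof.
move=> GA e0; have [mA H] : approx A; last by split=> //; exact: H.
apply: (smallest_sub _ _ GA) => [|B GB]; last first.
  split=> [|e' e'0]; first exact: G_measurable.
  by exists B => //; rewrite setYK measure0 lee_fin ltW.
split.
- split=> // e' e'0; exists set0 => //; by rewrite setYK measure0 lee_fin ltW.
- by move=> B; rewrite setTD; exact: approxC.
- exact: approx_bigcup.
Qed.

End approximation.

(** [nu A <= mu A] does not pass to complements, so these sets need not form a Dynkin class. Instead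
    [A] is approximated by one element of [G] for both measures at once, through their sum. *)
Lemma le_measure_algebra (nu mu : {measure set T -> \bar R}) :
  (nu setT < +oo)%E -> (mu setT < +oo)%E ->
  (forall B, G B -> (nu B <= mu B)%E) -> forall A, <<s G >> A -> (nu A <= mu A)%E.
Proof.
move=> nu_fin mu_fin le A GA; apply/lee_addgt0Pr => e e0.
have e20 : 0 < e / 2 by rewrite divr_gt0.
pose rho : {measure set T -> \bar R} := measure_add nu mu.
have rhoE B : rho B = (nu B + mu B)%E by exact: measure_addE.
have rho_fin : (rho setT < +oo)%E by rewrite rhoE lte_add_pinfty.
have [mA [B GB]] := sigma_algebra_approx rho_fin GA e20.
rewrite rhoE => AB; have mB := G_measurable GB.
have mAB : measurable (A `+` B) by rewrite /setY; apply: measurableU; exact: measurableD.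
have nuAB : (nu (A `+` B) <= (e / 2)%:E)%E by apply: le_trans AB; rewrite leeDl.
have muAB : (mu (A `+` B) <= (e / 2)%:E)%E by apply: le_trans AB; rewrite leeDr.
have H (m : {measure set T -> \bar R}) C D : measurable C -> measurable D ->
    (m C <= m D + m (C `+` D))%E.
  move=> mC mD; have mCD : measurable (C `+` D).
    by rewrite /setY; apply: measurableU; exact: measurableD.
  apply: le_trans (measureU2 _ mD mCD); apply: le_measure; rewrite ?inE//.
    exact: measurableU.
  by move=> x Cx; have [Dx|Dx] := pselect (D x); [left|right; left].
apply: (le_trans (H nu A B mA mB)); rewrite [e]splitr EFinD addeA; apply: leeD => //.
apply: (le_trans (le _ GB)); apply: (le_trans (H mu B A mB mA)).
by rewrite setYC leeD.
Qed.

End algebra_approximation.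

Section dyadic.
Context {R : realType}.
Implicit Types (n m : nat) (z : R * R) (k : int * int).

Definition dyadic n z : int * int := (Num.floor (2 ^+ n * z.1), Num.floor (2 ^+ n * z.2)).

Definition cell n k : set (R * R) := [set z | dyadic n z = k].

Lemma floor_half (x : R) : Num.floor x = (Num.floor (2 * x) %/ 2)%Z.
Proof.
apply: floor_def; have /andP[h1 h2] := floor_itv (2 * x).
have e := divz_eq (Num.floor (2 * x)) 2.
have r1 : (0 <= (Num.floor (2 * x) %% 2)%Z)%R by exact: modz_ge0.
have r2 : ((Num.floor (2 * x) %% 2)%Z < 2)%R by exact: ltz_pmod.
move: (Num.floor _) h1 h2 e r1 r2 => f; move: (f %/ 2)%Z (f %% 2)%Z => q r h1 h2 e r1 r2.
move: h1 h2; rewrite e !intrD intrM => h1 h2.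
have r1' : (0 : R) <= r%:~R by rewrite ler0z.
have r2' : r%:~R <= (1 : R) by rewrite -[1]/(1%:~R) ler_int -ltzD1.
have two : (2%Z)%:~R = 2 :> R by [].
by rewrite two in h1 h2; apply/andP; split; lra.
Qed.

Lemma dyadic_coarsen n m : exists r : int * int -> int * int,
  forall z, dyadic n z = r (dyadic (n + m) z).
Proof.
elim: m => [|m [r IH]]; first by exists id => z; rewrite addn0.
exists (fun k => r ((k.1 %/ 2)%Z, (k.2 %/ 2)%Z)) => z.
by rewrite IH /dyadic /= addnS exprS -!mulrA -!floor_half.
Qed.

Lemma cellE n k z : cell n k z <->
  (k.1%:~R / 2 ^+ n <= z.1 < (k.1 + 1)%:~R / 2 ^+ n) /\
  (k.2%:~R / 2 ^+ n <= z.2 < (k.2 + 1)%:~R / 2 ^+ n).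
Proof.
have p0 : 0 < 2 ^+ n :> R by rewrite exprn_gt0.
rewrite !ler_pdivrMr// !ltr_pdivlMr// ![_ * 2 ^+ n]mulrC /cell /dyadic /=; split.
  by move=> <- /=; split; exact: floor_itv.
by case: k => a b /= [/floor_def-> /floor_def->].
Qed.

Lemma measurable_box (a b c d : R) :
  measurable [set z : R * R | (a <= z.1 < b) /\ (c <= z.2 < d)].
Proof.
have -> : [set z : R * R | (a <= z.1 < b) /\ (c <= z.2 < d)] =
    `[a, b[%classic `*` `[c, d[%classic.
  by apply/seteqP; split => z /=; rewrite !in_itv.
by apply: measurableX; exact: measurable_itv.
Qed.

Lemma measurable_cell n k : measurable (cell n k).
Proof.
rewrite (_ : cell n k = [set z : R * R |
  (k.1%:~R / 2 ^+ n <= z.1 < (k.1 + 1)%:~R / 2 ^+ n) /\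
  (k.2%:~R / 2 ^+ n <= z.2 < (k.2 + 1)%:~R / 2 ^+ n)]); first exact: measurable_box.
by apply/seteqP; split=> z /cellE.
Qed.

(** An enumeration by codes of the cells with index in [S], empty at the remaining codes: it
    exhibits the preimage as a countable disjoint union. *)
Let cells n (S : set (int * int)) (i : nat) : set (R * R) :=
  if pickle_inv i is Some k then if `[< S k >] then cell n k else set0 else set0.

Let cellsE n S : dyadic n @^-1` S = \bigcup_i cells n S i.
Proof.
apply/seteqP; split=> z /=.
  move=> Sz; exists (pickle (dyadic n z)); first exact: I.
  by rewrite /cells pickleK_inv; case: asboolP.
move=> [i _]; rewrite /cells; case: (pickle_inv i) => // k.
by case: asboolP => // Sk; rewrite /cell /= => ->.
Qed.

Let measurable_cells n S i : measurable (cells n S i).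
Proof.
rewrite /cells; case: (pickle_inv i) => // k; case: asboolP => // _; exact: measurable_cell.
Qed.

Lemma measurable_dyadic_preimage n S : measurable (dyadic n @^-1` S).
Proof. by rewrite cellsE; apply: bigcupT_measurable; exact: measurable_cells. Qed.

Lemma measurable_open_plane (U : set (R * R)) : open U -> measurable U.
Proof.
move=> oU.
rewrite (_ : U = \bigcup_n (dyadic n @^-1` [set k | cell n k `<=` U])); last first.
  apply/seteqP; split => [z Uz|z [n _ /=]]; last by apply; exact: erefl.
  move: oU; rewrite openE => /(_ z Uz) /nbhs_ballP[e /= e0 eU].
  have [n ne] : exists n, e^-1 < 2 ^+ n :> R.
    exists (Num.bound e^-1); apply: (lt_le_trans (archi_boundP _)).
      by rewrite invr_ge0 ltW.
    by rewrite -natrX ler_nat ltnW// ltn_expl.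
  have p0 : 0 < 2 ^+ n :> R by rewrite exprn_gt0.
  have ne' : (2 ^+ n)^-1 < e by rewrite invf_plt// posrE.
  exists n => //= y yz; apply: eU.
  have near (k : int) (a b : R) : k%:~R / 2 ^+ n <= a < (k + 1)%:~R / 2 ^+ n ->
      k%:~R / 2 ^+ n <= b < (k + 1)%:~R / 2 ^+ n -> `|a - b| < e.
    rewrite intrD mulrDl mul1r => /andP[h1 h2] /andP[h3 h4].
    by rewrite ltr_norml; apply/andP; split; lra.
  have /cellE[z1 z2] : cell n (dyadic n z) z by [].
  move: yz => /cellE[y1 y2].
  by split; [exact: near z1 y1|exact: near z2 y2].
by apply: bigcupT_measurable => n; exact: measurable_dyadic_preimage.
Qed.

Let trivIset_cells n S : trivIset setT (cells n S).
Proof.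
apply/trivIsetP => i j _ _ /eqP ij; apply/seteqP; split=> z // []; rewrite /cells.
have := pickle_invK (T := (int * int)%type) i; have := pickle_invK (T := (int * int)%type) j.
case: (pickle_inv i) => [k|//]; case: (pickle_inv j) => [l|//] /= pl pk.
case: asboolP => // _; case: asboolP => // _; rewrite /cell /= => zk zl.
by apply: ij; rewrite -pk -pl -zk -zl.
Qed.

(** Unions of cells of one scale. Any two scales have a common refinement by [dyadic_coarsen], so
    these sets form an algebra. *)
Definition dyadic_sets : set (set (R * R)) :=
  [set A | exists n S, A = dyadic n @^-1` S].

Lemma dyadic_sets_generate : measurable `<=` <<s dyadic_sets >>.
Proof.
pose T' := g_sigma_algebraType dyadic_sets.
have mray (p : R * R -> R) (pk : int * int -> int) :
    (forall n z, pk (dyadic n z) = Num.floor (2 ^+ n * p z)) ->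
    @measurable_fun _ _ T' R setT p.
  move=> pE; apply: (measurability _ (RGenInftyO.measurableE R)) => _ [_ [x ->]] <-.
  (* A point has [p z < x] exactly when, at some scale, the whole cell of [p z] lies to the left of
     [x]. *)
  rewrite setTI (_ : _ @^-1` _ = \bigcup_n (dyadic n @^-1`
    [set k | (pk k + 1)%:~R <= 2 ^+ n * x])).
    apply: bigcupT_measurable => n; apply: sub_sigma_algebra.
    by exists n, [set k | (pk k + 1)%:~R <= 2 ^+ n * x].
  apply/seteqP; split=> z /=; rewrite in_itv /=.
    move=> zx; have d0 : 0 < x - p z by rewrite subr_gt0.
    pose n := (Num.truncn (x - p z)^-1).+1.
    exists n => //=; rewrite pE intrD.
    have h1 : 1 <= 2 ^+ n * (x - p z).
      rewrite -ler_pdivrMr// div1r; apply: (le_trans (ltW (truncnS_gt _))).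
      by rewrite -/n -natrX ler_nat ltnW// ltn_expl.
    rewrite mulrBr in h1; have := floor_le (2 ^+ n * p z); rewrite -[1%:~R]/(1 : R); lra.
  move=> [n _ /=]; rewrite pE => h; have p0 : 0 < 2 ^+ n :> R by rewrite exprn_gt0.
  rewrite -(ltr_pM2l p0); exact: lt_le_trans (floorD1_gt _) h.
have mid : @measurable_fun _ _ T' (R * R)%type setT (fun z : R * R => z).
  apply/measurable_fun_pairP; split.
    exact: (mray fst fst).
  exact: (mray snd snd).
by move=> A mA; have := mid measurableT A mA; rewrite setTI preimage_id.
Qed.

Lemma le_measure_dyadic (nu mu : {measure set (R * R) -> \bar R}) :
  (nu setT < +oo)%E -> (mu setT < +oo)%E ->
  (forall n k, (nu (cell n k) <= mu (cell n k))%E) ->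
  forall A, measurable A -> (nu A <= mu A)%E.
Proof.
move=> nu_fin mu_fin le A /dyadic_sets_generate GA.
apply: (le_measure_algebra _ _ _ _ nu_fin mu_fin _ GA).
- move=> _ [n [S ->]]; rewrite cellsE; apply: bigcupT_measurable; exact: measurable_cells.
- by exists 0%N, set0; rewrite preimage_set0.
- by move=> _ [n [S ->]]; exists n, (~` S); rewrite preimage_setC.
- move=> _ _ [n [S ->]] [m [S' ->]].
  have [r rE] := dyadic_coarsen n m; have [r' rE'] := dyadic_coarsen m n.
  exists (n + m)%N, (r @^-1` S `|` r' @^-1` S').
  apply/seteqP; split=> z /=; rewrite rE rE' [(m + n)%N]addnC //.
- move=> _ [n [S ->]]; rewrite cellsE.
  have mU : measurable (\bigcup_i cells n S i).
    by apply: bigcupT_measurable; exact: measurable_cells.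
  rewrite !measure_semi_bigcup//; try exact: measurable_cells; try exact: trivIset_cells.
  apply: lee_nneseries => [i _ _|i _]; first exact: measure_ge0.
  by rewrite /cells; case: (pickle_inv i) => [k|]; [case: asboolP|]; rewrite ?measure0.
Qed.

End dyadic.

Lemma integral_cst_prob (R : realType) (d : measure_display) (T : measurableType d)
  (mu : probability T R) (k : R) : (\int[mu]_y k%:E = k%:E)%E.
Proof.
rewrite integral_cst//; transitivity (k%:E * 1)%E; last exact: mule1.
by congr (_ * _)%E; exact: probability_setT.
Qed.

Lemma integral_modulus_le (R : realType) (mu : probability (R * R)%type R) (B : R) :
  0 <= B -> mu [set y | B < modulus y] = 0%E -> (\int[mu]_y (modulus y)%:E <= B%:E)%E.
Proof.
move=> B0 muB.
apply: (@le_trans _ _ (\int[mu]_y B%:E)%E); last by rewrite integral_cst_prob.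
apply: ae_ge0_le_integral => //.
- by move=> y _; rewrite lee_fin modulus_ge0.
- by apply/measurable_EFinP; exact: measurable_modulus.
- have mS : measurable [set y : R * R | B < modulus y].
    have := @measurable_modulus R measurableT _ (measurable_itv `]B, +oo[).
    by rewrite setTI; congr measurable; apply/seteqP; split => y /=; rewrite in_itv /= andbT.
  exists [set y : R * R | B < modulus y]; split=> // y /= /not_implyP[_ /negP].
  by rewrite lee_fin -ltNge.
Qed.

(** * Measures are determined by their potentials *)

Section smoothing.
Context {R : realType}.
Variable g : R -> R.
Hypothesis g_cont : {within `[0, 1], continuous g}.
Hypothesis dg1_cvg : cvg ((g 1 - g (1 - h)) / h @[h --> 0^'+]).
Hypothesis A3 : condA3 g.
Variables c : R.
Hypothesis c0 : 0 <= c.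
Hypothesis cP : forall r, rad0 g < r < rad1 g ->
  `|derive1 (fun r => alpha0 g r / r) r| <= c.
Variable nu : probability (R * R)%type R.
Hypothesis nuP : nu0_spec g nu.
Let h (r : R) := alpha0 g r / r.
Let hL := h_lip g_cont dg1_cvg A3 c0 cP.
Let h0 (r : R) : 0 <= r -> 0 <= h r.
Proof. exact: (h_ge0 g_cont dg1_cvg A3). Qed.
Let al0 : alpha0 g 0 = 0 := alpha0_0 g.
Let M := 108 * c.
Let M0 : 0 <= M. Proof. by rewrite mulr_ge0. Qed.
Let nuD y (r : R) : 0 < r -> (nu (disc y r) <= (M * r ^+ 2)%:E)%E.
Proof. by move=> r0; exact: (nu_disc_le c0 h0 hL al0 nuP). Qed.
Let tc0 : (0 : R) * c < 1. Proof. by rewrite mul0r. Qed.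

Lemma transport_id w : transport g 0 w = w.
Proof. by rewrite transportE scale0r addr0. Qed.

Lemma pot_id w : pot g 0 w = V g (modulus w) - g 1.
Proof. by rewrite pot_V !mul0r addr0. Qed.

Lemma integrable_ln_dist_nu w : nu.-integrable setT (EFin \o ln_dist w).
Proof.
have := integrable_L g_cont dg1_cvg A3 c0 cP (lexx 0) tc0 nuP w; apply: eq_integrable => //.
by move=> y _; rewrite /= !transport_id.
Qed.

(** The case [t = 0] of [integral_ln_transport], where [T] is the identity. *)
Lemma potential_nu w : \int[nu]_y ln_dist w y = V g (modulus w) - g 1.
Proof.
rewrite -pot_id -(integral_ln_transport g_cont dg1_cvg A3 c0 cP (lexx 0) tc0 nuP w).
by apply: eq_Rintegral => y _; rewrite !transport_id.
Qed.

Lemma nu_rad1 : nu [set y | rad1 g < modulus y] = 0%E.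
Proof.
have mS : measurable [set y : R * R | rad1 g < modulus y].
  have := @measurable_modulus R measurableT _ (measurable_itv `]rad1 g, +oo[).
  by rewrite setTI; congr measurable; apply/seteqP; split => y /=; rewrite in_itv /= andbT.
apply/eqP; rewrite eq_le measure_ge0 andbT.
rewrite -(nu_setC_level1 g_cont dg1_cvg A3 c0 cP nuP); apply: le_measure; rewrite ?inE//.
  by apply: measurableC; exact: (measurable_level g_cont dg1_cvg A3 c0 cP).
move=> y /= ry; rewrite /level /= (alpha0_ge_rad1 g_cont dg1_cvg A3) ?ltxx//; exact: ltW.
Qed.

(* The potential at [x] of the image of [nu] under the homothety of ratio [e]. *)
Definition smooth_ln (e : R) (x : R * R) : R := ln e + (V g (modulus x / e) - g 1).

Lemma modulus_scale (e : R) x y : 0 < e ->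
  modulus (x - e *: y) = e * modulus (e^-1 *: x - y).
Proof.
move=> e0; have en : e != 0 by rewrite gt_eqF.
rewrite -[in LHS](scalerKV en x).
by rewrite -scalerBr modulusZ gtr0_norm.
Qed.

Lemma smooth_lnE (e : R) x : 0 < e ->
  (\int[nu]_y (ln (modulus (x - e *: y)))%:E)%E = (smooth_ln e x)%:E.
Proof.
move=> e0; have i1 := integrable_ln_dist_nu (e^-1 *: x).
have i2 : nu.-integrable setT (EFin \o (fun _ : R * R => ln e)).
  by apply: finite_measure_integrable_cst.
transitivity (\int[nu]_y ((ln e)%:E + (ln_dist (e^-1 *: x) y)%:E))%E.
  have mE : measurable_fun setT (fun y : R * R => ln (modulus (x - e *: y))).
    apply: measurableT_comp => //; apply: measurableT_comp; first exact: measurable_modulus.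
    apply: (measurableT_comp (measurable_subr2 x)).
    apply/measurable_fun_pairP; split.
    - by rewrite (_ : fst \o _ = fun z : R * R => e * z.1)//; apply: measurable_funM.
    - by rewrite (_ : snd \o _ = fun z : R * R => e * z.2)//; apply: measurable_funM.
  apply: ae_eq_integral => //.
  - exact/measurable_EFinP.
  - by apply: emeasurable_funD => //; apply/measurable_EFinP; exact: measurable_ln_dist.
  - have := ae_neq (mu_set1 M0 nuD (e^-1 *: x)); apply: filterS => y yx _.
    rewrite modulus_scale// lnM ?EFinD// posrE modulus_gt0 subr_eq0 eq_sym//.
rewrite integralD// integral_cst_prob /smooth_ln EFinD; congr (_ + _)%E.
have -> : modulus x / e = modulus (e^-1 *: x).
  by rewrite modulusZ gtr0_norm ?invr_gt0// mulrC.
rewrite -potential_nu /Rintegral fineK//; exact: integrable_fin_num.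
Qed.

Section potential_smoothing.
Variables (mu : probability (R * R)%type R) (B : R) (P : R * R -> R).
Hypothesis B0 : 0 <= B.
Hypothesis muB : mu [set y | B < modulus y] = 0%E.
Hypothesis muP : forall z, (\int[mu]_y (ln_dist z y)%:E = (P z)%:E)%E.
Variables (z : R * R) (e : R).
Hypothesis e0 : 0 < e.

Let f (p : (R * R) * (R * R)) : R := ln (modulus (z - p.1 - e *: p.2)).

Let mf : measurable_fun setT f.
Proof.
apply: measurableT_comp => //; apply: measurableT_comp; first exact: measurable_modulus.
apply/measurable_fun_pairP; split.
- rewrite (_ : fst \o _ = fun p : (R * R) * (R * R) => z.1 - p.1.1 - e * p.2.1)//.
  apply: measurable_funB; first apply: measurable_funB => //.
    exact: (measurableT_comp measurable_fst measurable_fst).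
  apply: measurable_funM => //; exact: (measurableT_comp measurable_fst measurable_snd).
- rewrite (_ : snd \o _ = fun p : (R * R) * (R * R) => z.2 - p.1.2 - e * p.2.2)//.
  apply: measurable_funB; first apply: measurable_funB => //.
    exact: (measurableT_comp measurable_snd measurable_fst).
  apply: measurable_funM => //; exact: (measurableT_comp measurable_snd measurable_snd).
Qed.

Let inner_le x : (\int[nu]_y `|(f (x, y))%:E| <=
  (e^-1 * (4 * M + 1) + (modulus z + e * rad1 g))%:E + (modulus x)%:E)%E.
Proof.
have r1 := rad1_gt0 g.
have mI : measurable_fun setT (fun y => (e^-1)%:E * (inv_dist (e^-1 *: (z - x)) y)%:E)%E.
  by apply/measurable_EFinP; apply: measurable_funM => //; exact: measurable_inv_dist.
have mM : measurable_fun setT (fun y : R * R => e%:E * (modulus y)%:E)%E.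
  by apply/measurable_EFinP; apply: measurable_funM => //; exact: measurable_modulus.
pose k : \bar R := ((modulus z)%:E + (modulus x)%:E)%E.
apply: (@le_trans _ _ (\int[nu]_y ((e^-1)%:E * (inv_dist (e^-1 *: (z - x)) y)%:E +
    (k + e%:E * (modulus y)%:E)))%E).
  apply: ge0_le_integral => //.
  - apply/measurable_EFinP/measurableT_comp => //.
    exact: (measurableT_comp mf (measurable_pair1 x)).
  - by apply: emeasurable_funD => //; apply: emeasurable_funD.
  - move=> y _; rewrite /k -!EFinM -!EFinD /= lee_fin.
    apply: (le_trans (normr_ln_le (modulus_ge0 _))); apply: lerD.
      by rewrite modulus_scale// invfM.
    apply: (le_trans (le_modulusD _ _)); apply: lerD.
      by apply: (le_trans (le_modulusD _ _)); rewrite modulusN.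
    by rewrite modulusN modulusZ gtr0_norm.
rewrite ge0_integralD//; last 3 first.
- by move=> y _; rewrite -EFinM lee_fin mulr_ge0 ?inv_dist_ge0 ?invr_ge0 ?(ltW e0).
- move=> y _; rewrite /k -!EFinM -!EFinD lee_fin.
  by rewrite !addr_ge0 ?mulr_ge0 ?modulus_ge0 ?(ltW e0).
- exact: emeasurable_funD.
rewrite ge0_integralZl_EFin//; last 3 first.
- by move=> y _; rewrite lee_fin inv_dist_ge0.
- exact: measurable_inv_distE.
- by rewrite invr_ge0 ltW.
rewrite ge0_integralD//; last 2 first.
- by move=> y _; rewrite /k -EFinD lee_fin addr_ge0 ?modulus_ge0.
- by move=> y _; rewrite -EFinM lee_fin mulr_ge0 ?modulus_ge0 ?(ltW e0).
rewrite /k -EFinD integral_cst_prob ge0_integralZl_EFin//; last 3 first.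
- by move=> y _; rewrite lee_fin modulus_ge0.
- by apply/measurable_EFinP; exact: measurable_modulus.
- exact: ltW.
have -> : ((e^-1 * (4 * M + 1) + (modulus z + e * rad1 g))%:E + (modulus x)%:E =
    (e^-1 * (4 * M + 1))%:E + ((modulus z + modulus x)%:E + (e * rad1 g)%:E))%E.
  by rewrite -!EFinD; congr (_%:E); ring.
apply: leeD.
  rewrite EFinM; apply: lee_wpmul2l; first by rewrite lee_fin invr_ge0 ltW.
  have := integral_inv_dist_le M0 nuD (e^-1 *: (z - x)) ltr01 measurableT.
  by rewrite probability_setT mulr1 invr1 mule1.
apply: leeD => //.
rewrite EFinM; apply: lee_wpmul2l; first by rewrite lee_fin ltW.
by apply: integral_modulus_le; [exact: ltW|exact: nu_rad1].
Qed.

Let fint : (mu \x nu)%E.-integrable setT (EFin \o f).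
Proof.
apply/integrable12ltyP; first exact/measurable_EFinP.
apply: (@le_lt_trans _ _ (\int[mu]_x
  ((e^-1 * (4 * M + 1) + (modulus z + e * rad1 g))%:E + (modulus x)%:E))%E).
  apply: ge0_le_integral => //.
  - by move=> x _; exact: integral_ge0.
  - apply: (@measurable_fun_fubini_tonelli_F _ _ _ _ _ nu (fun p => `|(f p)%:E|%E)) => //.
    by apply/measurable_EFinP/measurableT_comp.
  - by apply: emeasurable_funD => //; apply/measurable_EFinP; exact: measurable_modulus.
  - by move=> x _; exact: inner_le.
rewrite ge0_integralD//; last 3 first.
- move=> x _; rewrite lee_fin !addr_ge0 ?mulr_ge0 ?modulus_ge0 ?invr_ge0 ?(ltW e0)//.
    by rewrite addr_ge0// mulr_ge0.
  exact: ltW (rad1_gt0 g).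
- by move=> x _; rewrite lee_fin modulus_ge0.
- by apply/measurable_EFinP; exact: measurable_modulus.
rewrite integral_cst_prob.
by rewrite (le_lt_trans (leeD (lexx _) (integral_modulus_le B0 muB)))// ltry.
Qed.

Lemma integrable_smooth_ln : mu.-integrable setT (fun x => (smooth_ln e (z - x))%:E).
Proof.
have := integrable_fubini_F fint; apply: eq_integrable => // x _.
by rewrite /fubini_F /f /= smooth_lnE.
Qed.

(** By Fubini, smoothing the kernel amounts to smoothing the potential, so the integral depends on
    [mu] through [P] alone. *)
Lemma integral_smooth_ln :
  (\int[mu]_x (smooth_ln e (z - x))%:E = \int[nu]_y (P (z - e *: y))%:E)%E.
Proof.
transitivity (\int[mu]_x \int[nu]_y (f (x, y))%:E)%E.
  by apply: eq_integral => x _; rewrite /f /= smooth_lnE.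
rewrite (Fubini fint); apply: eq_integral => y _.
rewrite -muP; apply: eq_integral => x _; rewrite /f /ln_dist /=; congr (ln (modulus _))%:E.
by rewrite addrAC.
Qed.

End potential_smoothing.
End smoothing.

(** * Lebesgue measure on the plane *)

Section plane_lebesgue.
Context {R : realType}.
Local Notation leb := (@leb1 R \x @leb1 R)%E.

Lemma leb1_itv (a b : R) : a <= b -> leb1 `[a, b[%classic = (b - a)%:E.
Proof.
move=> ab; rewrite /leb1 lebesgue_measure_itv /= lte_fin.
by move: ab; rewrite le_eqVlt => /predU1P[->|->]; rewrite ?ltxx ?subrr// EFinB.
Qed.

Lemma leb1_shift (a : R) (A : set R) : measurable A -> leb1 ((fun x => x - a) @^-1` A) = leb1 A.
Proof.
move=> mA; have ms : measurable_fun setT (fun x : R => x - a) by exact: measurable_funB.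
apply/esym; apply: (lebesgue_measure_unique (mu := pushforward (@lebesgue_measure R)
  (fun x : measurableTypeR R => (x - a : measurableTypeR R)))) => //.
move=> _ [[x y] _ <-].
change (lebesgue_measure `]x, y]%classic =
  lebesgue_measure ((fun u : R => u - a) @^-1` `]x, y]%classic)).
have -> : (fun u : R => u - a) @^-1` `]x, y]%classic = `]x + a, y + a]%classic.
  by apply/seteqP; split => u /=; rewrite !in_itv /= ltrBrDr lerBlDr.
by rewrite !lebesgue_measure_itv /= !lte_fin ltrD2r; case: ifP => // _;
   rewrite -!EFinB; congr (_%:E); ring.
Qed.

Definition box (a b c d : R) : set (R * R) := [set z | (a <= z.1 < b) /\ (c <= z.2 < d)].

Lemma boxE (a b c d : R) : box a b c d = `[a, b[%classic `*` `[c, d[%classic.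
Proof. by apply/seteqP; split => z /=; rewrite /box /= !in_itv. Qed.

Lemma leb2_box (a b c d : R) : a <= b -> c <= d ->
  leb2 (box a b c d) = ((b - a) * (d - c))%:E.
Proof.
move=> ab cd; rewrite boxE EFinM -(leb1_itv ab) -(leb1_itv cd).
by apply: product_measure1E; exact: measurable_itv.
Qed.

Lemma measurable_shift (z0 : R * R) : measurable_fun setT (fun z : R * R => z - z0).
Proof.
by apply/measurable_fun_pairP; split; apply: measurable_funB.
Qed.

Lemma leb2_shift (z0 : R * R) (A : set (R * R)) : measurable A ->
  leb A = leb ((fun z => z - z0) @^-1` A).
Proof.
move=> mA; apply: (product_measure_unique (m' := pushforward leb (fun z : R * R => z - z0))) => //.
  exact: measurable_shift.
move=> Hyp0 X Y mX mY.
change (leb ((fun z : R * R => z - z0)%R @^-1` (X `*` Y)) = leb1 X * leb1 Y)%E.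
clear Hyp0.
have -> : (fun z : R * R => z - z0) @^-1` (X `*` Y) =
    ((fun x => x - z0.1) @^-1` X) `*` ((fun x => x - z0.2) @^-1` Y) by [].
have mp (a : R) (B : set R) : measurable B -> measurable ((fun x => x - a) @^-1` B).
  move=> mB; rewrite -[X in measurable X]setTI.
  by apply: measurable_funB => //; exact: measurableT.
rewrite product_measure1E; [|exact: mp..].
by congr (_ * _)%E; exact: leb1_shift.
Qed.

Lemma integral_shift (z0 : R * R) (f : R * R -> \bar R) : measurable_fun setT f ->
  (forall z, 0 <= f z)%E -> (\int[leb]_z f (z - z0)%R = \int[leb]_z f z)%E.
Proof.
move=> mf f0.
have <- : (\int[pushforward leb (fun z : R * R => z - z0)%R]_z f z = \int[leb]_z f (z - z0)%R)%E.
  by rewrite (ge0_integral_pushforward (measurable_shift z0))// preimage_setT.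
apply: eq_measure_integral => [|Hyp0 A mA _]; first exact: measurable_shift.
by apply/esym; exact: leb2_shift.
Qed.

(* A carrier for the sigma-finite structure of [leb2], which Fubini needs and
   which is not inferred for the product [leb1 \x leb1]. *)
Definition plane_leb : set (R * R) -> \bar R := leb2.

HB.instance Definition _ := isMeasure.Build _ (R * R)%type R plane_leb
  (measure0 leb2) (measure_ge0 leb2) (@measure_semi_sigma_additive _ _ _ leb2).

Lemma plane_leb_sigma_finite : sigma_finite [set: R * R] plane_leb.
Proof.
exists (fun n => box (- n%:R) n%:R (- n%:R) n%:R).
  apply/esym; rewrite -subTset => z _.
  pose m := Num.max `|z.1| `|z.2|.
  have m0 : 0 <= m by rewrite le_max normr_ge0.
  exists (Num.bound m) => //; have := archi_boundP m0.
  rewrite gt_max !ltr_norml => /andP[/andP[h1 h2] /andP[h3 h4]].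
  by split; rewrite ltW.
move=> n; split; first exact: measurable_box.
rewrite /plane_leb.
by have n0 := ler0n R n; rewrite leb2_box ?ltry//; lra.
Qed.

HB.instance Definition _ :=
  Measure_isSigmaFinite.Build _ (R * R)%type R plane_leb plane_leb_sigma_finite.

End plane_lebesgue.

(** * The mollifying kernel *)

Section kernel.
Context {R : realType}.
Variable g : R -> R.
Hypothesis g_cont : {within `[0, 1], continuous g}.
Hypothesis dg1_cvg : cvg ((g 1 - g (1 - h)) / h @[h --> 0^'+]).
Hypothesis A3 : condA3 g.
Variables c : R.
Hypothesis c0 : 0 <= c.
Hypothesis cP : forall r, rad0 g < r < rad1 g ->
  `|derive1 (fun r => alpha0 g r / r) r| <= c.
Let al0 : alpha0 g 0 = 0 := alpha0_0 g.
Local Notation leb := (@leb1 R \x @leb1 R)%E.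

Lemma measurable_V_modulus (e : R) : 0 < e ->
  measurable_fun setT (fun x : R * R => V g (modulus x / e)).
Proof.
move=> e0; have ma := measurable_alpha_modulus g_cont dg1_cvg A3 c0 cP.
have mg : measurable_fun setT (fun x : R * R => g (alpha0 g (modulus x))).
  have mg1 : measurable_fun (`[0, 1]%classic : set R) g.
    by apply: subspace_continuous_measurable_fun => //; exact: measurable_itv.
  apply: (measurable_comp _ _ mg1 ma).
    exact: measurable_itv.
    move=> _ [x _ <-].
    have := alpha0_01 g_cont dg1_cvg A3 (modulus_ge0 x).
    by rewrite /= in_itv /=.
have mV : measurable_fun setT (fun x : R * R => V g (modulus x)).
  apply: measurable_funD => //; apply: measurable_funM => //.
  by apply: measurableT_comp => //; exact: measurable_modulus.
have ms : measurable_fun setT (fun x : R * R => e^-1 *: x).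
  by apply/measurable_fun_pairP; split; apply: measurable_funM.
have := measurableT_comp mV ms; apply: eq_measurable_fun => x _ /=.
by rewrite modulusZ gtr0_norm ?invr_gt0// mulrC.
Qed.

Variable e : R.
Hypothesis e0 : 0 < e.

Definition bump (x : R * R) : R := smooth_ln g (2 * e) x - smooth_ln g e x.

Lemma measurable_bump : measurable_fun setT bump.
Proof.
by apply: measurable_funB; apply: measurable_funD => //; apply: measurable_funB => //;
  apply: measurable_V_modulus => //; rewrite mulr_gt0.
Qed.

Lemma bumpE x : bump x = ln 2 - (V g (modulus x / e) - V g (modulus x / (2 * e))).
Proof. by rewrite /bump /smooth_ln lnM ?posrE//; ring. Qed.

Let ln2 : 0 < ln 2 :> R. Proof. by rewrite ln_gt0// ltr1n. Qed.

(** The two arguments of [V] differ by a factor 2, so by [V_diff] the increment of [V] is [ln 2]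
    times a number between the values of [alpha0] at them. *)
Lemma bump_bounds x :
  ln 2 * (1 - alpha0 g (modulus x / e)) <= bump x <= ln 2.
Proof.
rewrite bumpE; have [->|x0] := eqVneq x 0.
  by rewrite modulus0 !mul0r al0 subrr !subr0 mulr1 !lexx.
have m0 : 0 < modulus x by rewrite modulus_gt0.
have y0 : 0 < modulus x / e by rewrite divr_gt0.
have e20 : 0 < 2 * e by rewrite mulr_gt0.
have z0 : 0 < modulus x / (2 * e) by rewrite divr_gt0.
have E : ln (modulus x / e) - ln (modulus x / (2 * e)) = ln 2.
  rewrite !ln_div ?posrE// lnM ?posrE//; ring.
have h1 := V_diff g_cont dg1_cvg A3 y0 z0.
have h2 := V_diff g_cont dg1_cvg A3 z0 y0.
have /andP[a0 _] := alpha0_01 g_cont dg1_cvg A3 (ltW z0).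
rewrite -[ln (_ / (2 * e)) - _]opprB E mulrN in h1; rewrite E in h2.
have := mulr_ge0 a0 (ltW ln2).
by move=> h3; apply/andP; split; [move: h1; rewrite mulrBr mulr1 [ln 2 * _]mulrC|]; lra.
Qed.

Lemma bump_ge0 x : 0 <= bump x.
Proof.
have /andP[h1 _] := bump_bounds x; apply: le_trans h1.
have /andP[_ a1] := alpha0_01 g_cont dg1_cvg A3 (divr_ge0 (modulus_ge0 x) (ltW e0)).
by apply: mulr_ge0; [exact: ltW|rewrite subr_ge0].
Qed.

Lemma bump_out x : 2 * e * rad1 g <= modulus x -> bump x = 0.
Proof.
move=> xe; have e20 : 0 < 2 * e by rewrite mulr_gt0.
have z1 : rad1 g <= modulus x / (2 * e) by rewrite ler_pdivlMr// mulrC.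
have r1 := rad1_gt0 g.
have m0 : 0 < modulus x by apply: lt_le_trans xe; rewrite !mulr_gt0.
have y1 : rad1 g <= modulus x / e.
  by apply: (le_trans z1); rewrite ler_pM2l// lef_pV2 ?posrE// ler_peMl ?(ltW e0)// ler1n.
rewrite bumpE /V !(alpha0_ge_rad1 g_cont dg1_cvg A3)// !mul1r.
by rewrite !ln_div ?posrE// lnM ?posrE//; ring.
Qed.

Let u := expR (- derive1 g 2^-1).

(** Up to the radius [u] at which [alpha0] is one half, the lower bound of [bump_bounds] stays away
    from 0; this makes [bump_mass] positive. *)
Lemma bump_near x : modulus x <= e * u -> ln 2 / 2 <= bump x.
Proof.
move=> xu; have /andP[h1 _] := bump_bounds x; apply: le_trans h1.
have h01 : 0 < (2^-1 : R) < 1 by rewrite invr_gt0 ltr0n invf_lt1 ?ltr1n.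
apply: ler_wpM2l; first exact: ltW.
have xe : modulus x / e <= u by rewrite ler_pdivrMr// mulrC.
have : alpha0 g (modulus x / e) <= 2^-1.
  rewrite leNgt (lt_alpha0 g_cont dg1_cvg A3 h01) ?divr_ge0 ?modulus_ge0 ?(ltW e0)//.
  by rewrite -leNgt.
lra.
Qed.

Definition bump_mass : \bar R := (\int[leb]_z (bump z)%:E)%E.

Lemma bump_mass_lty : (bump_mass < +oo)%E.
Proof.
pose D := 2 * e * rad1 g; have D0 : 0 < D by rewrite !mulr_gt0// rad1_gt0.
have mB : measurable (box (- D) D (- D) D) by exact: measurable_box.
apply: (@le_lt_trans _ _ (\int[leb]_z ((ln 2)%:E * (\1_(box (- D) D (- D) D) z)%:E))%E).
  apply: ge0_le_integral => //.
  - by move=> z _; rewrite lee_fin bump_ge0.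
  - by apply/measurable_EFinP; exact: measurable_bump.
  - by apply/measurable_EFinP; apply: measurable_funM => //; exact: measurable_indic.
  - move=> z _; rewrite -EFinM lee_fin indicE.
    have [zB|zB] := boolP (z \in box _ _ _ _).
      by rewrite mulr1; have /andP[] := bump_bounds z.
    rewrite mulr0 bump_out// leNgt; apply: contraNN zB => zD.
    rewrite inE /box /=; have := le_lt_trans (normr_fst_le z) zD.
    have := le_lt_trans (normr_snd_le z) zD; rewrite !ltr_norml.
    by move=> /andP[/ltW -> ->] /andP[/ltW -> ->].
rewrite ge0_integralZl_EFin//; last 2 first.
- by apply/measurable_EFinP; exact: measurable_indic.
- exact: ltW.
rewrite integral_indic// setIT.
rewrite [X in (_ * X)%E](_ : _ = ((D - - D) * (D - - D))%:E); last first.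
  by apply: leb2_box; lra.
by rewrite -EFinM ltry.
Qed.

Lemma bump_mass_gt0 : (0 < bump_mass)%E.
Proof.
pose D := e * u / 2; have D0 : 0 < D by rewrite divr_gt0// mulr_gt0// expR_gt0.
have mB : measurable (box (- D) D (- D) D) by exact: measurable_box.
apply: (@lt_le_trans _ _ (\int[leb]_z ((ln 2 / 2)%:E * (\1_(box (- D) D (- D) D) z)%:E))%E).
  rewrite ge0_integralZl_EFin//; last 2 first.
  - by apply/measurable_EFinP; exact: measurable_indic.
  - by rewrite divr_ge0// ltW.
  rewrite integral_indic// setIT.
  rewrite [X in (_ * X)%E](_ : _ = ((D - - D) * (D - - D))%:E); last first.
    by apply: leb2_box; lra.
  by rewrite -EFinM lte_fin opprK !mulr_gt0 ?addr_gt0// invr_gt0.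
apply: ge0_le_integral => //.
- by move=> z _; rewrite -EFinM lee_fin mulr_ge0// divr_ge0// ltW.
- by apply/measurable_EFinP; apply: measurable_funM => //; exact: measurable_indic.
- by apply/measurable_EFinP; exact: measurable_bump.
- move=> z _; rewrite -EFinM lee_fin indicE.
  have [zB|zB] := boolP (z \in box _ _ _ _); last by rewrite mulr0 bump_ge0.
  rewrite mulr1 bump_near//; apply: (le_trans (modulus_le_add z)).
  have -> : e * u = D + D by rewrite /D; field.
  move: zB; rewrite inE /box /= => -[/andP[h1 h2] /andP[h3 h4]].
  by apply: lerD; rewrite ler_norml ?h1 ?h3 ltW.
Qed.

End kernel.

(** * Comparison of two measures on boxes *)

Section comparison.
Context {R : realType}.
Variable g : R -> R.
Hypothesis g_cont : {within `[0, 1], continuous g}.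
Hypothesis dg1_cvg : cvg ((g 1 - g (1 - h)) / h @[h --> 0^'+]).
Hypothesis A3 : condA3 g.
Variables c : R.
Hypothesis c0 : 0 <= c.
Hypothesis cP : forall r, rad0 g < r < rad1 g ->
  `|derive1 (fun r => alpha0 g r / r) r| <= c.
Variable nu : probability (R * R)%type R.
Hypothesis nuP : nu0_spec g nu.
Variables (mu1 mu2 : probability (R * R)%type R) (B : R) (P : R * R -> R).
Hypothesis B0 : 0 <= B.
Hypothesis mu1B : mu1 [set y | B < modulus y] = 0%E.
Hypothesis mu2B : mu2 [set y | B < modulus y] = 0%E.
Hypothesis mu1P : forall z, (\int[mu1]_y (ln_dist z y)%:E = (P z)%:E)%E.
Hypothesis mu2P : forall z, (\int[mu2]_y (ln_dist z y)%:E = (P z)%:E)%E.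
Local Notation leb := (@leb1 R \x @leb1 R)%E.

Lemma integral_bump (e : R) z : 0 < e ->
  (\int[mu1]_x (bump g e (z - x))%:E = \int[mu2]_x (bump g e (z - x))%:E)%E.
Proof.
move=> e0; have e20 : 0 < 2 * e by rewrite mulr_gt0.
have E (mu : probability (R * R)%type R) : mu [set y | B < modulus y] = 0%E ->
    (forall z, (\int[mu]_y (ln_dist z y)%:E = (P z)%:E)%E) ->
    (\int[mu]_x (bump g e (z - x))%:E =
     \int[nu]_y (P (z - (2 * e) *: y))%:E - \int[nu]_y (P (z - e *: y))%:E)%E.
  move=> muB muP.
  rewrite -(integral_smooth_ln g_cont dg1_cvg A3 c0 cP nuP B0 muB muP z e0).
  rewrite -(integral_smooth_ln g_cont dg1_cvg A3 c0 cP nuP B0 muB muP z e20).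
  rewrite -integralB//.
  - exact: (integrable_smooth_ln g_cont dg1_cvg A3 c0 cP nuP B0 muB z e20).
  - exact: (integrable_smooth_ln g_cont dg1_cvg A3 c0 cP nuP B0 muB z e0).
by rewrite !E.
Qed.

Section box_comparison.
Variables (a b a' b' e : R).
Hypothesis e0 : 0 < e.
Let D := 2 * e * rad1 g.
Let F (p : (R * R) * (R * R)) : \bar R :=
  (\1_(box a b a' b') p.2 * bump g e (p.2 - p.1))%:E.

Let mF : measurable_fun setT F.
Proof.
apply/measurable_EFinP; apply: measurable_funM.
  by apply: (measurableT_comp _ measurable_snd); apply: measurable_indic; exact: measurable_box.
apply: (measurableT_comp (measurable_bump g_cont dg1_cvg A3 c0 cP e0)).
apply/measurable_fun_pairP; split.
- apply: measurable_funB.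
    exact: (measurableT_comp measurable_fst measurable_snd).
  exact: (measurableT_comp measurable_fst measurable_fst).
- apply: measurable_funB.
    exact: (measurableT_comp measurable_snd measurable_snd).
  exact: (measurableT_comp measurable_snd measurable_fst).
Qed.

Let F0 p : (0 <= F p)%E.
Proof. by rewrite lee_fin mulr_ge0// (bump_ge0 g_cont dg1_cvg A3). Qed.

(** The indicator of the box convolved with [bump]. It never exceeds [bump_mass], attains it on the
    box shrunk by [D], and vanishes off the box inflated by [D]. *)
Let J (x : R * R) : \bar R := (\int[leb]_z F (x, z))%E.

Let J0 x : (0 <= J x)%E. Proof. exact: integral_ge0. Qed.

Let mJ : measurable_fun setT J.
Proof.
exact: (@measurable_fun_fubini_tonelli_F _ _ _ _ _ plane_leb F mF F0).
Qed.

Let integral_J : (\int[mu1]_x J x = \int[mu2]_x J x)%E.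
Proof.
have H (mu : probability (R * R)%type R) :
    (\int[mu]_x J x = \int[leb]_z \int[mu]_x F (x, z))%E.
  exact: (@fubini_tonelli _ _ _ _ _ mu plane_leb F mF F0).
rewrite !H; apply: eq_integral => z _; rewrite /F /= indicE.
have [_|_] := boolP (z \in _).
  by under eq_integral do rewrite mul1r; under [RHS]eq_integral do rewrite mul1r;
     exact: integral_bump.
by under eq_integral do rewrite mul0r; under [RHS]eq_integral do rewrite mul0r; rewrite !integral0.
Qed.

Let mass_shift x : (\int[leb]_z (bump g e (z - x))%:E = bump_mass g e)%E.
Proof.
apply: (integral_shift x (f := fun z => (bump g e z)%:E)).
  by apply/measurable_EFinP; exact: (measurable_bump g_cont dg1_cvg A3 c0 cP e0).
by move=> z; rewrite lee_fin (bump_ge0 g_cont dg1_cvg A3).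
Qed.

Let mbx (x : R * R) : measurable_fun setT (fun z : R * R => (bump g e (z - x)%R)%:E).
Proof.
apply/measurable_EFinP.
apply: (measurableT_comp (measurable_bump g_cont dg1_cvg A3 c0 cP e0)).
exact: measurable_shift.
Qed.

Let J_le x : (J x <= bump_mass g e)%E.
Proof.
rewrite -(mass_shift x); apply: ge0_le_integral => //.
- exact: (measurableT_comp mF (measurable_pair1 x)).
- move=> z _; rewrite lee_fin indicE; case: (z \in _).
    by rewrite mul1r.
  by rewrite mul0r (bump_ge0 g_cont dg1_cvg A3).
Qed.

Let J_in x : box (a + D) (b - D) (a' + D) (b' - D) x -> J x = bump_mass g e.
Proof.
move=> [/andP[h1 h2] /andP[h3 h4]]; rewrite -(mass_shift x); apply: eq_integral => z _.
rewrite /F /=; have [zD|zD] := leP D (modulus (z - x)).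
  by rewrite (bump_out g_cont dg1_cvg A3 e0 zD) mulr0.
have := le_lt_trans (normr_fst_le (z - x)) zD.
have := le_lt_trans (normr_snd_le (z - x)) zD; rewrite !ltr_norml /=.
move=> /andP[k1 k2] /andP[k3 k4]; rewrite indicE mem_set ?mul1r//.
by split; apply/andP; split; lra.
Qed.

Let J_out x : ~ box (a - D) (b + D) (a' - D) (b' + D) x -> J x = 0%E.
Proof.
move=> xB; apply: integral0_eq => z _; rewrite /F /= indicE.
have [|_] := boolP (z \in _); last by rewrite mul0r.
rewrite inE => -[/andP[h1 h2] /andP[h3 h4]].
have [zD|zD] := leP D (modulus (z - x)).
  by rewrite (bump_out g_cont dg1_cvg A3 e0 zD) mulr0.
exfalso; apply: xB; have := le_lt_trans (normr_fst_le (z - x)) zD.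
have := le_lt_trans (normr_snd_le (z - x)) zD; rewrite !ltr_norml /=.
move=> /andP[k1 k2] /andP[k3 k4].
by split; apply/andP; split; lra.
Qed.

Lemma box_compare_inflated : (mu1 (box (a + D) (b - D) (a' + D) (b' - D)) <=
  mu2 (box (a - D) (b + D) (a' - D) (b' + D)))%E.
Proof.
have k0 := bump_mass_gt0 g_cont dg1_cvg A3 c0 cP e0.
have k1 := bump_mass_lty g_cont dg1_cvg A3 c0 cP e0.
have [k kE] : exists k : R, bump_mass g e = k%:E.
  by exists (fine (bump_mass g e)); rewrite fineK// ge0_fin_numE// ltW.
set I := box (a + D) _ _ _; set O := box (a - D) _ _ _.
have mI : measurable I by exact: measurable_box.
have mO : measurable O by exact: measurable_box.
rewrite kE lte_fin in k0.
have k00 : (0 <= k%:E)%E by rewrite lee_fin ltW.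
rewrite -(@lee_pmul2l _ k%:E)//.
have lo : (k%:E * mu1 I <= \int[mu1]_x J x)%E.
  rewrite -(integral_cst mu1 mI k%:E)//.
  apply: (@le_trans _ _ (\int[mu1]_(x in I) J x)%E).
    by rewrite le_eqVlt; apply/orP; left; apply/eqP; apply: eq_integral => x;
       rewrite inE => xI; rewrite J_in.
  exact: ge0_subset_integral.
apply: (le_trans lo); rewrite integral_J.
have -> : (k%:E * mu2 O = \int[mu2]_x (k%:E * (\1_O x)%:E))%E.
  rewrite ge0_integralZl_EFin//; last first.
    by apply/measurable_EFinP; exact: measurable_indic.
  by rewrite integral_indic// setIT.
apply: ge0_le_integral => //.
  apply/measurable_EFinP; apply: measurable_funM => //; exact: measurable_indic.
move=> x _; rewrite indicE; have [xO|xO] := boolP (x \in O).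
  by rewrite mule1 -kE J_le.
by rewrite mule0 J_out// => /mem_set; rewrite -/O (negPf xO).
Qed.

End box_comparison.

Lemma box_le_inflated (a b a' b' d : R) : 0 < d ->
  (mu1 (box a b a' b') <= mu2 (box (a - d) (b + d) (a' - d) (b' + d)))%E.
Proof.
move=> d0; have r1 := rad1_gt0 g.
(* This scale makes the support radius [2 e rad1] of the kernel equal to [d / 2]. *)
pose e := d / (4 * rad1 g); have e0 : 0 < e by rewrite divr_gt0// mulr_gt0.
have E : 2 * e * rad1 g = d / 2 by rewrite /e; field; exact: lt0r_neq0.
have := box_compare_inflated (a - d / 2) (b + d / 2) (a' - d / 2) (b' + d / 2) e0.
rewrite E !subrK !addrK.
have e1 x : x - d / 2 - d / 2 = x - d by field.
have e2 x : x + d / 2 + d / 2 = x + d by field.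
by rewrite !e1 !e2.
Qed.
End comparison.

Lemma le_of_invn (R : realType) (x y : R) : (forall k, x <= y + k.+1%:R^-1) -> x <= y.
Proof.
move=> H; apply/ler_addgt0Pr => e e0.
have := H (Num.bound e^-1); move/le_trans; apply; rewrite lerD2l invf_ple ?posrE//.
by apply: ltW; apply: (lt_le_trans (archi_boundP _)); rewrite ?invr_ge0 ?(ltW e0)// ler_nat.
Qed.

Section measure_determined.
Context {R : realType}.
Variable g : R -> R.
Hypothesis g_cont : {within `[0, 1], continuous g}.
Hypothesis dg1_cvg : cvg ((g 1 - g (1 - h)) / h @[h --> 0^'+]).
Hypothesis A3 : condA3 g.
Variables c : R.
Hypothesis c0 : 0 <= c.
Hypothesis cP : forall r, rad0 g < r < rad1 g ->
  `|derive1 (fun r => alpha0 g r / r) r| <= c.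
Variable nu : probability (R * R)%type R.
Hypothesis nuP : nu0_spec g nu.
Variables (mu1 mu2 : probability (R * R)%type R) (B : R) (P : R * R -> R).
Hypothesis B0 : 0 <= B.
Hypothesis mu1B : mu1 [set y | B < modulus y] = 0%E.
Hypothesis mu2B : mu2 [set y | B < modulus y] = 0%E.
Hypothesis mu1P : forall z, (\int[mu1]_y (ln_dist z y)%:E = (P z)%:E)%E.
Hypothesis mu2P : forall z, (\int[mu2]_y (ln_dist z y)%:E = (P z)%:E)%E.

Let d k : R := k.+1%:R^-1.

Let d0 k : 0 < d k. Proof. by rewrite invr_gt0. Qed.

Let d_le m n : (m <= n)%N -> d n <= d m.
Proof. by move=> mn; rewrite lef_pV2 ?posrE// ler_nat ltnS. Qed.

(** As the inflation tends to 0 the inflated boxes decrease to a closed box, which fits into the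
    half-open one only if the upper ends have been lowered beforehand. *)
Let box_le_lt (a b a' b' b1 b1' : R) : b1 < b -> b1' < b' ->
  (mu1 (box a b1 a' b1') <= mu2 (box a b a' b'))%E.
Proof.
move=> bb bb'; pose F k := box (a - d k) (b1 + d k) (a' - d k) (b1' + d k).
have mF k : measurable (F k) by exact: measurable_box.
have mI : measurable (\bigcap_k F k) by exact: bigcapT_measurable.
have cv : mu2 \o F @ \oo --> mu2 (\bigcap_k F k).
  apply: nonincreasing_cvg_mu => //.
    by apply: le_lt_trans (probability_le1 mu2 (mF 0%N)) _; rewrite ltry.
  move=> m n mn; apply/subsetPset => z [/andP[h1 h2] /andP[h3 h4]]; have dd := d_le mn.
  by split; apply/andP; split; lra.
apply: (@le_trans _ _ (mu2 (\bigcap_k F k))).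
  rewrite -(cvg_lim _ cv)//; apply: lime_ge; first by apply/cvg_ex; eexists; exact: cv.
  by apply: nearW => k; exact: (box_le_inflated g_cont dg1_cvg A3 c0 cP nuP B0 mu1B mu2B mu1P mu2P).
apply: le_measure; rewrite ?inE//; first exact: measurable_box.
move=> z Fz.
have lo1 : a <= z.1 by apply: le_of_invn => k; have [/andP[h _] _] := Fz k I; rewrite -lerBlDr.
have lo2 : a' <= z.2 by apply: le_of_invn => k; have [_ /andP[h _]] := Fz k I; rewrite -lerBlDr.
have up1 : z.1 <= b1 by apply: le_of_invn => k; have [/andP[_ h] _] := Fz k I; exact: ltW.
have up2 : z.2 <= b1' by apply: le_of_invn => k; have [_ /andP[_ h]] := Fz k I; exact: ltW.
by split; apply/andP; split => //; lra.
Qed.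

Let box_le (a b a' b' : R) : (mu1 (box a b a' b') <= mu2 (box a b a' b'))%E.
Proof.
pose F k := box a (b - d k) a' (b' - d k).
have mF k : measurable (F k) by exact: measurable_box.
have FE : box a b a' b' = \bigcup_k F k.
  apply/seteqP; split => [z [/andP[h1 h2] /andP[h3 h4]]|z [k _ [/andP[h1 h2] /andP[h3 h4]]]].
    have e0 : 0 < Num.min (b - z.1) (b' - z.2) by rewrite lt_min !subr_gt0 h2.
    exists (Num.bound (Num.min (b - z.1) (b' - z.2))^-1) => //.
    set n := Num.bound _.
    have : d n < Num.min (b - z.1) (b' - z.2).
      rewrite invf_plt ?posrE//; apply: (lt_le_trans (archi_boundP _)).
        by rewrite invr_ge0 ltW.
      by rewrite ler_nat.
    rewrite lt_min => /andP[k1 k2].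
    by split; apply/andP; split => //; lra.
  by have dk := d0 k; split; apply/andP; split; lra.
have cv : mu1 \o F @ \oo --> mu1 (\bigcup_k F k).
  apply: nondecreasing_cvg_mu => //; first exact: bigcupT_measurable.
  move=> m n mn; apply/subsetPset => z [/andP[h1 h2] /andP[h3 h4]]; have dd := d_le mn.
  by split; apply/andP; split; lra.
rewrite {1}FE -(cvg_lim _ cv)//; apply: lime_le; first by apply/cvg_ex; eexists; exact: cv.
by apply: nearW => k; apply: box_le_lt; rewrite ltrBlDr ltrDl.
Qed.

Lemma measure_le_of_potential A : measurable A -> (mu1 A <= mu2 A)%E.
Proof.
apply: le_measure_dyadic.
- by apply: le_lt_trans (probability_le1 mu1 measurableT) _; rewrite ltry.
- by apply: le_lt_trans (probability_le1 mu2 measurableT) _; rewrite ltry.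
move=> n k; rewrite (_ : cell n k = box (k.1%:~R / 2 ^+ n) ((k.1 + 1)%:~R / 2 ^+ n)
    (k.2%:~R / 2 ^+ n) ((k.2 + 1)%:~R / 2 ^+ n)); first exact: box_le.
by apply/seteqP; split => z /cellE.
Qed.

End measure_determined.

(** * The push-forward of nu_0 is nu_t *)

Section pushforward.
Context {R : realType}.
Variable g : R -> R.
Hypothesis g_cont : {within `[0, 1], continuous g}.
Hypothesis dg1_cvg : cvg ((g 1 - g (1 - h)) / h @[h --> 0^'+]).
Hypothesis A3 : condA3 g.
Variables c t : R.
Hypothesis c0 : 0 <= c.
Hypothesis cP : forall r, rad0 g < r < rad1 g ->
  `|derive1 (fun r => alpha0 g r / r) r| <= c.
Hypothesis t0 : 0 < t.
Hypothesis tc : t * c < 1.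
Variables nu nut : probability (R * R)%type R.
Hypothesis nuP : nu0_spec g nu.
Hypothesis nutP : nut_spec g t nut.
Local Notation T := (transport g t).
Let h (r : R) := alpha0 g r / r.
Let hL := h_lip g_cont dg1_cvg A3 c0 cP.
Let h0 (r : R) : 0 <= r -> 0 <= h r.
Proof. exact: (h_ge0 g_cont dg1_cvg A3). Qed.
Let al0 : alpha0 g 0 = 0 := alpha0_0 g.
Let mT : measurable_fun setT T := measurable_transport g_cont dg1_cvg A3 t c0 cP.

Lemma measurable_modulus_gt (b : R) : measurable [set y : R * R | b < modulus y].
Proof.
rewrite -[X in measurable X]setTI.
exact: (measurable_fun_ltr (measurable_cst b) (@measurable_modulus R)).
Qed.

Lemma measure_bound_le (mu : probability (R * R)%type R) (B B' : R) : B <= B' ->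
  mu [set y | B < modulus y] = 0%E -> mu [set y | B' < modulus y] = 0%E.
Proof.
move=> BB muB; apply/eqP; rewrite eq_le measure_ge0 andbT -muB.
apply: le_measure; rewrite ?inE; try exact: measurable_modulus_gt.
by move=> z /=; exact: le_lt_trans.
Qed.

Lemma compactly_supported_bound (mu : probability (R * R)%type R) :
  compactly_supported mu -> exists2 B, 0 <= B & mu [set y | B < modulus y] = 0%E.
Proof.
move=> [K cK muK]; have [M [_ bK]] := compact_bounded cK.
pose B := 2 * Num.max 0 (M + 1).
have B0 : 0 <= B by rewrite mulr_ge0// le_max lexx.
exists B => //; apply/eqP; rewrite eq_le measure_ge0 andbT -muK; apply: le_measure; rewrite ?inE.
- exact: measurable_modulus_gt.
- by apply: measurable_open_plane; apply: closed_openC; apply: compact_closed => //;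
    exact: norm_hausdorff.
move=> z /= zB Kz; move: zB; apply/negP; rewrite -leNgt.
have : `|z| <= M + 1 by apply: bK => //; rewrite ltrDl.
rewrite prod_normE ge_max => /andP[h1 h2].
apply: (le_trans (modulus_le_add z)); rewrite /B mulr_natl mulr2n.
by apply: lerD; rewrite le_max ?h1 ?h2 orbT.
Qed.

(** At an atom the negative part of [lne] has integral +oo, and subtracting it yields [-oo] whatever
    the positive part is. *)
Lemma potential_no_atom (mu : probability (R * R)%type R) z :
  log_potential mu z \is a fin_num -> mu [set z] = 0%E.
Proof.
have mz := measurable_set1_plane z.
apply: contraTP => /eqP muz; rewrite fin_numE negb_and !negbK; apply/orP; left; apply/eqP.
rewrite /log_potential integralE.
suff -> : (\int[mu]_y (fun y => lne (modulus (z - y))%:E)^\- y = +oo)%E by rewrite addeNy.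
apply/eqP; rewrite -leye_eq.
have <- : (\int[mu]_(y in [set z]) +oo = +oo)%E.
  by rewrite (integral_cst mu mz +oo%E)// gt0_mulye// lt_def measure_ge0 andbT.
apply: (@le_trans _ _ (\int[mu]_(y in [set z]) (fun y => lne (modulus (z - y))%:E)^\- y)%E).
  rewrite le_eqVlt; apply/orP; left; apply/eqP; apply: eq_integral => y.
  by rewrite inE => ->; rewrite funenegE subrr modulus0 /= lexx max_l ?leey.
apply: ge0_subset_integral => //; apply: measurable_funeneg; exact: measurable_lne_dist.
Qed.

Lemma integral_ln_dist_nut z : (\int[nut]_y (ln_dist z y)%:E = (U_ g t z)%:E)%E.
Proof.
have [_ nutU] := nutP.
rewrite -log_potentialE ?nutU//; apply: potential_no_atom.
by rewrite nutU.
Qed.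

Let sigma := distribution nu
  (HB.pack T (isMeasurableFun.Build _ _ _ _ T mT) :
    {mfun (R * R)%type >-> (R * R)%type}).

Lemma sigmaE A : sigma A = nu (T @^-1` A).
Proof. by []. Qed.

Lemma integral_ln_dist_sigma z : (\int[sigma]_y (ln_dist z y)%:E = (U_ g t z)%:E)%E.
Proof.
have [w <-] := transport_surj c0 (ltW t0) tc h0 hL z.
have iL := integrable_L g_cont dg1_cvg A3 c0 cP (ltW t0) tc nuP w.
rewrite integral_distribution//; last first.
  by apply/measurable_EFinP; exact: measurable_ln_dist.
rewrite (U_transport g_cont dg1_cvg A3 c0 cP (ltW t0) tc w t0).
rewrite -(integral_ln_transport g_cont dg1_cvg A3 c0 cP (ltW t0) tc nuP w).
by rewrite fineK//; exact: integrable_fin_num.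
Qed.

Lemma sigma_bound : exists2 B, 0 <= B & sigma [set y | B < modulus y] = 0%E.
Proof.
exists ((1 + t * c) * rad1 g).
  by rewrite mulr_ge0 ?addr_ge0 ?(ltW (rad1_gt0 g))// mulr_ge0// ltW.
rewrite sigmaE; apply/eqP; rewrite eq_le measure_ge0 andbT.
rewrite -(nu_rad1 g_cont dg1_cvg A3 c0 cP nuP).
apply: le_measure; rewrite ?inE.
- rewrite -[X in measurable X]setTI; apply: mT => //; exact: measurable_modulus_gt.
- exact: measurable_modulus_gt.
move=> w /= Tw; have k0 : 0 < 1 + t * c by rewrite ltr_wpDr// mulr_ge0// ltW.
have := transport_lip c0 (ltW t0) h0 hL w 0; rewrite transport0 !subr0 => /(lt_le_trans Tw).
by rewrite ltr_pM2l.
Qed.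

Lemma pushforward_transport A : measurable A -> nu (T @^-1` A) = nut A.
Proof.
move=> mA; have [B1 B10 nutB] := compactly_supported_bound nutP.1.
have [B2 B20 sigB] := sigma_bound.
have BB0 : 0 <= Num.max B1 B2 by rewrite le_max B10.
have le1 : B1 <= Num.max B1 B2 by rewrite le_max lexx.
have le2 : B2 <= Num.max B1 B2 by rewrite le_max lexx orbT.
have nutB' := measure_bound_le le1 nutB; have sigB' := measure_bound_le le2 sigB.
apply/eqP; rewrite eq_le -/(sigma A); apply/andP; split.
- exact: (measure_le_of_potential g_cont dg1_cvg A3 c0 cP nuP BB0 sigB' nutB'
    integral_ln_dist_sigma integral_ln_dist_nut mA).
- exact: (measure_le_of_potential g_cont dg1_cvg A3 c0 cP nuP BB0 nutB' sigB'
    integral_ln_dist_nut integral_ln_dist_sigma mA).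
Qed.

End pushforward.

(** * Bounded densities *)

Section bounded_density.
Context {R : realType}.
Variables (mu : probability (R * R)%type R) (M : R).
Hypothesis M0 : 0 <= M.
Hypothesis muleb : forall A, measurable A -> (mu A <= M%:E * plane_leb A)%E.

Let mu_ac : mu `<< plane_leb.
Proof.
apply/null_content_dominatesP => A mA A0; apply/eqP.
by rewrite eq_le measure_ge0 andbT (le_trans (muleb mA))// A0 mule0.
Qed.

Let f := Radon_Nikodym_SigmaFinite.f mu plane_leb.

Let f0 x : (0 <= f x)%E. Proof. exact: Radon_Nikodym_SigmaFinite.f_ge0. Qed.

Let f_fin x : f x \is a fin_num. Proof. exact: Radon_Nikodym_SigmaFinite.f_fin_num. Qed.

Let mf : measurable_fun setT f.
Proof. exact: measurable_int (Radon_Nikodym_SigmaFinite.f_integrable mu_ac). Qed.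

Let E : set (R * R) := [set x | ((M + 1)%:E < f x)%E].

Let mE : measurable E.
Proof. by rewrite -[E]setTI; exact: emeasurable_fun_o_infty. Qed.

(** [(M + 1) leb E <= mu E <= M leb E] forces [leb E = 0] once it is finite, and finiteness follows
    from [mu E <= 1]. The added 1 makes the gap strict and the factor invertible even if [M = 0]. *)
Let leb_E : plane_leb E = 0%E.
Proof.
have le : ((M + 1)%:E * plane_leb E <= M%:E * plane_leb E)%E.
  apply: le_trans (muleb mE); rewrite (Radon_Nikodym_SigmaFinite.f_integral mu_ac mE).
  rewrite -(integral_cst plane_leb mE (M + 1)%:E).
  apply: ge0_le_integral => //.
  - by move=> x _; rewrite lee_fin addr_ge0.
  - exact: measurable_funS mf.
  - by move=> x /ltW.
have fin : (plane_leb E < +oo)%E.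
  have M1 : 0 < M + 1 by rewrite ltr_wpDl.
  apply: (@le_lt_trans _ _ ((M + 1)^-1%:E * mu E)%E).
    have E1 : plane_leb E = ((M + 1)^-1%:E * ((M + 1)%:E * plane_leb E))%E.
      by rewrite muleA -EFinM mulVf ?lt0r_neq0// mul1e.
    rewrite E1.
    apply: lee_wpmul2l; first by rewrite lee_fin invr_ge0 ltW.
    rewrite (Radon_Nikodym_SigmaFinite.f_integral mu_ac mE).
    rewrite -(integral_cst plane_leb mE (M + 1)%:E).
    apply: ge0_le_integral => //.
    - by move=> x _; rewrite lee_fin addr_ge0.
    - exact: measurable_funS mf.
    - by move=> x /ltW.
  apply: (@le_lt_trans _ _ ((M + 1)^-1%:E * 1)%E); last by rewrite mule1 ltry.
  apply: lee_wpmul2l; first by rewrite lee_fin invr_ge0 ltW.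
  exact: probability_le1.
have [k kE] : exists k : R, plane_leb E = k%:E.
  by exists (fine (plane_leb E)); rewrite fineK// ge0_fin_numE.
have : (0 <= plane_leb E)%E by exact: measure_ge0.
move: le; rewrite kE -!EFinM !lee_fin => h1 h2.
by congr (_%:E); apply/eqP; rewrite eq_le h2 andbT; move: h1; rewrite mulrDl mul1r; lra.
Qed.

Lemma exists_bounded_density : exists p : R * R -> R,
  [/\ measurable_fun setT p, exists M : R, forall z, 0 <= p z <= M &
      forall A, measurable A -> mu A = (\int[leb2]_(z in A) (p z)%:E)%E].
Proof.
(* Truncation changes the density on the null set [E] only and makes the bound hold at every
   point. *)
pose p x := Num.min (fine (f x)) (M + 1).
have mp : measurable_fun setT p.
  apply/measurable_EFinP.
  rewrite (_ : EFin \o p = fun x => Order.min (f x) (M + 1)%:E); first exact: measurable_mine.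
  by apply/funext => x /=; rewrite EFin_min fineK.
have p0 x : 0 <= p x by rewrite le_min fine_ge0//= addr_ge0.
exists p; split => //; first by exists (M + 1) => x; rewrite p0 ge_min lexx orbT.
move=> A mA; rewrite (Radon_Nikodym_SigmaFinite.f_integral mu_ac mA).
change (\int[plane_leb]_(x in A) f x = \int[plane_leb]_(x in A) (p x)%:E)%E.
apply: ge0_ae_eq_integral => //.
- exact: measurable_funS mf.
- by apply/measurable_EFinP; exact: measurable_funS mp.
- by move=> x _; rewrite lee_fin.
exists E; split => // x /=; apply: contra_notP => /negP; rewrite -leNgt => fM _.
have := f_fin x; rewrite fin_numE /p; move: fM (f0 x); case: (f x) => //= r.
by rewrite !lee_fin => rM _ _; rewrite min_l.
Qed.

End bounded_density.

Section lebesgue_domination.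
Context {R : realType}.
Variables (mu : probability (R * R)%type R) (M B : R).
Hypothesis M0 : 0 <= M.
Hypothesis muD : forall z (r : R), 0 < r -> (mu (disc z r) <= (M * r ^+ 2)%:E)%E.
Hypothesis B0 : 0 <= B.
Hypothesis muB : mu [set y | B < modulus y] = 0%E.

Let N := Num.bound B.
Let S : set (int * int) := [set k | (- N%:Z <= k.1 < N%:Z) && (- N%:Z <= k.2 < N%:Z)].
(** A square that carries [mu]. Lebesgue measure restricted to it is finite, as the comparison on
    dyadic cells requires. *)
Let D : set (R * R) := dyadic 0 @^-1` S.

Let mD : measurable D. Proof. exact: measurable_dyadic_preimage. Qed.

Let floor_range (x : R) : `|x| < N%:R -> - N%:Z <= Num.floor x < N%:Z.
Proof.
rewrite ltr_norml => /andP[h1 h2]; have /andP[f1 f2] := floor_itv x.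
apply/andP; split.
  rewrite -ltzD1 -(ltr_int R) rmorphN; exact: lt_trans h1 f2.
by rewrite -(ltr_int R); exact: le_lt_trans f1 h2.
Qed.

Let muDC : mu (~` D) = 0%E.
Proof.
apply/eqP; rewrite eq_le measure_ge0 andbT -muB; apply: le_measure; rewrite ?inE.
- exact: measurableC.
- exact: measurable_modulus_gt.
move=> z /=; apply: contra_notP => /negP; rewrite -leNgt => zB.
have BN : B < N%:R by exact: archi_boundP.
by rewrite /D /S /dyadic /= expr0 !mul1r !floor_range//; apply: le_lt_trans BN;
   apply: le_trans zB; [exact: normr_snd_le|exact: normr_fst_le].
Qed.

Let leb_D : (plane_leb D < +oo)%E.
Proof.
have N0 : (0 : R) <= N%:R by [].
apply: (@le_lt_trans _ _ (plane_leb (box (- N%:R) N%:R (- N%:R) N%:R))).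
  apply: le_measure; rewrite ?inE//; first exact: measurable_box.
  move=> z; rewrite /D /S /dyadic /= expr0 !mul1r => /andP[/andP[h1 h2] /andP[h3 h4]].
  have /andP[f1 f2] := floor_itv z.1; have /andP[f3 f4] := floor_itv z.2.
  split; apply/andP; split.
  - by apply: le_trans f1; rewrite -(ler_int R) rmorphN in h1.
  - by apply: (lt_le_trans f2); rewrite -[N%:R]/(N%:Z%:~R) ler_int lezD1.
  - by apply: le_trans f3; rewrite -(ler_int R) rmorphN in h3.
  - by apply: (lt_le_trans f4); rewrite -[N%:R]/(N%:Z%:~R) ler_int lezD1.
rewrite (_ : plane_leb _ = ((N%:R - - N%:R) * (N%:R - - N%:R))%:E) ?ltry//.
by apply: leb2_box; lra.
Qed.

Let leb_cell n k : plane_leb (cell n k) = (((2 : R) ^+ n)^-1 ^+ 2)%:E.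
Proof.
have p0 : 0 < ((2 : R) ^+ n)^-1 by rewrite invr_gt0 exprn_gt0.
rewrite (_ : cell n k = box (k.1%:~R / 2 ^+ n) ((k.1 + 1)%:~R / 2 ^+ n)
    (k.2%:~R / 2 ^+ n) ((k.2 + 1)%:~R / 2 ^+ n)); last first.
  by apply/seteqP; split => z /cellE.
transitivity ((((k.1 + 1)%:~R / 2 ^+ n - k.1%:~R / 2 ^+ n) *
  ((k.2 + 1)%:~R / 2 ^+ n - k.2%:~R / 2 ^+ n) : R)%:E).
  by apply: leb2_box; rewrite !intrD !mulrDl mul1r lerDl ltW.
by congr (_%:E); rewrite !intrD !mulrDl mul1r; ring.
Qed.

(** A cell lies in the disc about its corner with radius twice its side, whence the factor 4. *)
Let mu_cell n k : (mu (cell n k) <= (4 * M)%:E * plane_leb (cell n k))%E.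
Proof.
have p0 : 0 < ((2 : R) ^+ n)^-1 by rewrite invr_gt0 exprn_gt0.
pose z : R * R := (k.1%:~R / 2 ^+ n, k.2%:~R / 2 ^+ n).
rewrite leb_cell -EFinM.
have -> : 4 * M * ((2 : R) ^+ n)^-1 ^+ 2 = M * (2 * ((2 : R) ^+ n)^-1) ^+ 2 by ring.
apply: le_trans (muD z (mulr_gt0 (ltr0n R 2) p0)).
apply: le_measure; rewrite ?inE; [exact: measurable_cell|exact: measurable_disc|].
move=> y /cellE[/andP[h1 h2] /andP[h3 h4]]; rewrite /disc /= modulusBC.
move: h2 h4; rewrite !intrD !mulrDl mul1r => h2 h4.
apply: (le_lt_trans (modulus_le_add _)) => /=.
rewrite !ger0_norm ?subr_ge0//; lra.
Qed.

Lemma measure_le_lebesgue A : measurable A -> (mu A <= (4 * M)%:E * plane_leb A)%E.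
Proof.
have M40 : 0 <= 4 * M by rewrite mulr_ge0.
pose r : {nonneg R} := NngNum M40.
pose lam : {measure set (R * R) -> \bar R} := mscale r (mrestr plane_leb mD).
have lamE X : lam X = ((4 * M)%:E * plane_leb (X `&` D))%E by [].
move=> mA; apply: (@le_trans _ _ (lam A)); last first.
  rewrite lamE; apply: lee_wpmul2l; first by rewrite lee_fin.
  by apply: le_measure; rewrite ?inE//; exact: measurableI.
move: A mA; apply: le_measure_dyadic.
- by apply: le_lt_trans (probability_le1 mu measurableT) _; rewrite ltry.
- by rewrite lamE setTI; apply: lte_mul_pinfty => //; rewrite lee_fin.
move=> n k; have [rc rcE] := @dyadic_coarsen R 0 n.
(* [D] is a union of unit cells, so a smaller cell lies either inside it or in its null
   complement. *)
have [Sk|Sk] := pselect (S (rc k)).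
  rewrite lamE (_ : cell n k `&` D = cell n k); first exact: mu_cell.
  apply/setIidPl => z zk; rewrite /D /= rcE add0n.
  by rewrite (_ : dyadic n z = k).
apply: (@le_trans _ _ (mu (~` D))); last by rewrite muDC.
apply: le_measure; rewrite ?inE; [exact: measurable_cell|exact: measurableC|].
by move=> z zk; rewrite /D /= rcE add0n (_ : dyadic n z = k).
Qed.

End lebesgue_domination.

(** * Regularity of the transported measure *)

Section plane_calculus.
Context {R : realType}.
Implicit Types z w v m : R * R.

Lemma norm_le_modulus z : `|z| <= modulus z.
Proof. by rewrite prod_normE ge_max normr_fst_le normr_snd_le. Qed.

Lemma modulus_le_norm z : modulus z <= 2 * `|z|.
Proof.
apply: (le_trans (modulus_le_add z)); rewrite mulr_natl mulr2n prod_normE.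
by apply: lerD; rewrite le_max lexx ?orbT.
Qed.

Lemma modulus_lip_continuous (f : R * R -> R * R) (K : R) : 0 <= K ->
  (forall z w, modulus (f z - f w) <= K * modulus (z - w)) -> continuous f.
Proof.
move=> K0 fK z; apply/cvgrPdist_le => e e0.
have d0 : 0 < e / (2 * K + 1) by rewrite divr_gt0// ltr_wpDl// mulr_ge0.
have near_z : \forall w \near (z : R * R), `|z - w| <= e / (2 * K + 1).
  have := nbhsx_ballx (z : R * R) _ d0; apply: filterS => w.
  by rewrite -ball_normE /= => /ltW.
near=> w; have zw : `|z - w| <= e / (2 * K + 1) by near: w.
apply: (le_trans (norm_le_modulus _)); apply: (le_trans (fK z w)).
apply: (@le_trans _ _ (K * (2 * (e / (2 * K + 1))))).
  apply: ler_wpM2l => //; apply: (le_trans (modulus_le_norm _)).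
  by rewrite ler_pM2l.
have k0 : 0 < 2 * K + 1 by rewrite ltr_wpDl// mulr_ge0.
rewrite !mulrA ler_pdivrMr//.
have -> : e * (2 * K + 1) = K * 2 * e + e by ring.
by rewrite lerDl ltW.
Unshelve. all: by end_near. Qed.

Lemma re_mul_linear m : linear (re_mul m : R * R -> R).
Proof. by move=> a u v; rewrite /re_mul /= /GRing.scale /=; ring. Qed.

Lemma continuous_re_mul m : continuous (re_mul m : R * R -> R).
Proof.
by move=> v; apply: cvgB; (apply: cvgM; first exact: cvg_cst); [exact: cvg_fst|exact: cvg_snd].
Qed.

Lemma differentiable_quad (U : R * R -> R) z m (C : R) : 0 <= C ->
  (forall v, `|U (z + v) - U z - re_mul m v| <= C * modulus v ^+ 2) ->
  differentiable U z /\ forall v, 'd U z v = re_mul m v.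
Proof.
move=> C0 UC.
pose L : {linear (R * R)%type -> R} := HB.pack (re_mul m)
  (GRing.isLinear.Build R (R * R)%type R *:%R (re_mul m) (re_mul_linear m)).
have cL : continuous L by exact: continuous_re_mul.
have E : U \o shift z = cst (U z) + L +o_ (0 : R * R) id.
  apply/eqaddoP => e e0.
  have k0 : 0 < C * (2 * 2) + 1 by rewrite ltr_wpDl// mulr_ge0.
  have d0 : 0 < e / (C * (2 * 2) + 1) by rewrite divr_gt0.
  have near0 : \forall v \near (0 : R * R), `|v| <= e / (C * (2 * 2) + 1) by exact: nbhs0_le.
  near=> v.
  rewrite /= !fctE /= opprD addrA [v + z]addrC.
  apply: (le_trans (UC v)).
  have h1 := modulus_le_norm v; have h2 := modulus_ge0 v.
  apply: (@le_trans _ _ (C * (2 * `|v|) ^+ 2)).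
    by apply: ler_wpM2l => //; rewrite ler_sqr ?nnegrE// mulr_ge0.
  rewrite exprMn expr2 mulrA [_ * (`|v| * _)]mulrA; apply: ler_wpM2r => //.
  have zv : `|v| <= e / (C * (2 * 2) + 1).
    by near: v.
  apply: (le_trans (ler_wpM2l _ zv)); first by rewrite mulr_ge0.
  rewrite (mulrA _ e) ler_pdivrMr//.
  have -> : e * (C * (2 * 2) + 1) = C * (2 * 2) * e + e by ring.
  by rewrite lerDl ltW.
have dE := diff_unique cL E.
split; last by move=> v; rewrite dE.
by apply/diff_locallyP; rewrite dE.
Unshelve. all: by end_near. Qed.

End plane_calculus.

(** * The conclusions for nu_t *)

Section conclusions.
Context {R : realType}.
Variable g : R -> R.
Hypothesis g_cont : {within `[0, 1], continuous g}.
Hypothesis dg1_cvg : cvg ((g 1 - g (1 - h)) / h @[h --> 0^'+]).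
Hypothesis A3 : condA3 g.
Variables c t : R.
Hypothesis c0 : 0 <= c.
Hypothesis cP : forall r, rad0 g < r < rad1 g ->
  `|derive1 (fun r => alpha0 g r / r) r| <= c.
Hypothesis t0 : 0 < t.
Hypothesis tc : t * c < 1.
Variables nu nut : probability (R * R)%type R.
Hypothesis nuP : nu0_spec g nu.
Hypothesis nutP : nut_spec g t nut.
Local Notation T := (transport g t).
Local Notation H := (hvec g).
Let h (r : R) := alpha0 g r / r.
Let hL := h_lip g_cont dg1_cvg A3 c0 cP.
Let h0 (r : R) : 0 <= r -> 0 <= h r.
Proof. exact: (h_ge0 g_cont dg1_cvg A3). Qed.
Let al0 : alpha0 g 0 = 0 := alpha0_0 g.
Let push := pushforward_transport g_cont dg1_cvg A3 c0 cP t0 tc nuP nutP.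
Let surj := transport_surj c0 (ltW t0) tc h0 hL.
Let tc0 : 0 < 1 - t * c. Proof. by rewrite subr_gt0. Qed.
Let M := 108 * c.
Let M0 : 0 <= M. Proof. by rewrite mulr_ge0. Qed.
Let nuD z (r : R) : 0 < r -> (nu (disc z r) <= (M * r ^+ 2)%:E)%E.
Proof. exact: (nu_disc_le c0 h0 hL al0 nuP). Qed.
Let Mt := M / (1 - t * c) ^+ 2.
Let Mt0 : 0 <= Mt. Proof. by rewrite divr_ge0// exprn_ge0// ltW. Qed.

(** [transport_expand] places the preimage of a disc about [T w] in a disc about [w] with radius
    larger by the factor [1 / (1 - t c)]. *)
Let nutD z (r : R) : 0 < r -> (nut (disc z r) <= (Mt * r ^+ 2)%:E)%E.
Proof.
move=> r0; have [w <-] := surj z; rewrite -push; last exact: measurable_disc.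
have r'0 : 0 < r / (1 - t * c) by rewrite divr_gt0.
have -> : Mt * r ^+ 2 = M * (r / (1 - t * c)) ^+ 2.
  by rewrite /Mt expr_div_n -mulrA [_^-1 * _]mulrC.
apply: le_trans (nuD w r'0); apply: le_measure; rewrite ?inE.
- rewrite -[X in measurable X]setTI.
  by apply: (measurable_transport g_cont dg1_cvg A3 t c0 cP) => //; exact: measurable_disc.
- exact: measurable_disc.
move=> v; rewrite /disc /= => vr; rewrite ltr_pdivlMr// mulrC.
exact: le_lt_trans (transport_expand c0 (ltW t0) h0 hL w v) vr.
Qed.

Lemma transport_density : exists p : R * R -> R,
  [/\ measurable_fun setT p, exists M : R, forall z, 0 <= p z <= M &
      forall A, measurable A -> nut A = (\int[leb2]_(z in A) (p z)%:E)%E].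
Proof.
have [B B0 nutB] := compactly_supported_bound nutP.1.
apply: (@exists_bounded_density _ nut (4 * Mt)); first by rewrite mulr_ge0.
exact: (measure_le_lebesgue Mt0 nutD B0 nutB).
Qed.

Let C := (2 * c + t * c ^+ 2) / (1 - t * c) ^+ 2.

Let C0 : 0 <= C.
Proof.
have t0' := ltW t0.
by rewrite divr_ge0 ?exprn_ge0 ?(ltW tc0)// addr_ge0 ?mulr_ge0// exprn_ge0.
Qed.

(** Surjectivity turns [T w + v] into some [T u], so the expansion along [T] is one around every
    point of the plane; the coefficient [H w] is at once the gradient of the potential and the
    Stieltjes transform. *)
Lemma U_quad w v : `|U_ g t (T w + v) - U_ g t (T w) - re_mul (H w) v| <= C * modulus v ^+ 2.
Proof.
have [u uE] := surj (T w + v); rewrite -uE.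
rewrite !(U_transport g_cont dg1_cvg A3 c0 cP (ltW t0) tc _ t0).
have -> : v = T u - T w by rewrite uE addrC addKr.
exact: (pot_quad g_cont dg1_cvg A3 c0 cP (ltW t0) tc).
Qed.

Lemma stieltjes_transport w : stieltjes nut (T w) = H w.
Proof.
have [B B0 nutB] := compactly_supported_bound nutP.1.
exact: (stieltjesE Mt0 nutD nutB nutP.2 (U_quad w)).
Qed.

Lemma log_potential_nu w : log_potential nu w = (V g (modulus w) - g 1)%:E.
Proof.
rewrite log_potentialE; last exact: (mu_set1 M0 nuD).
rewrite -(potential_nu g_cont dg1_cvg A3 c0 cP nuP w) fineK//.
exact: integrable_fin_num (integrable_ln_dist_nu g_cont dg1_cvg A3 c0 cP nuP w).
Qed.

Lemma stieltjes_nu w : stieltjes nu w = H w.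
Proof.
apply: (stieltjesE (C := 2 * c) M0 nuD (nu_rad1 g_cont dg1_cvg A3 c0 cP nuP) log_potential_nu) => v.
have := V_quad_plane g_cont dg1_cvg A3 c0 cP w (w + v).
rewrite [w + v]addrC addrK /re_mul.
have -> // : V g (modulus (v + w)) - g 1 - (V g (modulus w) - g 1) =
  V g (modulus (v + w)) - V g (modulus w).
ring.
Qed.

Lemma stieltjes_lip z z' : modulus (stieltjes nut z - stieltjes nut z') <=
  c / (1 - t * c) * modulus (z - z').
Proof.
have [w <-] := surj z; have [w' <-] := surj z'; rewrite !stieltjes_transport.
apply: (le_trans (hvec_lip c0 h0 hL w w')); rewrite -mulrA; apply: ler_wpM2l => //.
rewrite mulrC ler_pdivlMr// mulrC.
exact: (transport_expand c0 (ltW t0) h0 hL).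
Qed.

Lemma continuous_stieltjes : continuous (stieltjes nut).
Proof.
apply: (modulus_lip_continuous _ stieltjes_lip).
by rewrite divr_ge0// ltW.
Qed.

Lemma C1_potential : C1 (fun z => fine (log_potential nut z)).
Proof.
have dU z : differentiable (U_ g t) z /\ forall v, 'd (U_ g t) z v = re_mul (stieltjes nut z) v.
  have [w <-] := surj z; rewrite stieltjes_transport.
  exact: (differentiable_quad C0 (U_quad w)).
rewrite (_ : (fun z => _) = U_ g t); last by apply/funext => z; rewrite nutP.2.
split => [z|v]; first by have [] := dU z.
rewrite (_ : (fun z => _) = fun z => re_mul (stieltjes nut z) v); last first.
  by apply/funext => z; have [_ ->] := dU z.
move=> z; have cs : {for z, continuous (stieltjes nut)} by exact: continuous_stieltjes.
apply: cvgB; (apply: cvgM; last exact: cvg_cst).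
  exact: (cvg_comp _ _ cs cvg_fst).
exact: (cvg_comp _ _ cs cvg_snd).
Qed.

(** [nu0_spec] speaks of open discs. Circles carry no mass, because [alpha0_diff] bounds the mass of
    thin shells. *)
Lemma nu_modulus_le s : 0 <= s -> nu [set w | modulus w <= s] = (alpha0 g s)%:E.
Proof.
move=> s0; have ms : measurable [set w : R * R | modulus w <= s].
  rewrite (_ : mkset _ = ~` [set w : R * R | s < modulus w]).
    by apply: measurableC; exact: measurable_modulus_gt.
  by apply/seteqP; split => w /=; rewrite leNgt => /negP.
have fin : nu [set w | modulus w <= s] \is a fin_num by exact: fin_num_measure.
apply/eqP; rewrite eq_le; apply/andP; split; last first.
  rewrite -(nu_modulus_lt al0 nuP s0); apply: le_measure; rewrite ?inE//.
    exact: measurable_modulus_lt.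
  by move=> w /= /ltW.
rewrite -(fineK fin) lee_fin; apply/ler_addgt0Pr => e e0.
pose k := c * (2 * s + 1) + 1.
have k0 : 0 < k by rewrite ltr_wpDl// mulr_ge0// addr_ge0// mulr_ge0.
pose d := Num.min 1 (e / k).
have d0 : 0 < d by rewrite lt_min ltr01 divr_gt0.
have d1 : d <= 1 by rewrite ge_min lexx.
have dk : d * k <= e by rewrite -ler_pdivlMr// ge_min lexx orbT.
have sd : s <= s + d by rewrite lerDl ltW.
have sd0 : 0 <= s + d by exact: le_trans sd.
have : (nu [set w | (modulus w <= s)%R] <= (alpha0 g (s + d))%:E)%E.
  rewrite -(nu_modulus_lt al0 nuP sd0); apply: le_measure; rewrite ?inE//.
    exact: measurable_modulus_lt.
  by move=> w /= /le_lt_trans; apply; rewrite ltrDl.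
rewrite -(fineK fin) lee_fin => /le_trans; apply.
have := alpha0_diff h0 hL al0 s0 sd; rewrite [s + d - s]addrC addKr => /ler_normlW.
have : c * (s + d + s) * d <= k * d.
  apply: ler_wpM2r; first exact: ltW.
  rewrite /k -[X in X <= _]addr0; apply: lerD => //; apply: ler_wpM2l => //; lra.
by move: dk; rewrite [d * k]mulrC; lra.
Qed.

Lemma preimage_Eset s : 0 < s -> T @^-1` (Eset g s t) = [set w | modulus w <= s].
Proof.
move=> s0.
have E z : Eset g s t z = (ell g t s z <= 1) by rewrite /Eset /ell /axis1 /axis2 /= !mulrA.
apply/seteqP; split => w; rewrite /preimage /= E.
  by apply: contraTT; rewrite -!ltNge; exact: (ell_transport_gt (ltW t0) tc h0 hL s0).
rewrite le_eqVlt => /predU1P[ws|ws]; last first.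
  by apply: ltW; exact: (ell_transport_lt (ltW t0) tc h0 hL s0 ws).
have w0 : w != 0 by rewrite -modulus_gt0 ws.
by rewrite -ws (ell_transport_eq (ltW t0) tc h0 hL w0).
Qed.

Let measurable_quadric (p q : R) :
  measurable_fun setT (fun z : R * R => z.1 ^+ 2 / p + z.2 ^+ 2 / q).
Proof.
by apply: measurable_funD; apply: measurable_funM => //; apply: measurable_funX.
Qed.

Let measurable_quadric_le (p q : R) :
  measurable [set z : R * R | z.1 ^+ 2 / p + z.2 ^+ 2 / q <= 1].
Proof.
have := measurable_quadric p q measurableT (measurable_itv `]-oo, 1%R]).
by rewrite setTI; congr measurable; apply/seteqP; split => y /=; rewrite in_itv.
Qed.

Let measurable_quadric_lt (p q : R) :
  measurable [set z : R * R | z.1 ^+ 2 / p + z.2 ^+ 2 / q < 1].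
Proof.
have := measurable_quadric p q measurableT (measurable_itv `]-oo, 1%R[).
by rewrite setTI; congr measurable; apply/seteqP; split => y /=; rewrite in_itv.
Qed.

Lemma nut_Eset s : 0 < s -> nut (Eset g s t) = (alpha0 g s)%:E.
Proof.
move=> s0; rewrite -push; last exact: measurable_quadric_le.
by rewrite preimage_Eset// nu_modulus_le// ltW.
Qed.

Lemma nut_Rset : nut (Rset g t) = 1%E.
Proof.
have r1 := rad1_gt0 g; have r0 := rad0_ge0 g.
have r01 := rad0_lt_rad1 g_cont dg1_cvg A3.
rewrite -push; last first.
  by apply: measurableI; [exact: measurable_modulus_gt|exact: measurable_quadric_lt].
have -> : T @^-1` (Rset g t) = [set w | modulus w < rad1 g] `\` [set w | modulus w <= rad0 g].
  apply/seteqP; split => w /=.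
    move=> /(Rset_transport g_cont dg1_cvg A3 c0 cP (ltW t0) tc) /andP[h1 h2].
    by split => //; apply/negP; rewrite -ltNge.
  move=> [h1 /negP]; rewrite -ltNge => h2.
  by apply/(Rset_transport g_cont dg1_cvg A3 c0 cP (ltW t0) tc); rewrite h1 h2.
have ml : measurable [set w : R * R | modulus w < rad1 g] by exact: measurable_modulus_lt.
have mr : measurable [set w : R * R | modulus w <= rad0 g].
  rewrite (_ : mkset _ = ~` [set w : R * R | rad0 g < modulus w]).
    by apply: measurableC; exact: measurable_modulus_gt.
  by apply/seteqP; split => w /=; rewrite leNgt => /negP.
rewrite measureD//; last by apply: le_lt_trans (probability_le1 nu ml) _; rewrite ltry.
have -> : [set w : R * R | modulus w < rad1 g] `&` [set w | modulus w <= rad0 g] =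
    [set w | modulus w <= rad0 g].
  by apply/seteqP; split => [w []//|w /= wr]; split => //; exact: le_lt_trans wr r01.
transitivity ((alpha0 g (rad1 g))%:E - (alpha0 g (rad0 g))%:E)%E.
  by rewrite -(nu_modulus_lt al0 nuP (ltW r1)) -(nu_modulus_le r0).
by rewrite (alpha0_ge_rad1 g_cont dg1_cvg A3)// (alpha0_le_rad0 g_cont A3)// sube0.
Qed.

Lemma alpha0_interior r : rad0 g < r < rad1 g -> 0 < alpha0 g r < 1.
Proof.
move=> /andP[r0 r1]; have r00 : 0 <= r.
  exact: le_trans (rad0_ge0 g) (ltW r0).
have [[]|[a a01 [_ ->//]]|[]] := alpha0_cases g_cont dg1_cvg A3 r00.
- by rewrite leNgt r0.
- by rewrite leNgt r1.
Qed.

Lemma is_derive_transport w : is_derive t 1 (fun s : R => transport g s w) (H w).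
Proof.
rewrite (_ : (fun s => _) = fun s => w + s *: H w); last by apply/funext => s; exact: transportE.
have cv : h^-1 *: (((fun s => w + s *: H w) \o shift t) (h *: 1) - (w + t *: H w))
    @[h --> 0^'] --> H w.
  apply: cvg_near_cst; near=> s.
  have s0 : s != 0 by near: s; exact: nbhs_dnbhs_neq.
  rewrite /= opprD addrACA subrr add0r -scalerBl [s *: 1]mulr1 addrK.
  by rewrite scalerA mulVf// scale1r.
by split; [apply: cvgP cv|exact: cvg_lim cv].
Unshelve. all: by end_near. Qed.

Lemma log_potential_transport w : log_potential nut (T w) =
  (log_potential nu w +
   ((alpha0 g (modulus w)) ^+ 2 / 2 * complex.Re (t%:C / cplx w ^+ 2))%:E)%E.
Proof.
rewrite nutP.2 log_potential_nu -EFinD; congr (_%:E).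
rewrite (U_transport g_cont dg1_cvg A3 c0 cP (ltW t0) tc _ t0) /pot /V.
have -> : complex.Re (t%:C / cplx w ^+ 2) = t * complex.Re (cplx w ^- 2).
  by case: (cplx w ^- 2) => x y /=; rewrite mul0r subr0.
ring.
Qed.

Lemma stieltjes_integrable_nut z : stieltjes_integrable nut z.
Proof. exact: (stieltjes_integrableP Mt0 nutD). Qed.

Lemma stieltjes_integrable_nu z : stieltjes_integrable nu z.
Proof. exact: (stieltjes_integrableP M0 nuD). Qed.

End conclusions.

Theorem theorem3p3 (R : realType) (d : measure_display)
    (Omega : measurableType d) (P : probability Omega R)
    (xi : nat -> {RV P >-> (R * R)%type}) (coef : nat -> nat -> R[i])
    (g : R -> R) (t : R) (nu0 nut : probability (R * R)%type R)
    (hA1 : condA1 xi) (hA2 : condA2 g coef) (hA3 : condA3 g)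
    (hnu0 : zero_limit P xi coef 0 nu0) (hnu0' : nu0_spec g nu0)
    (hnut : zero_limit P xi coef t nut) (hnut' : nut_spec g t nut)
    (t_gt0 : 0 < t) (t_lt : (t%:E < t_sing g)%E) :
  (* (a) *)
  [/\ [/\ forall A : set (R * R), measurable A ->
            pushforward nu0 (transport g t) A = nut A,
          nut (Rset g t) = 1%E &
          forall s : R, 0 < s -> nut (Eset g s t) = (alpha0 g s)%:E],
  (* (b) *)
      exists p : R * R -> R,
        [/\ measurable_fun setT p,
            exists M : R, forall z, 0 <= p z <= M &
            forall A : set (R * R), measurable A ->
              nut A = (\int[leb2]_(z in A) (p z)%:E)%E],
  (* (c) *)
      [/\ forall z, stieltjes_integrable nut z,
          continuous (stieltjes nut) &
          forall w : R * R, w <> 0 ->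
            [/\ stieltjes nut (transport g t w) = stieltjes nu0 w,
                stieltjes_integrable nu0 w,
                stieltjes nu0 w =
                  plane ((alpha0 g (modulus w))%:C / cplx w) &
                is_derive t 1 (fun s : R => transport g s w)
                  (plane ((alpha0 g (modulus w))%:C / cplx w))]],
  (* (d) *)
      (forall z, Rset g t z ->
         unique_maximizer01 (fun a => (f_ g t z a)%:E) (alpha_ g t z) /\
         0 < alpha_ g t z < 1) /\
      (forall w : R * R,
         unique_maximizer01 (fun a => (f_ g t (transport g t w) a)%:E)
           (alpha_ g t (transport g t w)) /\
         alpha_ g t (transport g t w) = alpha0 g (modulus w)) &
  (* (e) *)
      [/\ forall z, log_potential nut z \is a fin_num,
          C1 (fun z => fine (log_potential nut z)) &
          forall w : R * R, w <> 0 ->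
            log_potential nut (transport g t w) =
            (log_potential nu0 w +
             ((alpha0 g (modulus w)) ^+ 2 / 2 *
              complex.Re (t%:C / cplx w ^+ 2))%:E)%E]].
Proof.
have [g_cont _ _ dg1_cvg] := hA2.
have [c [c0 tc cP]] := t_sing_lip t_gt0 t_lt.
have t0 := ltW t_gt0.
have hL := h_lip g_cont dg1_cvg hA3 c0 cP.
have h0 := h_ge0 g_cont dg1_cvg hA3.
have surj := transport_surj c0 t0 tc h0 hL.
have hvecE w : hvec g w = plane ((alpha0 g (modulus w))%:C / cplx w).
  by rewrite -hvec_cplx cplxK.
split.
- split; first exact: (pushforward_transport g_cont dg1_cvg hA3 c0 cP t_gt0 tc hnu0' hnut').
    exact: (nut_Rset g_cont dg1_cvg hA3 c0 cP t_gt0 tc hnu0' hnut').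
  exact: (nut_Eset g_cont dg1_cvg hA3 c0 cP t_gt0 tc hnu0' hnut').
- exact: (transport_density g_cont dg1_cvg hA3 c0 cP t_gt0 tc hnu0' hnut').
- split.
  + exact: (stieltjes_integrable_nut g_cont dg1_cvg hA3 c0 cP t_gt0 tc hnu0' hnut').
  + exact: (continuous_stieltjes g_cont dg1_cvg hA3 c0 cP t_gt0 tc hnu0' hnut').
  move=> w _; rewrite -hvecE; split.
  + rewrite (stieltjes_nu g_cont dg1_cvg hA3 c0 cP hnu0').
    exact: (stieltjes_transport g_cont dg1_cvg hA3 c0 cP t_gt0 tc hnu0' hnut').
  + exact: (stieltjes_integrable_nu g_cont dg1_cvg hA3 c0 cP hnu0').
  + exact: (stieltjes_nu g_cont dg1_cvg hA3 c0 cP hnu0').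
  + exact: is_derive_transport.
- split => [z|w].
    have [w <-] := surj z => /(Rset_transport g_cont dg1_cvg hA3 c0 cP t0 tc) wr.
    rewrite (alpha_transport g_cont dg1_cvg hA3 c0 cP t0 tc w t_gt0); split.
      exact: (f_max g_cont dg1_cvg hA3 c0 cP t0 tc w t_gt0).
    exact: (alpha0_interior g_cont dg1_cvg hA3).
  rewrite (alpha_transport g_cont dg1_cvg hA3 c0 cP t0 tc w t_gt0); split => //.
  exact: (f_max g_cont dg1_cvg hA3 c0 cP t0 tc w t_gt0).
- split.
  + by move=> z; rewrite hnut'.2.
  + exact: (C1_potential g_cont dg1_cvg hA3 c0 cP t_gt0 tc hnu0' hnut').
  + move=> w _.
    exact: (log_potential_transport g_cont dg1_cvg hA3 c0 cP t_gt0 tc hnu0' hnut').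
Qed.
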